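(* Let $p=2$ and $m=2$. For $1\le k\le 2$, $k<n$, let $\mu_{\alpha_{kn}}$ be a probability measure on $\mathbb F_2$ with $\mu_{\alpha_{kn}}(r)=\alpha_{kn}(r)>0$, $r\in\mathbb F_2$, and let $\mu_\alpha=\mu_\alpha^1\otimes\mu_\alpha^2$, $\mu^k_\alpha=\bigotimes_{n=k+1}^\infty\mu_{\alpha_{kn}}$, be the product measure on $X^2$. Put $c_{kn}=2\sqrt{\alpha_{kn}(0)\alpha_{kn}(1)}$. The quasiregular representation $T^{R,\mu_\alpha,2}$ of $B_0^{\mathbb N}(\mathbb F_2)$ on $L^2(X^2,\mu_\alpha)$ is irreducible if and only if both of the following conditions hold: 1) $(\mu_\alpha)^{L_{I+E_{12}}}\perp\mu_\alpha$, which is equivalent to $S^L_{12}(\mu_\alpha):=\sum_{n=3}^\infty\alpha_{2n}(1)(1-c_{1n})=\infty$; 2) $\mu_\alpha^2\perp\mu_{inv}^2$, which is equivalent to $S^L_{22}(\mu_\alpha):=\sum_{n=3}^\infty(1-c_{2n})=\infty$.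
   Context: $B_0^{\mathbb N}(\mathbb F_2)$ is the group of infinite upper triangular matrices $I+\sum_{1\le k<n}x_{kn}E_{kn}$ over $\mathbb F_2$ with only finitely many $x_{kn}\neq0$ ($E_{kn}$ are matrix units). $X^2$ is the set of arrays $x=(x_{kn})_{1\le k\le 2,\,k<n}$, $x_{kn}\in\mathbb F_2$, viewed as the first two rows of an infinite upper triangular matrix with units on the diagonal (so $x_{kk}=1$, $x_{21}=0$). The right action of $t\in B_0^{\mathbb N}(\mathbb F_2)$ on $X^2$ is $R_t(x)=xt^{-1}$ (product of the $2\times\infty$ matrix $x$ with $t^{-1}$). The representation is $$(T^{R,\mu_\alpha,2}_tf)(x)=\Big(\frac{d\mu_\alpha(R_t^{-1}(x))}{d\mu_\alpha(x)}\Big)^{1/2}f(R_t^{-1}(x)),\qquad f\in L^2(X^2,\mu_\alpha).$$ $L_{I+E_{12}}$ is left multiplication of $x$ by $\begin{pmatrix}1&1\\0&1\end{pmatrix}$, i.e. $(x_{1n},x_{2n})\mapsto(x_{1n}+x_{2n},x_{2n})$ for $n\ge3$ and $x_{12}\mapsto x_{12}+1$. For a bijection $f$, $\mu^f(\Delta)=\mu(f^{-1}(\Delta))$. $\mu^2_{inv}=\bigotimes_{n=3}^\infty\mu_{inv}$, where $\mu_{inv}(r)=1/2$ for $r\in\mathbb F_2$. $\perp$ means mutually singular. *)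

(* Defs.v *)
From HB Require Import structures.
From mathcomp Require Import all_boot all_order all_algebra.
From mathcomp Require Import all_classical all_reals all_analysis.
From mathcomp Require Import measurable_realfun complex.

Set Implicit Arguments.
Unset Strict Implicit.
Unset Printing Implicit Defensive.

Import Order.TTheory GRing.Theory Num.Theory.
Import numFieldNormedType.Exports.

Local Open Scope classical_set_scope.
Local Open Scope ring_scope.

(* Rows and columns are numbered from 1, as on paper.  A matrix is a function
   nat -> nat -> 'F_2 whose unused row 0 and column 0 agree with the identity
   matrix. *)
Notation infmx := (nat -> nat -> 'F_2).

Definition infmx1 : infmx := fun k n => (k == n)%:R.

(* Products are taken with an upper triangular right factor, so the column n
   of t vanishes below row n. *)
Definition infmx_mul (s t : infmx) : infmx :=
  fun k n => \sum_(j < n.+1) s k j * t j n.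

Definition B0_pred (t : infmx) : Prop :=
  (forall k n, k = 0%N \/ (n <= k)%N -> t k n = (k == n)%:R) /\
  finite_set [set kn : nat * nat | (kn.1 < kn.2)%N /\ t kn.1 kn.2 != 0].

Definition B0_bool : pred infmx := fun t => `[< B0_pred t >].

Record B0 := MkB0 { B0_mx :> infmx; B0_mxP : B0_bool B0_mx }.

HB.instance Definition _ := [isSub for B0_mx].
HB.instance Definition _ := [Choice of B0 by <:].

Section B0_group.
Implicit Types (t : infmx).

Lemma B0_predP t : B0_pred t <->
  (forall k n, k = 0%N \/ (n <= k)%N -> t k n = (k == n)%:R) /\
  exists N, forall k n, (k < n)%N -> (N <= n)%N -> t k n = 0.
Proof.
split=> -[ut ft]; split=> //.
  move: ft => /finite_seqP[s sE].
  exists (\sum_(i <- s) i.2.+1)%N => k n kn Nn.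
  apply/eqP; apply: contraT => tkn.
  have ks : (k, n) \in s by have : [set` s] (k, n) by rewrite -sE.
  by move: Nn; rewrite (big_rem (k, n) ks)/= addSn ltnNge leq_addr.
case: ft => N tN; apply: (@sub_finite_set _ _ (`I_N `*` `I_N)); last first.
  exact: finite_setX.
move=> [k n] /= [kn]; have [Nn|nN _] := leqP N n; first by rewrite tN ?eqxx.
by split=> //; exact: ltn_trans nN.
Qed.

Lemma B0_upper (t : B0) k n : k = 0%N \/ (n <= k)%N -> t k n = (k == n)%:R.
Proof. by have /asboolP[ut _] := B0_mxP t; exact: ut. Qed.

Lemma B0_lt0 (t : B0) k n : (n < k)%N -> t k n = 0.
Proof.
by move=> nk; rewrite B0_upper ?gtn_eqF//; right; exact: ltnW.
Qed.

Lemma B0_bounded (t : B0) :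
  exists N, forall k n, (k < n)%N -> (N <= n)%N -> t k n = 0.
Proof. by have /asboolP/B0_predP[] := B0_mxP t. Qed.

Lemma infmx1_B0 : B0_bool infmx1.
Proof.
apply/asboolP/B0_predP; split=> //; exists 0%N => k n kn _.
by rewrite /infmx1 ltn_eqF.
Qed.

Lemma infmx_mul_B0 (s t : B0) : B0_bool (infmx_mul s t).
Proof.
apply/asboolP/B0_predP; split=> [k n kn|].
  rewrite /infmx_mul big_ord_recr /= (@B0_upper t n n); last by right.
  rewrite eqxx mulr1 (B0_upper s kn) big1 ?add0r// => j _.
  case: kn => [->|nk].
    rewrite (@B0_upper s); last by left.
    case: (altP (0%N =P j :> nat)) => [<-|]; last by rewrite mul0r.
    rewrite (@B0_upper t); last by left.
    by rewrite (@ltn_eqF 0 n) ?mulr0//; apply: leq_ltn_trans (ltn_ord j).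
  by rewrite B0_lt0 ?mul0r// (leq_trans (ltn_ord j)).
have [N sN] := B0_bounded s; have [M tM] := B0_bounded t.
exists (maxn N M) => k n kn; rewrite geq_max => /andP[Nn Mn].
rewrite /infmx_mul big_ord_recr /= (sN k n)// mul0r addr0.
by apply: big1 => j _; rewrite tM ?mulr0.
Qed.

Definition B0_mul (s t : B0) : B0 := MkB0 (infmx_mul_B0 s t).
Definition B0_one : B0 := MkB0 infmx1_B0.

Lemma B0_eq (s t : B0) : (forall k n, s k n = t k n) -> s = t.
Proof.
by move=> st; apply: val_inj => /=; apply/funext => k; apply/funext => n.
Qed.

Lemma B0_mulA : associative B0_mul.
Proof.
move=> s t u; apply: B0_eq => k n /=; rewrite /infmx_mul.
under eq_bigr do rewrite big_distrr/=.
rewrite exchange_big/=.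
apply: eq_bigr => j _; under eq_bigr do rewrite mulrA.
rewrite -big_distrl/=; congr (_ * _).
rewrite [RHS](big_ord_widen n.+1 (fun i => s k i * t i j)) ?ltn_ord//.
rewrite [RHS]big_mkcond/=; apply: eq_bigr => i _.
by case: ltnP => ji //; rewrite (B0_lt0 t ji) mulr0.
Qed.

Lemma B0_mul1 : left_id B0_one B0_mul.
Proof.
move=> t; apply: B0_eq => k n /=; rewrite /infmx_mul /infmx1.
have [nk|kn] := ltnP n k.
  rewrite B0_lt0// big1// => j _; rewrite gtn_eqF ?mul0r//.
  by apply: leq_ltn_trans nk; rewrite -ltnS.
rewrite (bigD1 (Ordinal (kn : k < n.+1)%N))//= eqxx mul1r big1 ?addr0// => j.
by rewrite -val_eqE/= eq_sym => /negPf->; rewrite mul0r.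
Qed.

Lemma B0_mulr1 : right_id B0_one B0_mul.
Proof.
move=> t; apply: B0_eq => k n /=; rewrite /infmx_mul /infmx1.
rewrite big_ord_recr/= eqxx mulr1 big1 ?add0r// => j _.
by rewrite ltn_eqF ?mulr0.
Qed.

(* Neumann series for the inverse: the entry (k, n) is constant from the
   iteration n + 1 on. *)
Fixpoint infmx_inv_iter t m : infmx :=
  if m is m'.+1 then
    fun k n => (k == n)%:R - \sum_(j < n) infmx_inv_iter t m' k j * t j n
  else infmx1.

Definition infmx_inv t : infmx := fun k n => infmx_inv_iter t n.+1 k n.

Lemma infmx_inv_iterE t m k n :
  (n < m)%N -> infmx_inv_iter t m k n = infmx_inv t k n.
Proof.
elim/ltn_ind: n m => n IH [//|m]; rewrite ltnS => nm; rewrite /infmx_inv /=.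
congr (_ - _); apply: eq_bigr => j _.
by rewrite !IH// (leq_trans _ nm).
Qed.

Lemma infmx_invE t k n :
  infmx_inv t k n = (k == n)%:R - \sum_(j < n) infmx_inv t k j * t j n.
Proof.
rewrite {1}/infmx_inv /=; congr (_ - _); apply: eq_bigr => j _.
by rewrite infmx_inv_iterE.
Qed.

Lemma infmx_inv_B0 (t : B0) : B0_bool (infmx_inv t).
Proof.
have inv0 k n : k = 0%N \/ (n <= k)%N -> infmx_inv t k n = (k == n)%:R.
  elim/ltn_ind: n => n IH kn; rewrite infmx_invE big1 ?subr0// => j _.
  rewrite IH//; last first.
    by case: kn => [|nk]; [left|right; exact/ltnW/(leq_trans (ltn_ord j))].
  case: (altP (k =P j :> nat)) => [kj|]; last by rewrite mul0r.
  case: kn => [k0|nk]; last by move: (ltn_ord j); rewrite -kj ltnNge nk.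
  rewrite -kj k0 B0_upper; last by left.
  by rewrite (@ltn_eqF 0 n) ?mulr0//; apply: leq_ltn_trans (ltn_ord j).
apply/asboolP/B0_predP; split=> //.
have [N tN] := B0_bounded t; exists N => k n kn Nn.
rewrite infmx_invE ltn_eqF// big1 ?subr0// => j _.
by rewrite tN ?mulr0.
Qed.

Definition B0_inv (t : B0) : B0 := MkB0 (infmx_inv_B0 t).

Lemma B0_mulV : left_inverse B0_one B0_inv B0_mul.
Proof.
move=> t; apply: B0_eq => k n /=; rewrite /infmx_mul /infmx1 big_ord_recr/=.
rewrite (@B0_upper t n n); last by right.
by rewrite eqxx mulr1 [X in _ + X]infmx_invE subrKC.
Qed.

Lemma B0_mulrV : right_inverse B0_one B0_inv B0_mul.
Proof.
move=> t; rewrite -[LHS]B0_mul1 -{1}(B0_mulV (B0_inv t)) -B0_mulA.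
by rewrite [X in B0_mul _ X]B0_mulA B0_mulV B0_mul1 B0_mulV.
Qed.

HB.instance Definition _ := isGroup.Build B0
  B0_mulA B0_mul1 B0_mulr1 B0_mulV B0_mulrV.

End B0_group.

HB.instance Definition _ := isPointed.Build 'F_2 0.
HB.instance Definition _ := @isMeasurable.Build default_measure_display
  'F_2 discrete_measurable discrete_measurable0
  discrete_measurableC discrete_measurableU.

Section row_space.
Variable k : nat.

Definition row_index := {n : nat | (k < n)%N}.

Definition row_coordinates : set (set (row_index -> 'F_2)) :=
  [set A | exists i B, A = [set x | B (x i)]].

(* The entries right of the diagonal in row k, with the product
   sigma-algebra. *)
Definition row_space := g_sigma_algebraType row_coordinates.

HB.instance Definition _ := Measurable.on row_space.

Lemma measurable_row_coord (i : row_index) :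
  measurable_fun setT (fun x : row_space => x i).
Proof.
move=> _ B _; rewrite setTI; apply: sub_sigma_algebra.
by exists i, B.
Qed.

Lemma measurable_fun_row d (T : measurableType d) (f : T -> row_space) :
  (forall i, measurable_fun setT (fun t => f t i)) -> measurable_fun setT f.
Proof.
move=> mf; apply: (@measurability _ _ T row_space setT f row_coordinates) => //.
move=> _ [_ [i [B ->]] <-].
exact: (mf i measurableT B).
Qed.

(* The diagonal and the zeros to its left are added back to the row. *)
Definition row_val (x : row_space) (n : nat) : 'F_2 :=
  if insub n is Some i then x i else (n == k)%:R.

Definition row_cylinder (N : nat) (a : row_space) : set row_space :=
  [set x | forall i : row_index, (val i < N)%N -> x i = a i].

End row_space.

Section row_product.
Context {R : realType} (mu : nat -> probability 'F_2 R).

(* The product of the measures mu n over the columns n > k is determined by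
   its values on cylinders (lemmas row_product_exists, row_product_unique). *)
Definition is_row_product k (P : probability (row_space k) R) : Prop :=
  forall N (a : row_space k), P (row_cylinder N a) =
    (\prod_(k.+1 <= n < N) fine (mu n [set row_val a n]))%:E.

Section existence.
Variable k : nat.

Let p j : R := fine (mu (k.+1 + j)%N [set 0%R]).

Let F2E (r : 'F_2) : r = 0 \/ r = 1.
Proof. by case: r => -[|[|//]] ?; [left|right]; exact/val_inj. Qed.

Let mu1 j : fine (mu (k.+1 + j)%N [set 1%R]) = 1 - p j.
Proof.
set n := (k.+1 + j)%N.
have mT : mu n setT = (mu n [set 0%R] + mu n [set 1%R])%E.
  rewrite -measureU//; last by apply/seteqP; split => // x [/= -> /eqP].
  by congr (mu n _); apply/seteqP; split => // r _; exact: F2E.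
have f0 : mu n [set 0%R] \is a fin_num by exact: fin_num_measure.
have f1 : mu n [set 1%R] \is a fin_num by exact: fin_num_measure.
move: mT; rewrite probability_setT.
rewrite -[X in (X + _)%E](fineK f0) -[X in (_ + X)%E](fineK f1).
by rewrite -EFinD /p -/n => -[->]; rewrite addrAC subrr add0r.
Qed.

Let p_ge0 n : 0 <= p n.
Proof. exact: fine_ge0. Qed.

Let p_le1 n : 0 <= 1 - p n.
Proof. by rewrite -mu1 fine_ge0. Qed.

(* Repeated subdivision of [0, 1): at step j the current interval, given by
   its left end and its length, is cut in the proportion p j to 1 - p j. *)
Let cut j (al : R * R) : R := al.1 + al.2 * p j.

Let step (b : 'F_2) j (al : R * R) : R * R :=
  if b == 0 then (al.1, al.2 * p j) else (cut j al, al.2 * (1 - p j)).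

Let bitat (u : R) j (al : R * R) : 'F_2 := (~~ (u < cut j al))%:R.

Let state (u : R) n : R * R :=
  iteri n (fun j al => step (bitat u j al) j al) (0, 1).

Let bit (u : R) n : 'F_2 := bitat u n (state u n).

Let path (w : nat -> 'F_2) n : R * R := iteri n (fun j => step (w j) j) (0, 1).

Let bitat0 u j al : (bitat u j al == 0) = (u < cut j al).
Proof. by rewrite /bitat; case: (u < _). Qed.

Let path_bounds w n :
  [/\ 0 <= (path w n).1, 0 <= (path w n).2 & (path w n).1 + (path w n).2 <= 1].
Proof.
elim: n => [|n [h1 h2 h3]]; first by split=> //=; rewrite add0r.
rewrite /path/= -/(path w n) /step /cut; case: ifP => _ /=; split=> //.
- exact: mulr_ge0.
- apply: le_trans h3; rewrite lerD2l ler_piMr// -subr_ge0; exact: p_le1.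
- by rewrite addr_ge0// mulr_ge0.
- exact: mulr_ge0.
- by rewrite -addrA -mulrDr subrKC mulr1.
Qed.

Let bit_path w u n : 0 <= u < 1 ->
  (forall j, (j < n)%N -> bit u j = w j) <->
  (path w n).1 <= u < (path w n).1 + (path w n).2.
Proof.
move=> u01.
suff : ((forall j, (j < n)%N -> bit u j = w j) -> state u n = path w n /\
         (path w n).1 <= u < (path w n).1 + (path w n).2) /\
       ((path w n).1 <= u < (path w n).1 + (path w n).2 ->
         state u n = path w n /\ (forall j, (j < n)%N -> bit u j = w j)).
  by move=> [h1 h2]; split=> [/h1[]//|/h2[]//].
elim: n => [|n [IH1 IH2]]; first by split=> //=; rewrite add0r.
have key : state u n = path w n ->
    (path w n).1 <= u < (path w n).1 + (path w n).2 ->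
    (bit u n = w n <->
     (path w n.+1).1 <= u < (path w n.+1).1 + (path w n.+1).2).
  move=> st /andP[un un']; rewrite /bit st /path/= -/(path w n).
  have [->|->] := F2E (w n); rewrite /step /=.
    rewrite -/(cut n (path w n)) un/= -(bitat0 u n).
    by split=> [/eqP|/eqP].
  rewrite /= -addrA -mulrDr subrKC mulr1 un' andbT leNgt -(bitat0 u n).
  split=> [->//|b0]; have [b|//] := F2E (bitat u n (path w n)).
  by rewrite b eqxx in b0.
have sub : (path w n.+1).1 <= u < (path w n.+1).1 + (path w n.+1).2 ->
    (path w n).1 <= u < (path w n).1 + (path w n).2.
  have [h1 h2 h3] := path_bounds w n.
  rewrite /path/= -/(path w n) /step /cut; case: ifP => _ /= /andP[ua ub].
    rewrite ua/= (lt_le_trans ub)// lerD2l ler_piMr// -subr_ge0.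
    exact: p_le1.
  rewrite (le_trans _ ua) ?lerDl ?mulr_ge0//=.
  by move: ub; rewrite -addrA -mulrDr subrKC mulr1.
have stS : state u n = path w n -> bit u n = w n ->
    state u n.+1 = path w n.+1.
  rewrite /bit => st b; rewrite /state /path/= -/(state u n) -/(path w n).
  by rewrite b st.
split=> [h|h].
  have [st itv] := IH1 (fun j jn => h j (ltnW jn)).
  have bn := h n (ltnSn n).
  by split; [exact: stS|apply/key].
have [st hn] := IH2 (sub h).
have bn : bit u n = w n by apply/key => //; exact: sub.
split; first exact: stS.
by move=> j; rewrite ltnS leq_eqVlt => /predU1P[->//|]; exact: hn.
Qed.

Let path_length w n :
  (path w n).2 = \prod_(j < n) fine (mu (k.+1 + j)%N [set w j]).
Proof.
elim: n => [|n IH]; first by rewrite big_ord0.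
rewrite big_ord_recr/= -IH /path/= -/(path w n) /step.
by have [->|->] := F2E (w n); rewrite /= ?mu1.
Qed.

Let measurable_state n :
  measurable_fun setT (fun u => (state u n).1) /\
  measurable_fun setT (fun u => (state u n).2) /\
  measurable_fun setT (fun u : R => u < cut n (state u n)).
Proof.
elim: n => [|n [m1 [m2 mb]]].
  split; first exact: measurable_cst.
  split; first exact: measurable_cst.
  by apply: measurable_fun_ltr;
    [exact: measurable_id|exact: (measurable_cst (cut 0 (0, 1)))].
have m1' : measurable_fun setT (fun u => (state u n.+1).1).
  rewrite [X in measurable_fun _ X](_ : _ = fun u =>
    if u < cut n (state u n) then (state u n).1 else cut n (state u n)).
    apply: measurable_fun_ifT => //; apply: measurable_funD => //.
    by apply: measurable_funM.
  by apply/funext => u; rewrite /state/= /step bitat0; case: ifP.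
have m2' : measurable_fun setT (fun u => (state u n.+1).2).
  rewrite [X in measurable_fun _ X](_ : _ = fun u =>
    if u < cut n (state u n) then (state u n).2 * p n
    else (state u n).2 * (1 - p n)).
    by apply: measurable_fun_ifT => //; apply: measurable_funM.
  by apply/funext => u; rewrite /state/= /step bitat0; case: ifP.
split=> //; split=> //.
apply: measurable_fun_ltr => //; apply: measurable_funD => //.
exact: measurable_funM.
Qed.

Let mix (u : R) : row_space k := fun i => bit u (val i - k.+1).

Let measurable_mix : measurable_fun setT mix.
Proof.
apply: measurable_fun_row => i.
rewrite /mix /bit; set n := (_ - _)%N.
rewrite [X in measurable_fun _ X](_ : _ = fun u =>
  if u < cut n (state u n) then 0 else 1); last first.
  by apply/funext => u; rewrite /bitat; case: ifP.
have [_ [_ mb]] := measurable_state n.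
by apply: measurable_fun_ifT => //; exact: measurable_cst.
Qed.

Let mixL : measurableTypeR R -> row_space k := mix.

Let measurable_mixL : measurable_fun setT mixL.
Proof. exact: measurable_mix. Qed.

HB.instance Definition _ := isMeasurableFun.Build _ _ _ _ mixL measurable_mixL.

Let leb01 := mrestr (@lebesgue_measure R) (measurable_itv `[0%R, 1%R[).

HB.instance Definition _ := Measure.on leb01.

Let leb01_setT : leb01 setT = 1%E.
Proof.
by rewrite /leb01/= /mrestr setTI lebesgue_measure_itv/= lte01 oppr0 adde0.
Qed.

HB.instance Definition _ := Measure_isProbability.Build _ _ _ leb01 leb01_setT.

Lemma row_product_exists : exists P, @is_row_product k P.
Proof.
exists (distribution leb01 mixL) => N a.
pose w j := row_val a (k.+1 + j).
have [h1 h2 h3] := path_bounds w (N - k.+1).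
rewrite /distribution /pushforward /mixL /= /leb01 /mrestr.
rewrite (_ : _ `&` _ = `[(path w (N - k.+1)).1,
    (path w (N - k.+1)).1 + (path w (N - k.+1)).2[%classic); last first.
  apply/seteqP; split=> u /=; rewrite !in_itv/=.
    move=> [um u01]; apply/(bit_path w _ u01) => j jN.
    have kj : (k < k.+1 + j)%N by rewrite addSn ltnS leq_addr.
    pose i : row_index k := @exist nat (fun n => k < n)%N _ kj.
    have ui : mixL u i = a i by apply: um; rewrite /= -ltn_subRL.
    have ij : (val i - k.+1)%N = j by exact: addKn.
    by rewrite -ij -[LHS]/(mixL u i) ui ij /w /row_val insubT.
  move=> uI; have u01 : 0 <= u < 1.
    move/andP: uI => [ua ub]; rewrite (le_trans h1 ua)/=.
    exact: lt_le_trans ub h3.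
  split=> // i iN; have ki : (k < val i)%N := valP i.
  have /(bit_path w _ u01) bw := uI.
  rewrite -[LHS]/(bit u (val i - k.+1)) bw; last first.
    by rewrite ltn_sub2r// (leq_ltn_trans ki iN).
  by rewrite /w subnKC// /row_val valK.
rewrite lebesgue_measure_itv/= lte_fin ltrDl path_length.
rewrite -EFinD addrAC subrr add0r.
have -> : \prod_(k.+1 <= n < N) fine (mu n [set row_val a n]) =
    \prod_(j < N - k.+1) fine (mu (k.+1 + j)%N [set w j]).
  rewrite -{1}[k.+1]add0n big_addn big_mkord.
  by apply: eq_bigr => j _; rewrite addnC.
case: ltP => //; rewrite -path_length => h.
by congr EFin; apply/eqP; rewrite eq_le h2 h.
Qed.

End existence.

Definition row_product k : probability (row_space k) R :=
  sval (cid (row_product_exists k)).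

Lemma row_productE k : is_row_product (row_product k).
Proof. by rewrite /row_product; case: cid. Qed.

End row_product.

Section row_product_unique.
Variable k : nat.

Let cyl : set (set (row_space k)) :=
  [set A | A = set0 \/ exists N a, A = row_cylinder N a].

Lemma measurable_row_cylinder N (a : row_space k) :
  measurable (row_cylinder N a).
Proof.
pose F n : set (row_space k) :=
  [set x | (k < n < N)%N -> row_val x n = row_val a n].
rewrite (_ : row_cylinder N a = \bigcap_n F n).
  apply: bigcapT_measurable => n.
  have [kn|kn] := boolP (k < n)%N; last first.
    rewrite (_ : F n = setT)//; apply/seteqP; split=> // x _ /andP[].
    by rewrite (negPf kn).
  have [nN|nN] := boolP (n < N)%N; last first.
    rewrite (_ : F n = setT)//; apply/seteqP; split=> // x _ /andP[].
    by rewrite (negPf nN).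
  apply: sub_sigma_algebra.
  pose i : row_index k := @exist nat (fun n => k < n)%N _ kn.
  exists i, [set a i]; apply/seteqP; split=> x /=.
    by rewrite /F/= kn nN /row_val insubT => /(_ isT).
  by rewrite /F/= kn nN /row_val insubT.
apply/seteqP; split=> x /= h.
  move=> n _ /andP[kn nN]; rewrite /row_val insubT; exact: h.
move=> i iN; have := h (val i) I; rewrite /F/= iN (valP i) => /(_ isT).
by rewrite /row_val valK.
Qed.

Lemma row_measurableE : @measurable _ (row_space k) = <<s cyl >>.
Proof.
apply/seteqP; split; last first.
  apply: smallest_sub; first exact: sigma_algebra_measurable.
  move=> A [->|[N [a ->]]]; first exact: measurable0.
  exact: measurable_row_cylinder.
apply: smallest_sub; first exact: smallest_sigma_algebra.
move=> A [i [B ->]].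
pose a (t : {ffun 'I_(val i).+1 -> 'F_2}) : row_space k :=
  fun j => t (inord (val j)).
rewrite (_ : [set x | B (x i)] =
    \bigcup_(t in [set t | B (a t i)]) row_cylinder (val i).+1 (a t)).
  apply: (@fin_bigcup_measurable _ (g_sigma_algebraType cyl)).
    exact: finite_finset.
  by move=> t _; apply: sub_sigma_algebra; right; exists (val i).+1, (a t).
apply/seteqP; split=> x /=.
  move=> Bx; pose t := [ffun j : 'I_(val i).+1 => row_val x j].
  have tE j : (val j < (val i).+1)%N -> a t j = x j.
    by move=> ji; rewrite /a ffunE inordK// /row_val valK.
  by exists t => [|j ji] /=; rewrite tE.
by move=> [t /= Bt] xt; rewrite xt.
Qed.

Lemma row_product_unique {R : realType} (mu : nat -> probability 'F_2 R)
    (P Q : probability (row_space k) R) :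
  is_row_product mu P -> is_row_product mu Q ->
  forall A, measurable A -> P A = Q A.
Proof.
move=> hP hQ; apply: (measure_unique cyl (fun=> setT)) => //.
- exact: row_measurableE.
- move=> A B; case=> [->|[N [a ->]]]; first by rewrite set0I; left.
  case=> [->|[M [b ->]]]; first by rewrite setI0; left.
  have [[x [xa xb]]|nx] := pselect (exists x,
       row_cylinder N a x /\ row_cylinder M b x).
    right; exists (maxn N M), x; apply/seteqP; split=> y /=.
      move=> [ya yb] i; rewrite leq_max => /orP[iN|iM].
        by rewrite (ya _ iN) (xa _ iN).
      by rewrite (yb _ iM) (xb _ iM).
    move=> yx; split=> i iN; rewrite yx ?leq_max ?iN ?orbT//; first exact: xa.
    exact: xb.
  left; apply/seteqP; split=> // x [xa xb]; apply: nx; by exists x.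
- by move=> _; right; exists 0%N, point; apply/seteqP; split.
- by rewrite bigcup_const//; exists 0%N.
- by move=> A [->|[N [a ->]]]; [rewrite !measure0|
    exact: etrans (hP N a) (esym (hQ N a))].
- by move=> _; rewrite [X in (X < _)%E](@probability_setT _ _ _ P) ltry.
Qed.

End row_product_unique.

Section uniform_F2.
Context {R : realType}.

Let half : {nonneg R} := (2^-1)%:nng.

(* The Haar measure of 'F_2 (lemma mu_invE). *)
Definition mu_inv : set 'F_2 -> \bar R := mscale half (@counting 'F_2 R).

HB.instance Definition _ := Measure.on mu_inv.

Lemma mu_invE (r : 'F_2) : mu_inv [set r] = (2^-1)%:E.
Proof.
rewrite /mu_inv /mscale /= /counting asboolT//.
by rewrite fset_set1 finmap.cardfs1 mule1.
Qed.

Let mu_inv_setT : mu_inv [set: 'F_2] = 1%E.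
Proof.
have -> : [set: 'F_2] = [set 0] `|` [set 1].
  apply/seteqP; split=> // -[[|[|//]] ?] _; [left|right]; exact/val_inj.
rewrite measureU//; last by apply/seteqP; split => // x [/= -> /eqP].
rewrite [X in (X + _)%E](mu_invE 0) [X in (_ + X)%E](mu_invE 1).
by rewrite -EFinD -[X in (X + _)%:E]mul1r -[X in (_ + X)%:E]mul1r -splitr.
Qed.

HB.instance Definition _ :=
  Measure_isProbability.Build _ _ _ mu_inv mu_inv_setT.

End uniform_F2.

Section action.

(* The array (x_1n, x_2n), as the pair of its rows. *)
Definition X2 := (row_space 1 * row_space 2)%type.

(* The entries right of the diagonal of the product of a row by t; those up to
   the diagonal are unchanged (lemma row_val_mul). *)
Definition row_mul k (x : row_space k) (t : B0) : row_space k :=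
  fun i => \sum_(j < (val i).+1) row_val x j * t j (val i).

(* x |-> x t^-1 *)
Definition R_act (t : B0) (x : X2) : X2 :=
  (row_mul x.1 (t^-1)%g, row_mul x.2 (t^-1)%g).

(* Left multiplication by I + E_12; the entry (1, 2) receives x_22 = 1. *)
Definition L12 (x : X2) : X2 :=
  (fun i => x.1 i + row_val x.2 (val i), x.2).

Lemma measurable_F2_op d (T : measurableType d) (op : 'F_2 -> 'F_2 -> 'F_2)
    (f g : T -> 'F_2) :
  measurable_fun setT f -> measurable_fun setT g ->
  measurable_fun setT (fun x => op (f x) (g x)).
Proof.
move=> mf mg _ B _; rewrite setTI.
rewrite (_ : _ @^-1` B =
  \bigcup_(ab in [set ab : 'F_2 * 'F_2 | B (op ab.1 ab.2)])
    (f @^-1` [set ab.1] `&` g @^-1` [set ab.2])).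
  apply: fin_bigcup_measurable => // ab _; apply: measurableI.
    by rewrite -[X in measurable X]setTI; exact: mf.
  by rewrite -[X in measurable X]setTI; exact: mg.
apply/seteqP; split=> x /= => [Bx|[[a b] /= Bab [-> ->]]//].
by exists (f x, g x).
Qed.

Lemma measurable_row_val k n :
  measurable_fun setT (fun x : row_space k => row_val x n).
Proof.
rewrite /row_val; case: insub => [i|]; first exact: measurable_row_coord.
exact: measurable_cst.
Qed.

Lemma measurable_row_mul k (t : B0) :
  measurable_fun setT (fun x : row_space k => row_mul x t).
Proof.
apply: measurable_fun_row => i; rewrite /row_mul.
elim: (index_enum _) => [|j s IH].
  rewrite [X in measurable_fun _ X](_ : _ = fun=> 0).
    exact: measurable_cst.
  by apply/funext => x; rewrite big_nil.
rewrite [X in measurable_fun _ X](_ : _ = fun x : row_space k =>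
    row_val x j * t j (val i) + \sum_(l <- s) row_val x l * t l (val i)).
  apply: (measurable_F2_op +%R) => //.
  apply: (measurable_F2_op *%R); last exact: measurable_cst.
  exact: measurable_row_val.
by apply/funext => x; rewrite big_cons.
Qed.

Lemma measurable_R_act t : measurable_fun setT (R_act t).
Proof.
apply/measurable_fun_pairP; split.
  exact: (measurableT_comp (measurable_row_mul t^-1%g) measurable_fst).
exact: (measurableT_comp (measurable_row_mul t^-1%g) measurable_snd).
Qed.

HB.instance Definition _ t :=
  isMeasurableFun.Build _ _ _ _ (R_act t) (measurable_R_act t).

Lemma row_val_le k (x : row_space k) n :
  (n <= k)%N -> row_val x n = (n == k)%:R.
Proof. by move=> nk; rewrite /row_val insubF// ltnNge nk. Qed.

Lemma row_val_mul k (x : row_space k) t n :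
  (0 < k)%N -> row_val (row_mul x t) n = \sum_(j < n.+1) row_val x j * t j n.
Proof.
move=> k0; have [nk|kn] := leqP n k; last by rewrite {1}/row_val insubT.
rewrite row_val_le// big_ord_recr/= (@B0_upper t n n); last by right.
rewrite eqxx mulr1 row_val_le// big1 ?add0r// => j _.
have jk : (j < k)%N := leq_trans (ltn_ord j) nk.
by rewrite row_val_le ?ltn_eqF ?mul0r// ltnW.
Qed.

Lemma row_mulA k (x : row_space k) (s t : B0) :
  (0 < k)%N -> row_mul (row_mul x s) t = row_mul x (s * t)%g.
Proof.
move=> k0; apply/funext => i; rewrite /row_mul.
under eq_bigr do rewrite row_val_mul//.
rewrite [RHS](eq_bigr (fun j : 'I_(val i).+1 =>
  \sum_(l < (val i).+1) row_val x j * (s j l * t l (val i)))); last first.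
  by move=> j _; rewrite big_distrr.
rewrite exchange_big/=; apply: eq_bigr => j _.
under [RHS]eq_bigr do rewrite mulrA.
rewrite -big_distrl/=; congr (_ * _).
rewrite (big_ord_widen (val i).+1 (fun l => row_val x l * s l j)) ?ltn_ord//.
rewrite big_mkcond/=; apply: eq_bigr => l _.
by case: ltnP => jl //; rewrite (B0_lt0 s jl) mulr0.
Qed.

Lemma row_mul1 k (x : row_space k) : row_mul x 1%g = x.
Proof.
apply/funext => i; rewrite /row_mul big_ord_recr/= /infmx1 eqxx mulr1.
rewrite big1 ?add0r; first by rewrite /row_val valK.
by move=> j _; rewrite ltn_eqF ?mulr0.
Qed.

Lemma R_actK t : cancel (R_act t) (R_act t^-1%g).
Proof.
by case=> x1 x2; rewrite /R_act/= invgK !row_mulA// mulVg !row_mul1.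
Qed.

End action.

Section representation.
Local Open Scope complex_scope.
Local Open Scope charge_scope.
Context {R : realType} (mu : probability X2 R).

Definition sqr_norm (z : R[i]) : R := complex.Re z ^+ 2 + complex.Im z ^+ 2.

(* Elements of L^2 are handled through their representatives; all the
   notions below are invariant under almost everywhere equality. *)
Definition L2 : set (X2 -> R[i]) := [set f |
  [/\ measurable_fun setT (fun x => complex.Re (f x)),
      measurable_fun setT (fun x => complex.Im (f x)) &
      (\int[mu]_x (sqr_norm (f x))%:E < +oo)%E]].

(* The measure x |-> mu (R_t^-1 x) is the image of mu under R_t, and R_t^-1 is
   the action of t^-1 (lemma R_actK).  The Radon-Nikodym derivative of the
   library is a fixed representative. *)
Definition T_rep (t : B0) (f : X2 -> R[i]) : X2 -> R[i] := fun x =>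
  (Num.sqrt (fine
    (('d (charge_of_finite_measure (distribution mu (R_act t))) '/d mu) x)))%:C
  * f (R_act t^-1%g x).

(* Closedness under L^2 limits includes closedness under almost everywhere
   equality (constant sequences). *)
Definition closed_subspace (V : set (X2 -> R[i])) : Prop :=
  [/\ V `<=` L2,
      V (cst 0),
      (forall c f g, V f -> V g -> V (fun x => c * f x + g x)) &
      forall (u : nat -> X2 -> R[i]) f, (forall n, V (u n)) -> L2 f ->
        (\int[mu]_x (sqr_norm (u n x - f x))%:E)%E @[n --> \oo] --> 0%E ->
        V f].

(* L2 is not the zero space, since mu is a probability measure. *)
Definition irreducible (T : B0 -> (X2 -> R[i]) -> X2 -> R[i]) : Prop :=
  forall V, closed_subspace V -> (forall t f, V f -> V (T t f)) ->
    (forall f, V f -> {ae mu, forall x, f x = 0}) \/ V = L2.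

End representation.

Definition mutually_singular d (T : measurableType d) (R : realType)
    (m1 m2 : set T -> \bar R) : Prop :=
  exists A, [/\ measurable A, m1 A = 0%E & m2 (~` A) = 0%E].

Section data.
Context {R : realType} (mu : nat -> nat -> probability 'F_2 R).

Definition alpha k n (r : 'F_2) : R := fine (mu k n [set r]).

Definition c_coef k n : R := 2 * Num.sqrt (alpha k n 0 * alpha k n 1).

Definition mu_row k : probability (row_space k) R := row_product (mu k) k.

Definition mu_alpha : probability X2 R := (mu_row 1 \x mu_row 2)%E.

Definition mu_inv_row2 : probability (row_space 2) R :=
  row_product (fun=> mu_inv) 2.

Definition S_L12 : \bar R :=
  (\sum_(3 <= n <oo) (alpha 2 n 1 * (1 - c_coef 1 n))%:E)%E.

Definition S_L22 : \bar R := (\sum_(3 <= n <oo) (1 - c_coef 2 n)%:E)%E.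

End data.

(* Submission.v *)
(* Let m be mu_alpha and let V be a closed invariant subspace.  If both sums
   diverge, the columns n >= 3 can be cut into consecutive blocks on which the
   products of the c_1n, and those of the c_2n, tend to 0.  For k >= 3 let b_j be
   I plus the sum of the E_kn over the j-th block: the averages of the T_{b_j}
   converge strongly to multiplication by the indicator function of the set where
   the column k of x vanishes.  Conjugating by the group, V is stable under
   multiplication by functions of s x, where s x is the one of x and L12 x with
   x_12 = 0, that is, by the L12-invariant functions; when L12 m and m are
   singular to each other, these are all the functions.  By ergodicity V is 0 or L^2.

   Conversely, let k be L12 m, respectively m with its second row replaced by the
   uniform one.  If k and m are not singular to each other, ergodicity gives a
   density h of k with respect to m, and h (x t) D_t x = D'_t x h x, where D_t
   and D'_t are the densities of the translates of m and k.  Explicit functions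
   of h then give f and w, both nonzero, such that f is orthogonal to all
   translates of w: f = sqrt (min (1, h)) and w = (-1)^x_12 f in the first case,
   w = sqrt h and f = (-1)^x_23 w in the second one.

   The equivalences with the divergence of the sums are Kakutani's theorem. *)

Require Import Defs.
From HB Require Import structures.
From mathcomp Require Import all_boot all_order all_algebra.
From mathcomp Require Import all_classical all_reals all_analysis.
From mathcomp Require Import measurable_realfun complex ring lra zify.

Import Order.TTheory GRing.Theory Num.Theory.
Import numFieldNormedType.Exports.
Local Open Scope classical_set_scope.
Local Open Scope ring_scope.

Set Implicit Arguments.
Unset Strict Implicit.
Unset Printing Implicit Defensive.

(** * Coordinates with finitely many values, and approximation by cylinders *)

Section coordinates.
Context d (T : measurableType d) (R : realType) (J : finType).
Variable z : nat -> T -> J.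

(** An array is treated as a sequence of columns, each with values in a finite set. A group element
    changes finitely many columns, so its density is an explicit quotient of finite products, and
    [L12] acts on each column separately. Translation by [b_j] multiplies functions of the early
    columns by a weight that is 1 where column [k] vanishes. Elsewhere the weight is a product over
    the block, whose integral is a product of affinities bounded by the [c_1n] or by the [c_2n]; the
    weights of disjoint blocks are therefore nearly orthogonal and average out. The obstacle is
    [x_12]: after conjugation by the group, column [n] enters only through [x_2n] and
    [x_1n + x_12 x_2n], both unchanged by [L12]. The singularity of [L12 m] and [m] is what recovers
    [x_12]. In the first reducible case [h (L12 x) = 1 / h x], and [Num.min 1 h] is a bounded
    solution of [phi (1 / h) * h = phi h]. In the second one the uniform second row makes [D'_t] a
    function of the first row alone, so that a sign depending on [x_23] integrates to 0 against
    it. *)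

Definition prefix N (x : T) : {ffun 'I_N -> J} := [ffun n : 'I_N => z n x].

Definition level {U : Type} N (f : T -> U) :=
  forall x y, (forall n, (n < N)%N -> z n x = z n y) -> f x = f y.

Definition cylinder (A : set T) := exists N, level N A.

Lemma level_le U N M (f : T -> U) : (N <= M)%N -> level N f -> level M f.
Proof. by move=> NM fN x y xy; apply: fN => n nN; apply: xy; exact: leq_trans NM. Qed.

Lemma level_prefix U N (f : T -> U) : level N f ->
  forall x y, prefix N x = prefix N y -> f x = f y.
Proof.
move=> fN x y /ffunP xy; apply: fN => n nN.
by have := xy (Ordinal nN); rewrite !ffunE.
Qed.

Lemma level_comp2 U1 U2 U N (op : U1 -> U2 -> U) (f : T -> U1) (g : T -> U2) :
  level N f -> level N g -> level N (fun x => op (f x) (g x)).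
Proof. by move=> fN gN x y xy; rewrite (fN x y)// (gN x y). Qed.

Lemma cylinderC A : cylinder A -> cylinder (~` A).
Proof. by case=> N AN; exists N => x y xy; rewrite /setC /mkset (AN x y). Qed.

Lemma cylinderU A B : cylinder A -> cylinder B -> cylinder (A `|` B).
Proof.
case=> N AN [M BM]; exists (maxn N M) => x y xy; rewrite /setU /mkset.
rewrite (level_le (leq_maxl N M) AN (x := x) (y := y))//.
by rewrite (level_le (leq_maxr N M) BM (x := x) (y := y)).
Qed.

Lemma cylinder0 : cylinder set0. Proof. by exists 0%N. Qed.

Hypothesis measurableE : @measurable _ T = <<s cylinder >>.

Lemma measurable_cylinder A : cylinder A -> measurable A.
Proof. by move=> cA; rewrite measurableE; exact: sub_sigma_algebra. Qed.

Lemma level_fiber N i : level N [set x | prefix N x = i].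
Proof.
move=> x y xy; rewrite /mkset; congr (_ = i).
by apply/ffunP => n; rewrite !ffunE xy.
Qed.

Lemma measurable_fiber N i : measurable [set x | prefix N x = i].
Proof. by apply: measurable_cylinder; exists N; exact: level_fiber. Qed.

Lemma measurable_level N (f : T -> R) : level N f -> measurable_fun setT f.
Proof.
move=> fN _ B mB; rewrite setTI; apply: measurable_cylinder; exists N => x y xy.
by rewrite /preimage /mkset (fN x y).
Qed.

(** Some prefixes may be realized by no point, as for matrices with forced entries; there [g] is 0,
    which keeps it nonnegative. *)
Lemma levelE N (f : T -> R) : level N f ->
  exists g : {ffun {ffun 'I_N -> J} -> R}, (forall x, f x = g (prefix N x)) /\
  ((forall x, 0 <= f x) -> forall i, 0 <= g i).
Proof.
move=> fN; exists [ffun i => match pselect (exists x, prefix N x = i) with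
  left h => f (sval (cid h)) | right _ => 0 end]; split=> [x|f0 i]; rewrite ffunE.
  case: pselect => [h|[]]; last by exists x.
  by case: cid => y /= yx; exact/(level_prefix fN)/esym.
by case: pselect.
Qed.

(** The sets approximated by cylinders form a sigma-algebra. A countable union is reduced to a
    finite one by continuity of the finite measure [m] along the decreasing remainders [G n]. *)
Lemma cylinder_approx (m : {measure set T -> \bar R}) : (m setT < +oo)%E ->
  forall E, measurable E -> forall e : R, 0 < e ->
    exists2 A, cylinder A & (m (A `+` E) < e%:E)%E.
Proof.
move=> mfin.
pose H : set (set T) := [set E | measurable E /\ forall e : R, 0 < e ->
  exists2 A, cylinder A & (m (A `+` E) < e%:E)%E].
suff sH : <<s cylinder >> `<=` H by move=> E; rewrite measurableE => /sH[].
have mY A E : cylinder A -> measurable E -> measurable (A `+` E).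
  move=> /measurable_cylinder mA mE.
  by apply: measurableU; exact: measurableD.
have HU A B : H A -> H B -> H (A `|` B).
  move=> [mA hA] [mB hB]; split; first exact: measurableU.
  move=> e e0; have e20 : 0 < e / 2 by rewrite divr_gt0.
  have [A' cA' A'e] := hA _ e20; have [B' cB' B'e] := hB _ e20.
  exists (A' `|` B'); first exact: cylinderU.
  rewrite [e]splitr EFinD; apply: le_lt_trans (lteD A'e B'e).
  apply: le_trans (measureU2 m (mY _ _ cA' mA) (mY _ _ cB' mB)).
  apply: le_measure; rewrite ?inE; [|apply: measurableU; exact: mY|].
    by apply: mY; [exact: cylinderU|exact: measurableU].
  by move=> x [[[?|?] /not_orP[? ?]]|[[?|?] /not_orP[? ?]]];
    [left; left|right; left|left; right|right; right].
have HT (F : (set T)^nat) : (forall n, H (F n)) -> forall n, H (\big[setU/set0]_(k < n) F k).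
  move=> HF; elim=> [|n IH].
    rewrite big_ord0; split=> // e e0; exists set0; first exact: cylinder0.
    by rewrite setYK measure0 lte_fin.
  by rewrite big_ord_recr/=; exact: HU.
apply: smallest_sub; last first.
  move=> A cA; split; first exact: measurable_cylinder.
  by move=> e e0; exists A => //; rewrite setYK measure0 lte_fin.
split.
- split=> // e e0; exists set0; first exact: cylinder0.
  by rewrite setYK measure0 lte_fin.
- move=> A [mA hA]; rewrite setTD; split; first exact: measurableC.
  move=> e /hA[B cB Be]; exists (~` B); first exact: cylinderC.
  rewrite (_ : _ `+` _ = B `+` A)//.
  apply/seteqP; split=> x; rewrite /setY/=; last first.
    by move=> [[Bx Ax]|[Ax Bx]]; [right|left]; split.
  by move=> [[Bx /contrapT Ax]|[Ax /contrapT Bx]]; [right|left].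
- move=> F HF; have mF n : measurable (F n) by have [] := HF n.
  have mU : measurable (\bigcup_n F n) by exact: bigcupT_measurable.
  split=> // e e0.
  pose G n := \bigcup_n F n `\` \big[setU/set0]_(k < n) F k.
  have mB n : measurable (\big[setU/set0]_(k < n) F k) by have [] := HT F HF n.
  have mG n : measurable (G n) by exact: measurableD.
  have cG : m (G n) @[n --> \oo] --> m (\bigcap_n G n).
    apply: nonincreasing_cvg_mu => //.
    - by apply: le_lt_trans mfin; apply: le_measure; rewrite ?inE.
    - exact: bigcapT_measurable.
    - move=> n k nk; apply/subsetPset; apply: setDS.
      exact: subset_bigsetU.
  have G0 : \bigcap_n G n = set0.
    apply/seteqP; split=> // x Gx; have [[k _ Fk] _] := Gx 0%N I.
    have [_] := Gx k.+1 I; apply; rewrite -bigcup_mkord; by exists k => /=.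
  rewrite G0 measure0 in cG.
  have e20 : 0 < e / 2 by rewrite divr_gt0.
  have [n Gn] : exists n, (m (G n) < (e / 2)%:E)%E.
    have /fine_cvgP[fG] := cG; move/cvgr_lt => /(_ (e / 2)) /= /(_ e20) lG.
    near \oo => n; exists n.
    have fn : m (G n) \is a fin_num by near: n.
    by rewrite -(fineK fn) lte_fin; near: n.
  have [_ /(_ _ e20)[A cA Ae]] := HT F HF n.
  exists A => //; rewrite [e]splitr EFinD.
  apply: le_lt_trans (lteD Ae Gn).
  apply: le_trans (measureU2 m (mY _ _ cA (mB n)) (mG n)).
  apply: le_measure; rewrite ?inE; [exact: mY| |].
    by apply: measurableU; [exact: mY|exact: mG].
  move=> x [[Ax nF]|[Fx nA]].
    left; left; split=> //; rewrite -bigcup_mkord => -[k _ Fk].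
    by apply: nF; exists k.
  have [Bx|nB] := pselect ((\big[setU/set0]_(k < n) F k) x).
    by left; right.
  by right.
Unshelve. all: by end_near. Qed.

End coordinates.

(** * Product measures and Kakutani's theorem *)

Section product_measures.
Context d (T : measurableType d) (R : realType) (J : finType).
Variable z : nat -> T -> J.
Hypothesis measurableE : @measurable _ T = <<s cylinder z >>.
Implicit Types (m : {measure set T -> \bar R}) (p : nat -> J -> R).

Definition product_measure m p := forall N (i : {ffun 'I_N -> J}),
  m [set x | prefix z N x = i] = (\prod_(n < N) p n (i n))%:E.

Lemma integral_prefix m N (g : {ffun 'I_N -> J} -> R) : (forall i, 0 <= g i) ->
  (\int[m]_x (g (prefix z N x))%:E =
   \sum_i (g i)%:E * m [set x | prefix z N x = i])%E.
Proof.
move=> g0; pose F i := [set x | prefix z N x = i].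
have mF i : measurable (F i) by exact: (measurable_fiber measurableE).
transitivity (\int[m]_x \sum_i (g i * \1_(F i) x)%:E)%E.
  apply: eq_integral => x _; rewrite sumEFin (bigD1 (prefix z N x))//=.
  rewrite indicE mem_set// mulr1 big1 ?addr0// => i /negP ix.
  by rewrite indicE memNset ?mulr0// /F/= => xi; apply: ix; rewrite -xi.
rewrite ge0_integral_sum//; last 2 first.
- by move=> i; apply/measurable_EFinP; apply: measurable_funM => //;
    exact: measurable_indic.
- by move=> i x _; rewrite lee_fin mulr_ge0.
apply: eq_bigr => i _; under eq_integral do rewrite EFinM.
rewrite ge0_integralZl_EFin//; last first.
  exact/measurable_EFinP/measurable_indic.
by rewrite integral_indic// setIT.
Qed.

Lemma measure_prefix m N (S : pred {ffun 'I_N -> J}) :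
  m [set x | S (prefix z N x)] = (\sum_(i | S i) m [set x | prefix z N x = i])%E.
Proof.
have mS : measurable [set x | S (prefix z N x)].
  apply: (measurable_cylinder measurableE); exists N => x y xy.
  rewrite /mkset; congr (is_true (S _)).
  by apply/ffunP => n; rewrite !ffunE xy.
transitivity (\int[m]_x (\1_[set x | S (prefix z N x)] x)%:E)%E.
  by rewrite integral_indic// setIT.
transitivity (\int[m]_x (((S (prefix z N x))%:R : R)%:E))%E.
  apply: eq_integral => x _; rewrite indicE; congr (_%:R%:E).
  by case: (boolP (S _)) => Sx; [rewrite mem_set|rewrite memNset//; exact/negP].
pose g (i : {ffun 'I_N -> J}) : R := (S i)%:R.
have g0 i : 0 <= g i by rewrite ler0n.
rewrite -/(g _) (integral_prefix m g0) [RHS]big_mkcond/=.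
by apply: eq_bigr => i _; rewrite /g; case: ifP; rewrite ?mul1e ?mul0e.
Qed.

Variables (m : {measure set T -> \bar R}) (p : nat -> J -> R).
Hypotheses (mp : product_measure m p) (p0 : forall n v, 0 <= p n v).

Lemma product_measureT : m setT = 1%E.
Proof.
have i : {ffun 'I_0 -> J} by apply: finfun => -[].
have := mp i; rewrite big_ord0 => <-; congr (m _); apply/seteqP; split=> // x _.
by apply/ffunP => -[].
Qed.

Lemma product_measureE x N :
  m [set y | prefix z N y = prefix z N x] = (\prod_(n < N) p n (z n x))%:E.
Proof. by rewrite mp; congr EFin; apply: eq_bigr => n _; rewrite ffunE. Qed.

(** Independence of the coordinates: both sides expand into the same sum over prefixes. *)
Lemma integral_coordinates N (f : nat -> J -> R) : (forall n v, 0 <= f n v) ->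
  (\int[m]_x (\prod_(n < N) f n (z n x))%:E =
   (\prod_(n < N) \sum_v p n v * f n v)%:E)%E.
Proof.
move=> f0; pose g (i : {ffun 'I_N -> J}) := \prod_(n < N) f n (i n).
transitivity (\int[m]_x (g (prefix z N x))%:E)%E.
  apply: eq_integral => x _; congr EFin; apply: eq_bigr => n _.
  by rewrite ffunE.
rewrite integral_prefix; last by move=> i; apply: prodr_ge0.
rewrite (bigA_distr_bigA (fun (n : 'I_N) v => p n v * f n v)).
rewrite -sumEFin; apply: eq_bigr => i _; rewrite mp -EFinM; congr EFin.
by rewrite mulrC -big_split.
Qed.

End product_measures.

Section kakutani.
Context d (T : measurableType d) (R : realType) (J : finType).
Variable z : nat -> T -> J.
Hypothesis measurableE : @measurable _ T = <<s cylinder z >>.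
Variables (m m' : {measure set T -> \bar R}) (p p' : nat -> J -> R).
Hypotheses (mp : product_measure z m p) (p0 : forall n v, 0 <= p n v).
Hypotheses (mp' : product_measure z m' p') (p'0 : forall n v, 0 <= p' n v).

(** The Hellinger affinity of the laws of the coordinate [n] under the two measures. *)
Definition affinity n := \sum_v Num.sqrt (p n v * p' n v).

Let H N := \prod_(n < N) affinity n.
Let P N (i : {ffun 'I_N -> J}) := \prod_(n < N) p n (i n).
Let P' N (i : {ffun 'I_N -> J}) := \prod_(n < N) p' n (i n).

Let P0 N i : 0 <= @P N i. Proof. exact: prodr_ge0. Qed.
Let P'0 N i : 0 <= @P' N i. Proof. exact: prodr_ge0. Qed.

(** Affinities multiply over independent coordinates: [H N] is the affinity of the two laws of the
    prefix of length [N]. *)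
Let HE N : H N = \sum_(i : {ffun 'I_N -> J}) Num.sqrt (P i * P' i).
Proof.
rewrite /H /affinity (bigA_distr_bigA (fun (n : 'I_N) v => Num.sqrt (p n v * p' n v))).
apply: eq_bigr => i _; rewrite /P /P' -big_split/=.
elim/big_rec2: _ => [|n x y _ ->]; first by rewrite sqrtr1.
by rewrite [RHS]sqrtrM // mulr_ge0.
Qed.

Let mS N (S : pred {ffun 'I_N -> J}) :
  m [set x | S (prefix z N x)] = (\sum_(i | S i) P i)%:E.
Proof. by rewrite measure_prefix// -sumEFin; apply: eq_bigr => i _; exact: mp. Qed.

Let m'S N (S : pred {ffun 'I_N -> J}) :
  m' [set x | S (prefix z N x)] = (\sum_(i | S i) P' i)%:E.
Proof. by rewrite measure_prefix// -sumEFin; apply: eq_bigr => i _; exact: mp'. Qed.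

Lemma affinity_ge0 n : 0 <= affinity n.
Proof. by apply: sumr_ge0 => v _; exact: sqrtr_ge0. Qed.

Let sqrt_le (e a b : R) : 0 < e -> 0 <= a -> 0 <= b ->
  Num.sqrt (a * b) <= e^-1 * a + e * b.
Proof.
move=> e0 a0 b0; rewrite -(@ler_pXn2r _ 2)//; last 2 first.
- by rewrite nnegrE sqrtr_ge0.
- by rewrite nnegrE addr_ge0// mulr_ge0// ?invr_ge0 ltW.
rewrite sqr_sqrtr ?mulr_ge0//.
have -> : a * b = (e^-1 * a) * (e * b).
  by rewrite mulrACA mulVf ?mul1r// gt_eqF.
set x := e^-1 * a; set y := e * b.
have x0 : 0 <= x by rewrite mulr_ge0// invr_ge0 ltW.
have y0 : 0 <= y by rewrite mulr_ge0// ltW.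
by nra.
Qed.

(** A separating set is nearly a cylinder [B] such that [m] is small on [B] and [m'] is small off
    [B]. On each side [sqrt (P * P')] is bounded by [q^-1] times the small density plus [q] times
    the other one. As the small masses are below [q ^ 2], each side costs at most [2 * q], whence
    [q = e / 4]. *)
Lemma singular_affinity : mutually_singular m m' -> H N @[N --> \oo] --> 0.
Proof.
case=> A [mA mA0 m'A0].
have H0 N : 0 <= H N by apply: prodr_ge0 => n _; exact: affinity_ge0.
apply/cvgr0Pnorm_le => /= e e0; pose q := e / 4.
have q0 : 0 < q by rewrite divr_gt0.
pose s := measure_add m m'.
have sE B : s B = (m B + m' B)%E by exact: measure_addE.
have sfin : (s setT < +oo)%E.
  by rewrite sE (product_measureT mp) (product_measureT mp') -EFinD ltry.
have [B [N BN] sB] : exists2 A', cylinder z A' & (s (A' `+` A) < (q ^+ 2)%:E)%E.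
  by apply: (cylinder_approx measurableE) => //; exact: exprn_gt0.
have mB : measurable B by apply: (measurable_cylinder measurableE); exists N.
have mBA : measurable (B `+` A) by apply: measurableU; exact: measurableD.
have lb : (m B < (q ^+ 2)%:E)%E.
  apply: le_lt_trans sB; rewrite sE; apply: le_trans (leeDl _ (measure_ge0 _ _)).
  apply: (@le_trans _ _ (m ((B `+` A) `|` A))).
    apply: le_measure; rewrite ?inE; [by []|exact: measurableU|].
    by move=> x Bx; have [?|?] := pselect (A x); [right|left; left].
  by apply: le_trans (measureU2 m mBA mA) _; rewrite -[leRHS]adde0; apply: leeD => //; rewrite -mA0.
have lb' : (m' (~` B) < (q ^+ 2)%:E)%E.
  apply: le_lt_trans sB; rewrite sE; apply: le_trans (leeDr _ (measure_ge0 _ _)).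
  apply: (@le_trans _ _ (m' ((B `+` A) `|` ~` A))).
    apply: le_measure; rewrite ?inE; [exact: measurableC| |].
      by apply: measurableU => //; exact: measurableC.
    by move=> x Bx; have [?|?] := pselect (A x); [left; right|right].
  by apply: le_trans (measureU2 m' mBA (measurableC mA)) _; rewrite -[leRHS]adde0;
    apply: leeD => //; rewrite -m'A0.
near=> M; rewrite ger0_norm// HE.
have NM : (N <= M)%N by near: M; exact: nbhs_infty_ge.
have {}BN := level_le NM BN.
have [S SB] : exists S : pred {ffun 'I_M -> J}, B = [set x | S (prefix z M x)].
  exists (fun i => `[< exists2 x, B x & prefix z M x = i >]).
  apply/seteqP; split=> x /=; first by move=> Bx; apply/asboolP; exists x.
  by move=> /asboolP[y By] yx; rewrite (level_prefix BN (esym yx)).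
rewrite SB mS lte_fin in lb.
rewrite SB (_ : ~` _ = [set x | predC S (prefix z M x)]) ?m'S ?lte_fin in lb'; last first.
  by apply/seteqP; split=> x /= /negP.
have P1 : \sum_i @P M i = 1.
  apply/EFin_inj; rewrite -(mS predT) -(product_measureT mp); congr (m _).
  exact/seteqP.
have P'1 : \sum_i @P' M i = 1.
  apply/EFin_inj; rewrite -(m'S predT) -(product_measureT mp'); congr (m' _).
  exact/seteqP.
rewrite (bigID S)/=.
have le1 : \sum_(i | S i) Num.sqrt (@P M i * P' i) <=
    q^-1 * \sum_(i | S i) P i + q * \sum_i @P' M i.
  rewrite [X in _ <= _ + _ * X](bigID S)/= mulrDr addrA.
  rewrite -[X in X <= _]addr0 lerD//; last first.
    by rewrite mulr_ge0 ?sumr_ge0// ltW.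
  by rewrite !mulr_sumr -big_split/=; apply: ler_sum => i _; exact: sqrt_le.
have le2 : \sum_(i | ~~ S i) Num.sqrt (@P M i * P' i) <=
    q^-1 * \sum_(i | ~~ S i) P' i + q * \sum_i @P M i.
  rewrite [X in _ <= _ + _ * X](bigID S)/= mulrDr addrCA.
  rewrite -[X in X <= _]add0r lerD//.
    by rewrite mulr_ge0 ?sumr_ge0// ltW.
  rewrite !mulr_sumr -big_split/=; apply: ler_sum => i _.
  by rewrite mulrC; exact: sqrt_le.
apply: le_trans (lerD le1 le2) _; rewrite P1 P'1 !mulr1.
have q1 : q^-1 * q ^+ 2 = q by rewrite expr2 mulrA mulVf ?mul1r// gt_eqF.
have qi : 0 < q^-1 by rewrite invr_gt0.
have h1 : q^-1 * \sum_(i | S i) P i <= q by rewrite -[leRHS]q1 ler_pM2l// ltW.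
have h2 : q^-1 * \sum_(i | ~~ S i) P' i <= q by rewrite -[leRHS]q1 ler_pM2l// ltW.
have -> : e = q + q + (q + q) by rewrite /q; lra.
by apply: lerD; apply: lerD.
Unshelve. all: by end_near. Qed.

(* On the set where the density of [m'] exceeds that of [m] on the first [N k]
   coordinates, [m] is at most [H (N k)], and so is [m'] on the complement; the
   limit superior of these sets separates [m] from [m']. *)
Lemma affinity_singular : H N @[N --> \oo] --> 0 -> mutually_singular m m'.
Proof.
move=> H0.
(* Powers of 1/2 make the measures of the sets [B k] summable, as the Borel-Cantelli lemma
   requires. *)
have /choice[N HN] (k : nat) : exists N, H N <= 1 / (2 ^ k.+1)%:R.
  have e0 : 0 < 1 / (2 ^ k.+1)%:R :> R by rewrite divr_gt0// ltr0n expn_gt0.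
  have /cvgr_le/(_ _ e0) := H0; move=> [N _ /(_ N (leqnn N))] ?.
  by exists N.
pose B k := [set x | P (prefix z (N k) x) < P' (prefix z (N k) x)].
have mB k : measurable (B k).
  apply: (measurable_cylinder measurableE); exists (N k) => x y xy; rewrite /B /mkset.
  suff -> : prefix z (N k) x = prefix z (N k) y by [].
  by apply/ffunP => n; rewrite !ffunE xy.
have lB k : (m (B k) <= (1 / (2 ^ k.+1)%:R)%:E)%E.
  rewrite (mS (fun i => P i < P' i)) lee_fin; apply: le_trans (HN k).
  rewrite HE [leRHS](bigID (fun i => P i < P' i))/=.
  rewrite -[leLHS]addr0; apply: lerD; last by apply: sumr_ge0 => i _; exact: sqrtr_ge0.
  (* Where [P < P'], one has [P = sqrt (P ^ 2) <= sqrt (P * P')]. *)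
  apply: ler_sum => i ii; rewrite -{1}[P i]ger0_norm// -sqrtr_sqr ler_wsqrtr// expr2.
  by rewrite ler_wpM2l// ltW.
have lB' k : (m' (~` B k) <= (1 / (2 ^ k.+1)%:R)%:E)%E.
  rewrite (_ : ~` _ = [set x | (fun i => ~~ (P i < P' i)) (prefix z (N k) x)]); last first.
    by apply/seteqP; split=> x /= /negP.
  rewrite (m'S (fun i => ~~ (P i < P' i))) lee_fin; apply: le_trans (HN k).
  rewrite HE [leRHS](bigID (fun i => P i < P' i))/=.
  rewrite -[leLHS]add0r; apply: lerD; first by apply: sumr_ge0 => i _; exact: sqrtr_ge0.
  apply: ler_sum => i; rewrite -leNgt => ii; rewrite -{1}[P' i]ger0_norm// -sqrtr_sqr.
  by rewrite ler_wsqrtr// expr2 ler_wpM2r.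
exists (lim_sup_set B); split.
- apply: bigcap_measurable => // k _.
  by apply: bigcup_measurable => j _; exact: mB.
- apply: lim_sup_set_cvg0 => //.
  apply: le_lt_trans (_ : \sum_(k <oo) ((1 / (2 ^ k.+1)%:R)%:E : \bar R) < +oo)%E.
    by apply: lee_nneseries => // k _; exact: measure_ge0.
  exact: le_lt_trans (epsilon_trick0 xpredT ler01) (ltry _).
- rewrite /lim_sup_set setC_bigcap.
  have mBC n : measurable (~` \bigcup_(j in [set j | (n <= j)%N]) B j).
    by apply: measurableC; apply: bigcup_measurable => j _; exact: mB.
  apply/eqP; rewrite -measure_le0.
  apply: (@le_trans _ _ (\sum_(n <oo) m' (~` \bigcup_(j in [set j | (n <= j)%N]) B j))%E).
    apply: measure_sigma_subadditive => //.
    exact: bigcupT_measurable.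
  (* The complement of the union of the [B j] with [n <= j] lies in the complement of each such
     [B j], whose measure tends to 0. *)
  rewrite eseries0// => n _ _; apply/eqP; rewrite -measure_le0.
  apply/lee_addgt0Pr => /= e e0; rewrite add0e.
  have [k [nk ke]] : exists k, (n <= k)%N /\ 1 / (2 ^ k.+1)%:R <= e.
    have : (1 / (2 ^ k.+1)%:R : R) @[k --> \oo] --> 0.
      rewrite (_ : (fun k : nat => _) = (fun k => (2^-1) ^+ k.+1)).
        rewrite (cvg_shiftS (fun k : nat => (2^-1 : R) ^+ k)).
        apply: cvg_expr; rewrite ger0_norm ?invr_ge0//.
        by rewrite invf_lt1 ?ltr1n.
      by apply/funext => k; rewrite div1r natrX exprVn.
    move=> /cvgr_le/(_ _ e0)[k _ hk]; exists (maxn n k); split; first exact: leq_maxl.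
    by apply: hk; exact: leq_maxr.
  apply: le_trans (le_trans (lB' k) _); last by rewrite lee_fin.
  apply: le_measure; rewrite ?inE//; first exact: measurableC.
  by apply: subsetC => x Bx; exists k.
Qed.

Lemma kakutani : mutually_singular m m' <->
  \prod_(n < N) affinity n @[N --> \oo] --> 0.
Proof. by split; [exact: singular_affinity|exact: affinity_singular]. Qed.

End kakutani.

(** * Infinite products and series *)

Section infinite_products.
Variables (R : realType) (c : nat -> R).
Hypotheses (c_gt0 : forall n, 0 < c n) (c_le1 : forall n, c n <= 1).

Lemma prod_tail_small N (e : R) : \prod_(n < M) c n @[M --> \oo] --> 0 -> 0 < e ->
  \forall M \near \oo, \prod_(N <= n < M) c n <= e.
Proof.
move=> c0 e0; have P0 : 0 < \prod_(n < N) c n by exact: prodr_gt0.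
have /cvgr_le/(_ _ (mulr_gt0 P0 e0)) h := c0.
near=> M; have NM : (N <= M)%N by near: M; exact: nbhs_infty_ge.
rewrite -(ler_pM2l P0) -!(big_mkord xpredT c) -big_cat_nat//= !big_mkord.
by near: M; exact: h.
Unshelve. all: by end_near. Qed.

Let one_minus_sum_le N M : 1 - \sum_(N <= n < M) (1 - c n) <= \prod_(N <= n < M) c n.
Proof.
have [NM|MN] := leqP N M; last by rewrite !big_geq ?subr0// ltnW.
elim: M NM => [|M IH] NM; first by rewrite !big_geq// subr0.
move: NM; rewrite leq_eqVlt => /predU1P[<-|]; first by rewrite !big_geq ?subr0.
rewrite ltnS => NM; rewrite !big_nat_recr//=.
have P1 : \prod_(N <= n < M) c n <= 1 by apply: prodr_ile1 => n _; rewrite ltW/=.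
have := IH NM; have := c_gt0 M; have := c_le1 M.
set S := \sum_(_ <= _ < _) _ in IH *; set P := \prod_(_ <= _ < _) _ in P1 *.
by move=> ? ? ?; nra.
Qed.

Let prod_le_invr N M :
  \prod_(N <= n < M) c n * (1 + \sum_(N <= n < M) (1 - c n)) <= 1.
Proof.
have [NM|MN] := leqP N M; last by rewrite !big_geq ?addr0 ?mulr1// ltnW.
elim: M NM => [|M IH] NM; first by rewrite !big_geq// addr0 mulr1.
move: NM; rewrite leq_eqVlt => /predU1P[<-|]; first by rewrite !big_geq ?addr0 ?mulr1.
rewrite ltnS => NM; rewrite !big_nat_recr//=; apply: le_trans (IH NM).
rewrite -mulrA; apply: ler_wpM2l; first by apply: prodr_ge0 => n _; exact: ltW.
have S0 : 0 <= \sum_(N <= n < M) (1 - c n).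
  by apply: sumr_ge0 => n _; rewrite subr_ge0.
have := c_gt0 M; have := c_le1 M; set S := \sum_(_ <= _ < _) _ in S0 *.
by move=> ? ?; nra.
Qed.

(** If the products tend to 0, so do all tails, the factors being positive. By [one_minus_sum_le] a
    block with product at most 1/2 contributes at least 1/2 to the series, and there are infinitely
    many disjoint blocks of this kind. Conversely, [prod_le_invr] bounds a product by the inverse of
    1 plus the partial sum. The index [K] is free because finitely many positive factors do not
    affect the limit 0. *)
Lemma prod_cvg0P K : \prod_(n < N) c n @[N --> \oo] --> 0 <->
  (\sum_(K <= n <oo) (1 - c n)%:E = +oo)%E.
Proof.
have u0 n : (0 <= (1 - c n)%:E)%E by rewrite lee_fin subr_ge0.
split=> [c0|S].
  have half (k : nat) : exists M, k%:R / 2 <= \sum_(K <= n < M) (1 - c n).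
    elim: k => [|k [N hN]]; first by exists 0%N; rewrite mul0r big_geq.
    have [M _ hM] := prod_tail_small (maxn K N) c0 (ltac:(by []) : 0 < 2^-1 :> R).
    have := hM _ (leq_maxl M (maxn K N)); set M' := maxn M _.
    have := one_minus_sum_le (maxn K N) M' => h1 h2.
    exists M'; apply: (@le_trans _ _ (\sum_(K <= n < maxn K N) (1 - c n) +
        \sum_(maxn K N <= n < M') (1 - c n))).
      have hKN : \sum_(K <= n < N) (1 - c n) <= \sum_(K <= n < maxn K N) (1 - c n).
        have [KN|NK] := leqP K N; first by [].
        by rewrite (big_geq (ltnW NK)) big_geq.
      by rewrite -natr1 mulrDl; lra.
    by rewrite -big_cat_nat// ?leq_maxl ?leq_maxr.
  apply/eqyP => A A0; have [M hM] := half (Num.bound (A * 2)).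
  apply: (@le_trans _ _ (\sum_(K <= n < M) (1 - c n)%:E)%E); last first.
    by apply: nneseries_lim_ge => n _ _; exact: u0.
  rewrite sumEFin lee_fin; apply: le_trans hM; rewrite ler_pdivlMr//.
  have A20 : 0 <= A * 2 by rewrite mulr_ge0// ltW.
  exact: ltW (archi_boundP A20).
apply/cvgr0Pnorm_le => /= e e0.
pose C := \prod_(n < K) c n.
have C0 : 0 < C by exact: prodr_gt0.
have : (\sum_(K <= n < N) (1 - c n)%:E)%E @[N --> \oo] --> +oo%E.
  by rewrite -S; exact: is_cvg_ereal_nneg_natsum.
move=> /cvgeyPge/(_ (C / e)) hS.
near=> N; rewrite ger0_norm; last by apply: prodr_ge0 => n _; exact: ltW.
have KN : (K <= N)%N by near: N; exact: nbhs_infty_ge.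
rewrite -(big_mkord xpredT c) (@big_cat_nat _ _ _ K)//= big_mkord -/C.
have h : C / e <= \sum_(K <= n < N) (1 - c n).
  by rewrite -lee_fin -sumEFin; near: N.
have := prod_le_invr K N.
have P0 : 0 <= \prod_(K <= n < N) c n by apply: prodr_ge0 => n _; exact: ltW.
set P := \prod_(_ <= _ < _) _ in P0 *; set s := \sum_(_ <= _ < _) _ in h *.
move=> Ps; have : P * (C / e) <= 1.
  by apply: le_trans Ps; apply: ler_wpM2l => //; lra.
by rewrite mulrA ler_pdivrMr// mul1r mulrC.
Unshelve. all: by end_near. Qed.

End infinite_products.

(** * The columns of an array as coordinates *)

Section coordinate_sigma_algebra.
Context d (T : measurableType d) (J : finType).
Variable z : nat -> T -> J.
Hypothesis mz : forall n v, measurable [set x | z n x = v].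

Lemma cylinder_measurable A : cylinder z A -> measurable A.
Proof.
case=> N AN; pose F (i : {ffun 'I_N -> J}) := [set x | prefix z N x = i].
rewrite (_ : A = \bigcup_(i in [set i | exists2 x, A x & prefix z N x = i]) F i).
  apply: fin_bigcup_measurable => // i _.
  rewrite (_ : F i = \bigcap_(n in [set: 'I_N]) [set x | z n x = i n]).
    by apply: fin_bigcap_measurable => // n _; exact: mz.
  apply/seteqP; split=> x; first by move=> <- n _; rewrite /= ffunE.
  by move=> xi; apply/ffunP => n; rewrite ffunE; exact: xi.
apply/seteqP; split=> x; first by move=> Ax; exists (prefix z N x) => //=; exists x.
by move=> [i [y Ay yi] xi]; rewrite -(level_prefix AN (_ : prefix z N y = _)) ?yi.
Qed.

End coordinate_sigma_algebra.

Lemma F2_cases (r : 'F_2) : r = 0 \/ r = 1.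
Proof. by case: r => -[|[|//]] ?; [left|right]; exact/val_inj. Qed.

Lemma F2_addrr (r : 'F_2) : r + r = 0.
Proof. by have [->|->] := F2_cases r; exact/val_inj. Qed.

Lemma sum_F2 (V : nmodType) (F : 'F_2 -> V) : \sum_r F r = F 0 + F 1.
Proof.
rewrite (bigD1 (0 : 'F_2))//= (bigD1 (1 : 'F_2))//= big1 ?addr0// => r /andP[r0 r1].
by have [E|E] := F2_cases r; rewrite E eqxx in r0 r1.
Qed.

(** Columns 0 and 1 and the lower entry of column 2 are forced. Keeping them aligns the numbering of
    the coordinates with that of the matrices acting on the right. *)
Definition entry (n : nat) (x : X2) : 'F_2 * 'F_2 := (row_val x.1 n, row_val x.2 n).

Lemma row_val_measurable k n v : measurable [set x : row_space k | row_val x n = v].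
Proof.
rewrite -[X in measurable X]setTI.
exact: (@measurable_row_val k n measurableT [set v] I).
Qed.

Lemma row_cylinder_generate k :
  @measurable _ (row_space k) = <<s cylinder (fun n (x : row_space k) => row_val x n) >>.
Proof.
apply/seteqP; split; last first.
  apply: smallest_sub; first exact: sigma_algebra_measurable.
  exact: (cylinder_measurable (@row_val_measurable k)).
rewrite row_measurableE; apply: sub_smallest2r; first exact: smallest_sigma_algebra.
move=> A [->|[N [a ->]]]; first by exists 0%N.
exists N => x y xy; apply/propext; split=> h i iN; rewrite -h//.
  by have := xy _ iN; rewrite /row_val valK.
by have := xy _ iN; rewrite /row_val valK.
Qed.

Lemma measurable_entry n v : measurable [set x | entry n x = v].
Proof.
rewrite (_ : [set x | _] = (fst @^-1` [set y | row_val y n = v.1]) `&`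
                           (snd @^-1` [set y | row_val y n = v.2])).
  apply: measurableI; rewrite -[X in measurable X]setTI.
    exact: (measurable_fst measurableT _ (@row_val_measurable _ n v.1)).
  exact: (measurable_snd measurableT _ (@row_val_measurable _ n v.2)).
by apply/seteqP; split=> x; rewrite /entry; case: v => a b /=; [case|case=> -> ->].
Qed.

Lemma entry_generate : @measurable _ X2 = <<s cylinder entry >>.
Proof.
apply/seteqP; split; last first.
  apply: smallest_sub; first exact: sigma_algebra_measurable.
  exact: (cylinder_measurable measurable_entry).
have rowE k (f : X2 -> row_space k) B :
    (forall n x y, entry n x = entry n y -> row_val (f x) n = row_val (f y) n) ->
    measurable B -> <<s cylinder entry >> (f @^-1` B).
  move=> fE; suff mf : measurable_fun (setT : set (g_sigma_algebraType (cylinder entry))) f.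
    by move=> mB; have := mf measurableT B mB; rewrite setTI.
  apply: measurable_fun_row => i _ C _; rewrite setTI; apply: sub_sigma_algebra.
  exists (val i).+1 => x y xy; rewrite /preimage /mkset.
  by have := fE _ _ _ (xy _ (ltnSn _)); rewrite /row_val valK => ->.
apply: smallest_sub; first exact: smallest_sigma_algebra.
move=> A [] [B mB <-]; rewrite setTI; apply: rowE => //.
- by move=> n x y; rewrite /entry => -[].
- by move=> n x y; rewrite /entry => -[].
Qed.

Section weights.
Variables (R : realType) (mu : nat -> nat -> probability 'F_2 R).

(** A forced entry carries the point mass at its value, so that one product formula covers all
    columns. *)
Definition row_weight k n (v : 'F_2) : R :=
  if (k < n)%N then alpha mu k n v else (v == (n == k)%:R)%:R.

Definition weight n (v : 'F_2 * 'F_2) : R := row_weight 1 n v.1 * row_weight 2 n v.2.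

Lemma row_weight_ge0 k n v : 0 <= row_weight k n v.
Proof. by rewrite /row_weight; case: ifP => // _; exact: fine_ge0. Qed.

Lemma weight_ge0 n v : 0 <= weight n v.
Proof. by rewrite mulr_ge0// row_weight_ge0. Qed.

Lemma alpha_sum1 k n : alpha mu k n 0 + alpha mu k n 1 = 1.
Proof.
have mT : mu k n setT = (mu k n [set 0%R] + mu k n [set 1%R])%E.
  rewrite -measureU//; last by apply/seteqP; split => // x [/= -> /eqP].
  by congr (mu k n _); apply/seteqP; split => // r _; exact: F2_cases.
rewrite probability_setT in mT; apply: EFin_inj; rewrite mT EFinD /alpha.
by rewrite !fineK//; exact: fin_num_measure.
Qed.

Lemma row_weight_sum1 k n : \sum_v row_weight k n v = 1.
Proof.
rewrite sum_F2 /row_weight; case: ifP => _; first exact: alpha_sum1.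
by case: (n == k); rewrite /= ?eqxx ?add0r ?addr0.
Qed.

Lemma sum_pair (V : nmodType) (F : 'F_2 * 'F_2 -> V) :
  \sum_v F v = \sum_a \sum_b F (a, b).
Proof. by rewrite pair_big/=; apply: eq_bigr => -[]. Qed.

Lemma sum_pairM (F G : 'F_2 -> R) :
  \sum_(v : 'F_2 * 'F_2) F v.1 * G v.2 = (\sum_a F a) * (\sum_b G b).
Proof. by rewrite sum_pair big_distrlr. Qed.

Lemma weight_sum1 n : \sum_v weight n v = 1.
Proof. by rewrite sum_pairM !row_weight_sum1 mulr1. Qed.

(** A prefix contradicting a forced entry gives 0 on both sides; any other prefix comes from a row
    [a], completed by zeros. *)
Lemma row_product_weight k :
  product_measure (fun n (x : row_space k) => row_val x n) (mu_row mu k) (row_weight k).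
Proof.
move=> N i.
have [iE|/existsNP[n /not_implyP[nk iE]]]
  := pselect (forall n : 'I_N, (n <= k)%N -> i n = (n == k :> nat)%:R); last first.
  rewrite (_ : [set x | _] = set0); last first.
    apply/seteqP; split=> // x /= xi; apply: iE; rewrite -xi ffunE.
    exact: row_val_le.
  rewrite measure0 (bigD1 n)//= /row_weight ltnNge nk/=.
  by case: eqP => //; rewrite mul0r.
pose a : row_space k := fun j => if insub (val j) is Some n then i n else 0.
have aE (n : 'I_N) : row_val a n = i n.
  rewrite /row_val; case: insubP => [u ku un|].
    by rewrite /a un valK.
  by rewrite -leqNgt => nk; rewrite iE.
rewrite (_ : [set x | _] = row_cylinder N a).
  apply: (etrans (@row_productE R (mu k) k N a)); congr EFin.
  under [RHS]eq_bigr do rewrite -aE.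
  rewrite -(big_mkord xpredT (fun n => row_weight k n (row_val a n))).
  have [kN|Nk] := leqP k.+1 N.
    rewrite [RHS](@big_cat_nat _ _ _ k.+1)//= [X in _ = X * _]big_nat.
    rewrite [X in _ = X * _]big1 ?mul1r.
      apply: eq_big_nat => n /andP[kn _].
      by rewrite /row_weight kn.
    move=> n /andP[_ nk]; rewrite /row_weight ltnNge -ltnS nk/= row_val_le//.
    by rewrite eqxx.
  rewrite big_geq ?(ltnW Nk)// big_nat big1// => n /andP[_ nN].
  have nk : (n <= k)%N by rewrite ltnW// (leq_trans nN).
  by rewrite /row_weight ltnNge nk/= row_val_le// eqxx.
apply/seteqP; split=> x /=.
  move=> xi j jN; have := aE (Ordinal jN); rewrite -xi ffunE /row_val valK//.
move=> xa; apply/ffunP => n; rewrite ffunE -aE /row_val; case: insubP => // u ku un.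
by apply: xa; rewrite un.
Qed.

Lemma entry_product_measure : product_measure entry (mu_alpha mu) weight.
Proof.
move=> N i.
pose i1 : {ffun 'I_N -> 'F_2} := [ffun n => (i n).1].
pose i2 : {ffun 'I_N -> 'F_2} := [ffun n => (i n).2].
pose F k (j : {ffun 'I_N -> 'F_2}) :=
  [set x : row_space k | prefix (fun n (x : row_space k) => row_val x n) N x = j].
rewrite (_ : [set x | _] = F 1%N i1 `*` F 2%N i2).
  have mF k j : measurable (F k j) by exact: (measurable_fiber (row_cylinder_generate _)).
  apply: (@eq_trans _ _ (mu_row mu 1 (F 1%N i1) * mu_row mu 2 (F 2%N i2))%E).
    exact: product_measure1E.
  rewrite !(@row_product_weight _) -EFinM -big_split/=; congr EFin.
  by apply: eq_bigr => n _; rewrite !ffunE.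
apply/seteqP; split=> x /=.
  by move=> xi; split; apply/ffunP => n; rewrite !ffunE -xi ffunE.
move=> [/ffunP x1 /ffunP x2]; apply/ffunP => n.
have := x1 n; have := x2 n; rewrite !ffunE /entry => -> ->.
by case: (i n).
Qed.

End weights.

Lemma series_oo_le (R : realType) (u v : nat -> R) K (C : R) : 0 < C ->
  (forall n, (K <= n)%N -> 0 <= u n <= C * v n) ->
  (\sum_(K <= n <oo) (u n)%:E = +oo)%E -> (\sum_(K <= n <oo) (v n)%:E = +oo)%E.
Proof.
move=> C0 uv uoo; apply/eqyP => A A0.
have v0 n : (K <= n)%N -> 0 <= v n.
  by move=> /uv/andP[u0 uC]; rewrite -(pmulr_rge0 _ C0) (le_trans u0).
have : (\sum_(K <= n < N) (u n)%:E)%E @[N --> \oo] --> +oo%E.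
  rewrite -uoo; apply: is_cvg_ereal_nneg_natsum => n Kn.
  by rewrite lee_fin; have /andP[] := uv n Kn.
move=> /cvgeyPge/(_ (C * A))[N _ /(_ N (leqnn N))].
rewrite /= sumEFin lee_fin => hN.
apply: (@le_trans _ _ (\sum_(K <= n < N) (v n)%:E)%E); last first.
  by apply: nneseries_lim_ge => n Kn _; rewrite lee_fin v0.
rewrite sumEFin lee_fin -(ler_pM2l C0) (le_trans hN)// mulr_sumr.
by apply: ler_sum_nat => n /andP[Kn _]; have /andP[] := uv n Kn.
Qed.

(** * The two Kakutani criteria as series *)

Section affinities.
Variables (R : realType) (mu : nat -> nat -> probability 'F_2 R).
Hypothesis alpha_gt0 : forall (k n : nat) (r : 'F_2),
  (1 <= k <= 2)%N -> (k < n)%N -> 0 < alpha mu k n r.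
Local Notation c := (c_coef mu).
Local Notation row_weight := (row_weight mu).
Local Notation weight := (weight mu).

Lemma c_coef_gt0 k n : (1 <= k <= 2)%N -> (k < n)%N -> 0 < c k n.
Proof. by move=> k12 kn; rewrite mulr_gt0// sqrtr_gt0 mulr_gt0// alpha_gt0. Qed.

Lemma c_coef_le1 k n : c k n <= 1.
Proof.
have a0 r : 0 <= alpha mu k n r by exact: fine_ge0.
rewrite -(@ler_pXn2r _ 2)// ?nnegrE//; last by rewrite mulr_ge0// sqrtr_ge0.
rewrite exprMn sqr_sqrtr ?mulr_ge0// expr1n.
have := alpha_sum1 mu k n; set a := alpha _ _ _ _; set b := alpha _ _ _ _ => ab.
have -> : b = 1 - a by lra.
by have := sqr_ge0 (1 - 2 * a); lra.
Qed.

(** The affinity of the law of an entry and its translate by [b]. Right of the diagonal and for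
    [b = 1] it is the coefficient [c k n]. *)
Definition shift_affinity k n (b : 'F_2) : R :=
  \sum_a Num.sqrt (row_weight k n a * row_weight k n (a + b)).

Lemma shift_affinity0 k n : shift_affinity k n 0 = 1.
Proof.
rewrite -(row_weight_sum1 mu k n); apply: eq_bigr => a _.
by rewrite addr0 -expr2 sqrtr_sqr ger0_norm// row_weight_ge0.
Qed.

Lemma shift_affinity1 k n : (k < n)%N -> shift_affinity k n 1 = c k n.
Proof.
move=> kn; rewrite /shift_affinity sum_F2 /Defs.c_coef /Submission.row_weight kn add0r.
by rewrite F2_addrr [alpha mu k n 1 * _]mulrC mulr2n mulrDl mul1r.
Qed.

Lemma shift_affinity_le1 k n b : (k < n)%N -> shift_affinity k n b <= 1.
Proof.
move=> kn; have [->|->] := F2_cases b; first by rewrite shift_affinity0.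
by rewrite shift_affinity1// c_coef_le1.
Qed.

(** The action of [L12] on one column; by the forced entries it is also correct in columns 0, 1 and
    2. *)
Definition shear (v : 'F_2 * 'F_2) := (v.1 + v.2, v.2).

Lemma shearK : involutive shear.
Proof. by case=> a b; rewrite /shear/= -addrA F2_addrr addr0. Qed.

Lemma entry_L12 n x : entry n (L12 x) = shear (entry n x).
Proof.
rewrite /entry /shear /L12/=; congr pair; rewrite /row_val.
case: insubP => [u ku un|]; first by rewrite -un.
rewrite -leqNgt => n1; case: insubP => [u k2u un|_].
  by move: k2u n1; rewrite /= => /leq_trans h /h.
by case: n n1 => [|[|]]//; rewrite addr0.
Qed.

Lemma L12K : involutive L12.
Proof.
move=> [x1 x2]; rewrite /L12/=; congr pair; apply/funext => i.
by rewrite -addrA F2_addrr addr0.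
Qed.

Lemma entry_inj x y : (forall n, entry n x = entry n y) -> x = y.
Proof.
case: x y => [x1 x2] [y1 y2] xy; congr pair; apply/funext => i.
  by have [] := xy (val i); rewrite /row_val !valK.
by have [] := xy (val i); rewrite /row_val !valK.
Qed.

Lemma measurable_entry_map (f : X2 -> X2) :
  (forall n, exists N, level entry N (fun x => entry n (f x))) -> measurable_fun setT f.
Proof.
move=> fN _ B mB; rewrite setTI.
suff : measurable_fun (setT : set X2) (f : X2 -> g_sigma_algebraType (cylinder entry)).
  have mB' : <<s cylinder entry >> B by rewrite -entry_generate.
  by move=> /(_ measurableT B mB'); rewrite setTI.
apply: (@measurability _ _ X2 (g_sigma_algebraType (cylinder entry)) setT f (cylinder entry)) => //.
move=> _ [C [N CN] <-]; rewrite setTI.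
apply: (cylinder_measurable measurable_entry).
have /choice[M fM] := fN; exists (\sum_(n < N) M n)%N => x y xy.
rewrite /preimage /mkset; apply: CN => n nN; apply: (fM n) => j jM; apply: xy.
by rewrite (leq_trans jM)// (bigD1 (Ordinal nN))//= leq_addr.
Qed.

Lemma measurable_L12 : measurable_fun setT L12.
Proof.
apply: measurable_entry_map => n; exists n.+1 => x y xy.
by rewrite !entry_L12 xy.
Qed.

HB.instance Definition _ := isMeasurableFun.Build _ _ _ _ L12 measurable_L12.

Lemma shear_product_measure :
  product_measure entry (distribution (mu_alpha mu) L12) (fun n v => weight n (shear v)).
Proof.
move=> N i; rewrite /distribution /pushforward.
transitivity (mu_alpha mu [set x | prefix entry N x = [ffun n => shear (i n)]]); last first.
  rewrite (entry_product_measure mu); congr EFin; apply: eq_bigr => n _.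
  by rewrite ffunE.
congr (mu_alpha mu _).
apply/seteqP; split=> x /=.
  move=> <-; apply/ffunP => n; rewrite !ffunE entry_L12 shearK//.
move=> /ffunP xi; apply/ffunP => n; have := xi n.
by rewrite !ffunE entry_L12 => ->; rewrite shearK.
Qed.

(** Given the lower entry [b] of the column, the upper one is translated by [b]. The value [b = 0]
    contributes its whole mass, and [b = 1] its mass times the affinity of a translation by 1. *)
Lemma affinity_shear n :
  affinity weight (fun n v => weight n (shear v)) n =
  1 - row_weight 2 n 1 * (1 - shift_affinity 1 n 1).
Proof.
rewrite /affinity sum_pair exchange_big/=.
under eq_bigr => b _.
  under eq_bigr => a _.
    rewrite /Submission.weight /= mulrACA -expr2 sqrtrM ?mulr_ge0 ?row_weight_ge0//.
    rewrite sqrtr_sqr ger0_norm ?row_weight_ge0//.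
    over.
  rewrite -mulr_suml -/(shift_affinity 1 n b).
  over.
rewrite sum_F2 shift_affinity0 mul1r.
have := row_weight_sum1 mu 2 n; rewrite sum_F2 => h.
have -> : row_weight 2 n 0 = 1 - row_weight 2 n 1 by lra.
by lra.
Qed.

Lemma affinity_shearE n : (2 < n)%N ->
  affinity weight (fun n v => weight n (shear v)) n =
  1 - alpha mu 2 n 1 * (1 - c 1 n).
Proof.
move=> n2; rewrite affinity_shear shift_affinity1; last exact: ltnW.
by rewrite /Submission.row_weight n2.
Qed.

Let row_weight_le1 k n v : row_weight k n v <= 1.
Proof.
rewrite -(row_weight_sum1 mu k n) (bigD1 v)//= lerDl.
by apply: sumr_ge0 => w _; exact: row_weight_ge0.
Qed.

Lemma affinity_shear_bounds n :
  0 < affinity weight (fun n v => weight n (shear v)) n <= 1.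
Proof.
rewrite affinity_shear; have w0 := row_weight_ge0 mu 2 n 1.
have w1 := row_weight_le1 2 n 1.
have [n1|n1] := leqP n 1.
  have -> : row_weight 2 n 1 = 0 by case: n n1 {w0 w1} => [|[|]].
  by rewrite mul0r subr0 ltr01 lexx.
rewrite shift_affinity1//; have c0 : 0 < c 1 n by exact: c_coef_gt0.
have c1 := c_coef_le1 1 n.
by apply/andP; split; nra.
Qed.

Lemma singular_shear :
  mutually_singular (pushforward (mu_alpha mu) L12) (mu_alpha mu) <-> S_L12 mu = +oo%E.
Proof.
pose a := affinity weight (fun n v => weight n (shear v)).
have sym (T : measurableType _) (m m' : set T -> \bar R) : mutually_singular m m' -> mutually_singular m' m.
  by case=> A [mA A0 A1]; exists (~` A); split; rewrite ?setCK//; exact: measurableC.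
have k := kakutani entry_generate (entry_product_measure mu) (weight_ge0 mu)
  shear_product_measure (fun n v => weight_ge0 mu n (shear v)).
have a0 n : 0 < a n by have /andP[] := affinity_shear_bounds n.
have a1 n : a n <= 1 by have /andP[] := affinity_shear_bounds n.
have SE : S_L12 mu = (\sum_(3 <= n <oo) (1 - a n)%:E)%E.
  apply/congr_lim/funext => N; rewrite !big_nat; apply: eq_bigr => n /andP[n3 _].
  by rewrite /a affinity_shearE// subKr.
rewrite SE -(prod_cvg0P a0 a1 3) -k; split=> h.
  exact: sym.
by apply: sym; exact: h.
Qed.

(** With this constant family, [mu_row h 2] is [mu_inv_row2], and the product formula for rows
    applies to the uniform measure. *)
Let h : nat -> nat -> probability 'F_2 R := fun _ _ => mu_inv.
Let w' := Submission.row_weight h 2.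
Let a2 n := affinity (row_weight 2) w' n.

Let a2_le n : (n <= 2)%N -> a2 n = 1.
Proof.
move=> n2; rewrite /a2 /affinity sum_F2 /w' /Submission.row_weight ltnNge n2/=.
by case: (n == 2%N); rewrite /= ?mulr0 ?mulr1 ?sqrtr0 ?sqrtr1 ?add0r ?addr0.
Qed.

(** In the square of [sqrt (alpha 0 / 2) + sqrt (alpha 1 / 2)] the squares add up to 1/2 and the
    mixed term is [c / 2]. *)
Let a2_sqr n : (2 < n)%N -> a2 n ^+ 2 = (1 + c 2 n) / 2.
Proof.
move=> n2; rewrite /a2 /affinity sum_F2 /w' /Submission.row_weight n2.
have hE r : alpha h 2 n r = 2^-1 by have := @mu_invE R r => /(congr1 fine).
have a0 r : 0 <= alpha mu 2 n r by exact: fine_ge0.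
rewrite !hE sqrrD !sqr_sqrtr ?mulr_ge0 ?invr_ge0//.
rewrite -sqrtrM ?mulr_ge0 ?invr_ge0// mulrACA -expr2 sqrtrM ?mulr_ge0//.
rewrite sqrtr_sqr ger0_norm ?invr_ge0// /Defs.c_coef.
have := alpha_sum1 mu 2 n; set s := Num.sqrt _.
by move=> ?; lra.
Qed.

Let a2_ge0 n : 0 <= a2 n. Proof. exact: affinity_ge0. Qed.

Let a2_bounds n : 0 < a2 n <= 1.
Proof.
have [n2|n2] := leqP n 2; first by rewrite a2_le// ltr01 lexx.
have := a2_sqr n2; have := a2_ge0 n; have := c_coef_le1 2 n.
have : 0 < c 2 n by exact: c_coef_gt0.
set x := a2 n; set y := c 2 n => y0 y1 x0 xy; rewrite lt_neqAle x0 andbT.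
apply/andP; split; last by nra.
by apply/eqP => x00; move: xy; rewrite -x00 expr0n/=; lra.
Qed.

(** By [a2_sqr], [1 - c 2 n] is [1 - a2 n] times [2 * (1 + a2 n)], a factor between 2 and 4: the
    series of the theorem and the one given by Kakutani's criterion diverge together. *)
Lemma singular_inv : mutually_singular (mu_row mu 2) (@mu_inv_row2 R) <-> S_L22 mu = +oo%E.
Proof.
have k := kakutani (row_cylinder_generate 2) (row_product_weight mu 2)
  (row_weight_ge0 mu 2) (row_product_weight h 2) (row_weight_ge0 h 2).
have a0 n : 0 < a2 n by have /andP[] := a2_bounds n.
have a1 n : a2 n <= 1 by have /andP[] := a2_bounds n.
apply: (iff_trans k); apply: (iff_trans (prod_cvg0P a0 a1 3)).
have key n : (2 < n)%N -> 1 - c 2 n = 2 * (1 - a2 n) * (1 + a2 n).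
  by move=> /a2_sqr; lra.
split; apply: series_oo_le.
- exact: ltr01.
- move=> n n3; rewrite subr_ge0 a1/= mul1r key//.
  by have := a0 n; have := a1 n; nra.
- exact: (ltr0n R 4).
- move=> n n3; rewrite subr_ge0 c_coef_le1/= key//.
  by have := a0 n; have := a1 n; nra.
Qed.

Lemma affinity_translate n (u : 'F_2 * 'F_2) :
  \sum_v Num.sqrt (weight n v * weight n (v + u)) =
  shift_affinity 1 n u.1 * shift_affinity 2 n u.2.
Proof.
rewrite /shift_affinity -sum_pairM; apply: eq_bigr => v _.
by rewrite /Submission.weight mulrACA sqrtrM// mulr_ge0// row_weight_ge0.
Qed.

End affinities.

(** * Densities and quasi-invariance *)

Section densities.
Context d (T : measurableType d) (R : realType).
Variables (mu : {sigma_finite_measure set T -> \bar R}) (nu : {finite_measure set T -> \bar R}).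

Definition has_density (D : T -> R) :=
  forall A, measurable A -> (nu A = \int[mu]_(x in A) (D x)%:E)%E.

Variable D : T -> R.
Hypothesis mD : measurable_fun setT D.
Hypothesis nuD : has_density D.

Lemma density_dominates : nu `<< mu.
Proof.
apply/null_content_dominatesP => A mA A0; rewrite nuD//.
by apply: null_set_integral => //; apply/measurable_EFinP; exact: measurable_funTS.
Qed.

(** This gives access to the derivative inside [T_rep], which is known only through its integrals,
    by means of an explicit density. *)
Lemma Radon_Nikodym_density :
  ae_eq mu setT (Radon_Nikodym (charge_of_finite_measure nu) mu) (EFin \o D).
Proof.
apply: integral_ae_eq => //.
- by apply: (@Radon_Nikodym_integrable _ _ _ (charge_of_finite_measure nu) mu); exact: density_dominates.
- exact/measurable_EFinP.
- by move=> E _ mE; rewrite -Radon_Nikodym_integral//; [exact: nuD|exact: density_dominates].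
Qed.

Lemma ge0_integral_density (h : T -> \bar R) : measurable_fun setT h ->
  (forall x, 0 <= h x)%E -> (\int[nu]_x h x = \int[mu]_x (h x * (D x)%:E))%E.
Proof.
move=> mh h0.
rewrite -(Radon_Nikodym_SigmaFinite.change_of_variables density_dominates)//.
have RNae : ae_eq mu setT (Radon_Nikodym_SigmaFinite.f nu mu) (EFin \o D).
  apply: integral_ae_eq => //.
  - exact: Radon_Nikodym_SigmaFinite.f_integrable density_dominates.
  - exact/measurable_EFinP.
  - move=> E _ mE; rewrite -Radon_Nikodym_SigmaFinite.f_integral//; first exact: nuD.
    exact: density_dominates.
apply: ae_eq_integral => //.
- apply: emeasurable_funM => //.
  exact: measurable_int (Radon_Nikodym_SigmaFinite.f_integrable density_dominates).
- by apply: emeasurable_funM => //; exact/measurable_EFinP.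
- exact: ae_eqe_mul2l.
Qed.

Lemma integral_density (h : T -> \bar R) : nu.-integrable setT h ->
  (\int[nu]_x h x = \int[mu]_x (h x * (D x)%:E))%E.
Proof.
move=> ih; have mh := measurable_int _ ih.
rewrite -(Radon_Nikodym_change_of_variables density_dominates)//.
apply: ae_eq_integral => //.
- apply: emeasurable_funM => //.
  apply: measurable_int (@Radon_Nikodym_integrable _ _ _ (charge_of_finite_measure nu) mu _).
  exact: density_dominates.
- by apply: emeasurable_funM => //; exact/measurable_EFinP.
- apply: ae_eqe_mul2l; exact: Radon_Nikodym_density.
Qed.

End densities.

Section fibers.
Context d (T : measurableType d) (R : realType) (J : finType).
Variable z : nat -> T -> J.
Hypothesis measurableE : @measurable _ T = <<s cylinder z >>.

Definition fiber N a := [set x | prefix z N x = prefix z N a].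

(** Depths below [N0] are left out because the density of a translate is constant only on fibers
    that are deep enough. *)
Definition fibers N0 (A : set T) :=
  A = set0 \/ exists N a, (N0 <= N)%N /\ A = fiber N a.

Lemma fiberP N a x : fiber N a x <-> forall n, (n < N)%N -> z n x = z n a.
Proof.
split=> [/ffunP xa n nN|xa]; first by have := xa (Ordinal nN); rewrite !ffunE.
by apply/ffunP => n; rewrite !ffunE xa.
Qed.

Lemma fiber_measurable N a : measurable (fiber N a).
Proof. exact: (measurable_fiber measurableE). Qed.

Lemma fibersI N0 : setI_closed (fibers N0).
Proof.
move=> A B [->|[N [a [NN ->]]]]; first by rewrite set0I; left.
move=> [->|[M [b [NM ->]]]]; first by rewrite setI0; left.
have [[x [/fiberP xa /fiberP xb]]|nx] := pselect (exists x, fiber N a x /\ fiber M b x).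
  right; exists (maxn N M), x; rewrite leq_max NN; split=> //.
  apply/seteqP; split=> y.
    move=> [/fiberP ya /fiberP yb]; apply/fiberP => n; rewrite leq_max.
    by move=> /orP[nN|nM]; [rewrite ya ?xa|rewrite yb ?xb].
  move=> /fiberP yx; split; apply/fiberP => n nN; rewrite yx ?leq_max ?nN ?orbT//.
    exact: xa.
  exact: xb.
by left; apply/seteqP; split=> // x [xa xb]; apply: nx; exists x.
Qed.

Lemma fibers_generate N0 : @measurable _ T = <<s fibers N0 >>.
Proof.
apply/seteqP; split; last first.
  apply: smallest_sub; first exact: sigma_algebra_measurable.
  move=> A [->|[N [a [_ ->]]]]; first exact: measurable0.
  exact: fiber_measurable.
rewrite measurableE; apply: smallest_sub; first exact: smallest_sigma_algebra.
move=> A [N AN]; have {}AN := level_le (leq_maxl N N0) AN.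
set M := maxn N N0 in AN.
rewrite (_ : A = \bigcup_(i in [set i | exists2 x, A x & prefix z M x = i])
    [set x | prefix z M x = i]).
  apply: (@fin_bigcup_measurable _ (g_sigma_algebraType (fibers N0))) => // i [x _ <-].
  by apply: sub_sigma_algebra; right; exists M, x; rewrite leq_maxr.
apply/seteqP; split=> x; first by move=> Ax; exists (prefix z M x) => //=; exists x.
by move=> [i [y Ay yi] xi]; rewrite -(level_prefix AN (_ : prefix z M y = _)) ?yi.
Qed.

Lemma fibers_measure_unique N0 (m1 m2 : {measure set T -> \bar R}) :
  (m1 setT < +oo)%E -> (forall N a, (N0 <= N)%N -> m1 (fiber N a) = m2 (fiber N a)) ->
  forall A, measurable A -> m1 A = m2 A.
Proof.
move=> m1T m12.
(* The whole space may fail to be a fiber of depth at least [N0]; it is covered by the finitely many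
   fibers of depth [N0], enumerated through [pickle]. *)
pose g n : set T := if unpickle n is Some i then [set x | prefix z N0 x = i] else set0.
have Gg n : fibers N0 (g n).
  rewrite /g; case: unpickle => [i|]; last by left.
  have [[x <-]|nx] := pselect (exists x, prefix z N0 x = i).
    by right; exists N0, x; rewrite leqnn.
  by left; apply/seteqP; split=> // x xi; apply: nx; exists x.
apply: (measure_unique (fibers N0) g) => //.
- exact: fibers_generate.
- exact: fibersI.
- apply/seteqP; split=> // x _; exists (pickle (prefix z N0 x)) => //.
  by rewrite /g pickleK.
- by move=> A [->|[N [a [NN ->]]]]; [rewrite !measure0|exact: m12].
- move=> k; apply: le_lt_trans m1T; apply: le_measure; rewrite ?inE//.
  by rewrite (fibers_generate N0); exact: sub_sigma_algebra.
Qed.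

End fibers.

Section density_measure.
Context d (T : measurableType d) (R : realType) (m : {measure set T -> \bar R}).
Variable D : T -> R.
Hypotheses (D0 : forall x, 0 <= D x) (mD : measurable_fun setT D).

Definition density_measure A := (\int[m]_(x in A) (D x)%:E)%E.

Let density_measure0 : density_measure set0 = 0%E.
Proof. exact: integral_set0. Qed.

Let density_measure_ge0 A : (0 <= density_measure A)%E.
Proof. by apply: integral_ge0 => x _; rewrite lee_fin. Qed.

Let density_measure_additive : semi_sigma_additive density_measure.
Proof.
by apply: semi_sigma_additive_nng_induced => //; exact/measurable_EFinP.
Qed.

Lemma density_measureP : exists nu : {measure set T -> \bar R}, 
  nu = density_measure :> (set T -> \bar R).
Proof.
pose nu : {measure set T -> \bar R} := HB.pack density_measure
  (isMeasure.Build _ _ _ density_measure density_measure0 density_measure_ge0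
     density_measure_additive).
by exists nu.
Qed.

End density_measure.

Definition rmul (x : X2) (t : B0) : X2 := (Defs.row_mul x.1 t, Defs.row_mul x.2 t).

Lemma R_actE t x : R_act t x = rmul x t^-1%g. Proof. by []. Qed.

Lemma rmulA x s t : rmul (rmul x s) t = rmul x (s * t)%g.
Proof. by rewrite /rmul/= !Defs.row_mulA. Qed.

Lemma rmul1 x : rmul x 1%g = x.
Proof. by case: x => x1 x2; rewrite /rmul/= !Defs.row_mul1. Qed.

Lemma rmulK t : cancel (fun x => rmul x t) (fun x => rmul x t^-1%g).
Proof. by move=> x; rewrite rmulA mulgV rmul1. Qed.

Lemma rmulVK t : cancel (fun x => rmul x t^-1%g) (fun x => rmul x t).
Proof. by move=> x; rewrite rmulA mulVg rmul1. Qed.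

Lemma entry_rmul n x t : entry n (rmul x t) =
  (\sum_(j < n.+1) (entry j x).1 * t j n, \sum_(j < n.+1) (entry j x).2 * t j n).
Proof. by rewrite /entry /rmul/= !row_val_mul. Qed.

Lemma level_rmul n t : level entry n.+1 (fun x => entry n (rmul x t)).
Proof.
move=> x y xy; rewrite !entry_rmul; congr pair; apply: eq_bigr => j _.
  by rewrite xy.
by rewrite xy.
Qed.

Lemma level_comp_rmul (U : Type) N t (f : X2 -> U) :
  level entry N f -> level entry N (fun x => f (rmul x t)).
Proof.
move=> fN x y xy; apply: fN => n nN; apply: level_rmul => j jn.
by apply: xy; exact: leq_trans jn nN.
Qed.

Lemma measurable_rmul t : measurable_fun setT (fun x => rmul x t).
Proof. apply: measurable_entry_map => n; exists n.+1; exact: level_rmul. Qed.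

Lemma rmul_L12 x t : rmul (L12 x) t = L12 (rmul x t).
Proof.
apply: entry_inj => n; rewrite entry_L12 !entry_rmul /shear/=; apply/pair_equal_spec; split.
  rewrite -big_split/=; apply: eq_bigr => j _; rewrite -mulrDl; congr (_ * _).
  by have := entry_L12 j x; rewrite /entry/shear/= => -[].
by [].
Qed.

(** From column [N] on, [t] agrees with the identity, so that right multiplication by [t] leaves
    those columns unchanged. *)
Definition bounded_by N (t : B0) := forall k n, (k < n)%N -> (N <= n)%N -> t k n = 0.

Lemma bounded_by_le N M t : (N <= M)%N -> bounded_by N t -> bounded_by M t.
Proof. by move=> NM tN k n kn Mn; apply: tN => //; exact: leq_trans Mn. Qed.

Definition bound (t : B0) := sval (cid (B0_bounded t)).

Lemma boundP t : bounded_by (bound t) t.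
Proof. by rewrite /bound; case: cid. Qed.

Lemma entry_rmul_bounded N t n x : bounded_by N t -> (N <= n)%N -> entry n (rmul x t) = entry n x.
Proof.
move=> tN Nn; rewrite entry_rmul !big_ord_recr/= (@B0_upper t n n); last by right.
by rewrite eqxx !mulr1 !big1 ?add0r// => j _; rewrite tN ?mulr0.
Qed.

Section quasi_invariance.
Variables (R : realType) (mu : nat -> nat -> probability 'F_2 R).
Hypothesis alpha_gt0 : forall (k n : nat) (r : 'F_2),
  (1 <= k <= 2)%N -> (k < n)%N -> 0 < alpha mu k n r.
Local Notation weight := (weight mu).
Local Notation m := (mu_alpha mu).

Definition mass N (x : X2) : R := \prod_(n < N) weight n (entry n x).

(** In spite of the point masses, a weight is positive at every column that an array really has. *)
Lemma weight_gt0 n x : 0 < weight n (entry n x).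
Proof.
have h k (y : row_space k) : (1 <= k <= 2)%N -> 0 < row_weight mu k n (row_val y n).
  move=> k12; rewrite /row_weight; case: ltnP => kn; first exact: alpha_gt0.
  by rewrite row_val_le// eqxx ltr01.
by rewrite /Submission.weight mulr_gt0// h.
Qed.

Lemma mass_gt0 N x : 0 < mass N x.
Proof. by apply: prodr_gt0 => n _; exact: weight_gt0. Qed.

Lemma level_mass N : level entry N (mass N).
Proof. by move=> x y xy; apply: eq_bigr => n _; rewrite xy. Qed.

(** The quotient of the measures of the fibers of [x t] and of [x] at depth [bound t]; any larger
    depth gives the same value, since the further columns agree. *)
Definition density (t : B0) (x : X2) : R := mass (bound t) (rmul x t) / mass (bound t) x.

Lemma mass_ratio N M t x : bounded_by N t -> (N <= M)%N ->
  mass M (rmul x t) / mass M x = mass N (rmul x t) / mass N x.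
Proof.
move=> tN NM; rewrite /mass.
rewrite -!(big_mkord xpredT (fun n => weight n (entry n (rmul x t)))).
rewrite -!(big_mkord xpredT (fun n => weight n (entry n x))).
rewrite !(@big_cat_nat _ _ _ N 0 M)//=.
have -> : \prod_(N <= i < M) weight i (entry i (rmul x t)) =
          \prod_(N <= i < M) weight i (entry i x).
  by apply: eq_big_nat => n /andP[Nn _]; rewrite (entry_rmul_bounded x tN Nn).
rewrite -mulf_div divff ?mulr1// gt_eqF//.
by apply: prodr_gt0 => n _; exact: weight_gt0.
Qed.

Lemma densityE N t x : bounded_by N t -> density t x = mass N (rmul x t) / mass N x.
Proof.
move=> tN; rewrite -(mass_ratio x tN (leq_maxl N (bound t))).
by rewrite (mass_ratio x (@boundP t) (leq_maxr N (bound t))).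
Qed.

Lemma density_gt0 t x : 0 < density t x.
Proof. by rewrite divr_gt0// mass_gt0. Qed.

Lemma density_ge0 t x : 0 <= density t x.
Proof. exact/ltW/density_gt0. Qed.

Lemma level_density t : level entry (bound t) (density t).
Proof.
apply: (level_comp2 (fun a b : R => a / b)); last exact: level_mass.
by apply: level_comp_rmul; exact: level_mass.
Qed.

Lemma measurable_density t : measurable_fun setT (density t).
Proof. exact: (measurable_level entry_generate (@level_density t)). Qed.

Lemma density_bounded t : exists C : R, forall x, density t x <= C.
Proof.
have [g [gE _]] := levelE (@level_density t).
exists (\sum_i `|g i|) => x; rewrite gE (le_trans (ler_norm _))//.
by rewrite (bigD1 (prefix entry (bound t) x))//= lerDl sumr_ge0.
Qed.

Lemma densityM s t x : density (s * t)%g x = density t (rmul x s) * density s x.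
Proof.
pose N := maxn (bound (s * t)%g) (maxn (bound s) (bound t)).
rewrite (@densityE N (s * t)%g); last first.
  by apply: (bounded_by_le _ (@boundP _)); exact: leq_maxl.
rewrite (@densityE N s); last first.
  by apply: (bounded_by_le _ (@boundP _)); rewrite /N !leq_max leqnn !orbT.
rewrite (@densityE N t); last first.
  by apply: (bounded_by_le _ (@boundP _)); rewrite /N !leq_max leqnn !orbT.
by rewrite -rmulA mulrA divfK// gt_eqF// mass_gt0.
Qed.

Lemma density1 x : density 1%g x = 1.
Proof. by rewrite /density rmul1 divff// gt_eqF// mass_gt0. Qed.

Lemma mass_fiber N a : m (fiber entry N a) = (mass N a)%:E.
Proof. exact: (product_measureE (entry_product_measure mu)). Qed.

Lemma rmul_fiber t N a : (fun x => rmul x t) @^-1` fiber entry N a = fiber entry N (rmul a t^-1%g).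
Proof.
apply/seteqP; split=> x /fiberP xa; apply/fiberP => n nN.
  rewrite -(rmulK t x); apply: (@level_rmul n) => j jn.
  by apply: xa; exact: leq_trans jn nN.
rewrite -[a](rmulVK t a); apply: (@level_rmul n) => j jn.
by apply: xa; exact: leq_trans jn nN.
Qed.

(** Right multiplication by a group element permutes the fibers of a given depth, and from depth
    [bound t] on the density is constant on each of them. It remains to compare masses. *)
Lemma image_density t : has_density m (distribution m (R_act t)) (density t).
Proof.
have [nu nuE] := density_measureP m (density_ge0 t) (measurable_density t).
move=> A mA; rewrite -[RHS]/(density_measure m (density t) A) -nuE.
apply: (fibers_measure_unique entry_generate (N0 := bound t)) => //.
  by apply: le_lt_trans (ltry 1); exact: probability_le1.
move=> N a tN; rewrite nuE /density_measure.
transitivity (\int[m]_(x in fiber entry N a) (density t a)%:E)%E; last first.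
  apply: eq_integral => x /set_mem/fiberP xa; congr EFin.
  by apply: (level_le tN (@level_density t)) => n nN; rewrite xa.
rewrite integral_cst; last exact: (fiber_measurable entry_generate).
transitivity (m (fiber entry N (rmul a t))).
  congr (m _); rewrite -[in RHS](invgK t) -rmul_fiber; exact/funext.
rewrite mass_fiber [X in (_ * X)%E](mass_fiber N a) -EFinM.
rewrite (densityE _ (bounded_by_le tN (@boundP t))) divfK// gt_eqF//.
exact: mass_gt0.
Qed.

Local Open Scope complex_scope.

(** [T_rep] with its derivative replaced by the explicit density. It satisfies the group law at
    every point and not only almost everywhere. *)
Definition translate (t : B0) (f : X2 -> R[i]) : X2 -> R[i] :=
  fun x => (Num.sqrt (density t x))%:C * f (rmul x t).

Lemma T_rep_ae t f : {ae m, forall x, T_rep m t f x = translate t f x}.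
Proof.
have := Radon_Nikodym_density (measurable_density t) (image_density t).
apply: filterS => x /(_ I) h; rewrite /T_rep /translate h/= R_actE invgK//.
Qed.

Lemma ge0_integral_rmul t (h : X2 -> \bar R) : measurable_fun setT h ->
  (forall x, 0 <= h x)%E ->
  (\int[m]_x (h (rmul x t) * (density t x)%:E) = \int[m]_x h x)%E.
Proof.
move=> mh h0.
have mht : measurable_fun setT (fun x => h (rmul x t)).
  exact: (measurableT_comp mh (measurable_rmul t)).
rewrite -(ge0_integral_density (measurable_density t) (image_density t))//.
rewrite (ge0_integral_pushforward (@measurable_R_act t))//.
by rewrite preimage_setT; apply: eq_integral => x _ /=; rewrite R_actE rmulVK.
Qed.

Lemma integral_rmul t (h : X2 -> \bar R) : m.-integrable setT h ->
  (\int[m]_x (h (rmul x t) * (density t x)%:E) = \int[m]_x h x)%E.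
Proof.
move=> ih; have mh := measurable_int _ ih.
have mht : measurable_fun setT (fun x => h (rmul x t)).
  exact: (measurableT_comp mh (measurable_rmul t)).
have ht : (h \o (fun x => rmul x t)) \o R_act t = h.
  by apply/funext => x /=; rewrite R_actE rmulVK.
have ih' : m.-integrable (R_act t @^-1` setT) ((h \o (fun x => rmul x t)) \o R_act t).
  by rewrite ht preimage_setT.
rewrite -(integral_density (measurable_density t) (image_density t)).
  rewrite (integral_pushforward (@measurable_R_act t) mht ih')//.
  by rewrite preimage_setT; under eq_integral do rewrite -[X in X _]/(_ \o _) ht.
exact: (integrable_pushforward (@measurable_R_act t) mht ih').
Qed.

End quasi_invariance.

(** * Square integrable functions and closed subspaces *)

Section complex_functions.
Local Open Scope complex_scope.
Variables (R : realType) (mu : probability X2 R).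
Implicit Types (f g : X2 -> R[i]) (z w : R[i]).
Local Notation Re := complex.Re.
Local Notation Im := complex.Im.

Let eq1_set (W : set (X2 -> R[i])) f g : W f -> f =1 g -> W g.
Proof. by move=> Wf /funext <-. Qed.

Lemma ReD z w : Re (z + w) = Re z + Re w. Proof. by case: z w => [a b][c d]. Qed.
Lemma ImD z w : Im (z + w) = Im z + Im w. Proof. by case: z w => [a b][c d]. Qed.
Lemma ReB z w : Re (z - w) = Re z - Re w. Proof. by case: z w => [a b][c d]. Qed.
Lemma ImB z w : Im (z - w) = Im z - Im w. Proof. by case: z w => [a b][c d]. Qed.
Lemma ReM z w : Re (z * w) = Re z * Re w - Im z * Im w.
Proof. by case: z w => [a b][c d]. Qed.
Lemma ImM z w : Im (z * w) = Re z * Im w + Im z * Re w.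
Proof. by case: z w => [a b][c d]. Qed.

Lemma sqr_norm_ge0 z : 0 <= sqr_norm z.
Proof. by rewrite addr_ge0// sqr_ge0. Qed.

Lemma sqr_normM z w : sqr_norm (z * w) = sqr_norm z * sqr_norm w.
Proof. by rewrite /sqr_norm ReM ImM; ring. Qed.

Lemma sqr_normC (a : R) : sqr_norm a%:C = a ^+ 2.
Proof. by rewrite /sqr_norm/= expr0n addr0. Qed.

Lemma sqr_norm_eq0 z : (sqr_norm z == 0) = (z == 0).
Proof. by case: z => a b; rewrite /sqr_norm/= paddr_eq0 ?sqr_ge0// !sqrf_eq0 eq_complex. Qed.

Lemma sqr_normB z w : sqr_norm (z - w) = sqr_norm (w - z).
Proof. by rewrite /sqr_norm !ReB !ImB; ring. Qed.

Lemma sqr_normD_le z w : sqr_norm (z + w) <= 2 * sqr_norm z + 2 * sqr_norm w.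
Proof.
rewrite /sqr_norm ReD ImD.
have := sqr_ge0 (Re z - Re w); have := sqr_ge0 (Im z - Im w).
by lra.
Qed.

(** The Cauchy-Schwarz inequality by induction: the mixed term is split with weight [k], the number
    of terms already summed. *)
Lemma sqr_norm_sum_le (I : Type) (s : seq I) (F : I -> R[i]) :
  sqr_norm (\sum_(i <- s) F i) <= (size s)%:R * \sum_(i <- s) sqr_norm (F i).
Proof.
elim: s => [|i s IH]; first by rewrite !big_nil mul0r sqr_normC expr0n.
rewrite !big_cons/= -natr1; set S := \sum_(_ <- _) _ in IH *.
set N := \sum_(_ <- _) _ in IH *.
have := sqr_norm_ge0 (F i); have N0 : 0 <= N by apply: sumr_ge0 => j _; exact: sqr_norm_ge0.
move: IH; case: (size s) => [|n] IH Fi0.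
  rewrite mul0r in IH; have S0 : S = 0.
    by apply/eqP; rewrite -sqr_norm_eq0 eq_le IH sqr_norm_ge0.
  by rewrite S0 addr0; lra.
have n0 : 0 < n.+1%:R :> R by rewrite ltr0n.
move: IH Fi0; set k : R := n.+1%:R in n0 * => IH Fi0.
rewrite /sqr_norm ReD ImD in IH Fi0 *.
set a := Re _ in IH Fi0 *; set b := Im _ in IH Fi0 *.
set c := Re _ in IH Fi0 *; set e := Im _ in IH Fi0 *.
have young (x y : R) : 2 * (x * y) <= k * x ^+ 2 + k^-1 * y ^+ 2.
  rewrite -subr_ge0 (_ : _ - _ = k^-1 * (k * x - y) ^+ 2).
    by rewrite mulr_ge0 ?sqr_ge0// invr_ge0 ltW.
  by field; rewrite lt0r_neq0.
have h1 := young c a; have h2 := young e b.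
have h3 : k^-1 * (a ^+ 2 + b ^+ 2) <= N.
  rewrite -(ler_pM2l n0) mulrA divff; last by rewrite gt_eqF.
  by rewrite mul1r.
rewrite !sqrrD; move: h1 h2 h3; rewrite mulrDr; set ki := k^-1 => h1 h2 h3.
by nra.
Qed.

Definition cmeasurable f := measurable_fun setT (fun x => Re (f x)) /\
  measurable_fun setT (fun x => Im (f x)).

Definition norm2 f : \bar R := (\int[mu]_x (sqr_norm (f x))%:E)%E.

Lemma L2P f : L2 mu f <-> cmeasurable f /\ (norm2 f < +oo)%E.
Proof. by split=> [[? ? ?]|[[? ?] ?]]; split. Qed.

Lemma cmeasurable_sqr_norm f : cmeasurable f -> measurable_fun setT (fun x => sqr_norm (f x)).
Proof.
by move=> [mr mi]; apply: measurable_funD; apply: measurable_funX.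
Qed.

Lemma measurable_sqr_norm f : cmeasurable f -> measurable_fun setT (fun x => (sqr_norm (f x))%:E).
Proof. by move=> mf; apply/measurable_EFinP; exact: cmeasurable_sqr_norm. Qed.

Let measurable_eq (a b : X2 -> R) : b =1 a -> measurable_fun setT a -> measurable_fun setT b.
Proof. by move=> /funext ->. Qed.

Lemma cmeasurableD f g : cmeasurable f -> cmeasurable g -> cmeasurable (fun x => f x + g x).
Proof.
move=> [fr fi] [gr gi]; split.
  by apply: (measurable_eq (fun x => ReD _ _)); exact: measurable_funD.
by apply: (measurable_eq (fun x => ImD _ _)); exact: measurable_funD.
Qed.

Lemma cmeasurableM f g : cmeasurable f -> cmeasurable g -> cmeasurable (fun x => f x * g x).
Proof.
move=> [fr fi] [gr gi]; split.
  apply: (measurable_eq (fun x => ReM _ _)).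
  by apply: measurable_funB; exact: measurable_funM.
apply: (measurable_eq (fun x => ImM _ _)).
by apply: measurable_funD; exact: measurable_funM.
Qed.

Lemma cmeasurableC (a : X2 -> R) : measurable_fun setT a -> cmeasurable (fun x => (a x)%:C).
Proof. by move=> ma; split=> //; exact: measurable_cst. Qed.

Lemma cmeasurable_cst z : cmeasurable (cst z).
Proof. by split; exact: measurable_cst. Qed.

Lemma cmeasurableB f g : cmeasurable f -> cmeasurable g -> cmeasurable (fun x => f x - g x).
Proof.
move=> [fr fi] [gr gi]; split.
  by apply: (measurable_eq (fun x => ReB _ _)); exact: measurable_funB.
by apply: (measurable_eq (fun x => ImB _ _)); exact: measurable_funB.
Qed.

Lemma norm2_ge0 f : (0 <= norm2 f)%E.
Proof. by apply: integral_ge0 => x _; rewrite lee_fin sqr_norm_ge0. Qed.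

Lemma norm2_le f g : cmeasurable f -> cmeasurable g ->
  (forall x, sqr_norm (f x) <= sqr_norm (g x)) -> (norm2 f <= norm2 g)%E.
Proof.
move=> mf mg fg; apply: ge0_le_integral => //.
- by move=> x _; rewrite lee_fin sqr_norm_ge0.
- exact: measurable_sqr_norm.
- exact: measurable_sqr_norm.
- by move=> x _; rewrite lee_fin.
Qed.

Lemma norm2_scale z f : cmeasurable f ->
  norm2 (fun x => z * f x) = ((sqr_norm z)%:E * norm2 f)%E.
Proof.
move=> mf; rewrite /norm2; under eq_integral do rewrite sqr_normM EFinM.
by rewrite ge0_integralZl_EFin ?sqr_norm_ge0//;
  [move=> x _; rewrite lee_fin sqr_norm_ge0|exact: measurable_sqr_norm].
Qed.

Lemma norm2D_le f g : cmeasurable f -> cmeasurable g ->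
  (norm2 (fun x => (f x + g x)%R) <= 2%:E * norm2 f + 2%:E * norm2 g)%E.
Proof.
move=> mf mg; rewrite /norm2.
rewrite -!ge0_integralZl_EFin//; try by move=> x _; rewrite lee_fin sqr_norm_ge0.
all: try exact: measurable_sqr_norm.
rewrite -ge0_integralD//.
- apply: ge0_le_integral => //.
  + by move=> x _; rewrite lee_fin sqr_norm_ge0.
  + exact: (measurable_sqr_norm (cmeasurableD mf mg)).
  + by apply: emeasurable_funD; apply: measurable_funeM; exact: measurable_sqr_norm.
  + by move=> x _; rewrite -!EFinM -EFinD lee_fin sqr_normD_le.
- by move=> x _; rewrite -EFinM lee_fin mulr_ge0// sqr_norm_ge0.
- by apply: measurable_funeM; exact: measurable_sqr_norm.
- by move=> x _; rewrite -EFinM lee_fin mulr_ge0// sqr_norm_ge0.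
- by apply: measurable_funeM; exact: measurable_sqr_norm.
Qed.

Lemma L2_le f g : cmeasurable f -> L2 mu g -> 
  (forall x, sqr_norm (f x) <= sqr_norm (g x)) -> L2 mu f.
Proof.
move=> mf /L2P[mg gfin] fg; apply/L2P; split=> //.
by apply: le_lt_trans gfin; exact: norm2_le.
Qed.

Lemma L2_comb z f g : L2 mu f -> L2 mu g -> L2 mu (fun x => z * f x + g x).
Proof.
move=> /L2P[mf ff] /L2P[mg gf]; apply/L2P.
have mzf : cmeasurable (fun x => z * f x) by exact/cmeasurableM/mf/cmeasurable_cst.
split; first exact: cmeasurableD.
apply: le_lt_trans (norm2D_le mzf mg) _; apply: lte_add_pinfty.
  rewrite norm2_scale// muleA -EFinM.
  by apply: lte_mul_pinfty => //; rewrite lee_fin mulr_ge0// sqr_norm_ge0.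
exact: lte_mul_pinfty.
Qed.

Lemma L2_0 : L2 mu (cst 0).
Proof.
apply/L2P; split; first exact: cmeasurable_cst.
by rewrite /norm2/= sqr_normC expr0n/= integral0 ltry.
Qed.

Lemma L2_1 : L2 mu (cst 1).
Proof.
apply/L2P; split; first exact: cmeasurable_cst.
rewrite /norm2/= sqr_normC expr1n integral_cst// mul1e.
by apply: le_lt_trans (ltry 1); exact: probability_le1.
Qed.

Definition restrict (A : set X2) f : X2 -> R[i] := fun x => (\1_A x)%:C * f x.

Lemma restrictE A f x : restrict A f x = if x \in A then f x else 0.
Proof. by rewrite /restrict indicE; case: (x \in A); rewrite ?mul1r ?mul0r. Qed.

Lemma cmeasurable_restrict A f : measurable A -> cmeasurable f -> cmeasurable (restrict A f).
Proof. by move=> mA mf; apply: cmeasurableM => //; apply: cmeasurableC; exact: measurable_indic. Qed.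

Lemma sqr_norm_restrict A f x : sqr_norm (restrict A f x) <= sqr_norm (f x).
Proof. by rewrite restrictE; case: ifP => // _; rewrite sqr_normC expr0n sqr_norm_ge0. Qed.

Lemma L2_restrict A f : measurable A -> L2 mu f -> L2 mu (restrict A f).
Proof.
move=> mA Lf; have /L2P[mf _] := Lf.
by apply: L2_le Lf _ => [|x]; [exact: cmeasurable_restrict|exact: sqr_norm_restrict].
Qed.

Section closed_subspace_theory.
Variable V : set (X2 -> R[i]).
Hypothesis cV : closed_subspace mu V.

Lemma closed_L2 f : V f -> L2 mu f. Proof. by case: cV => h _ _ _; exact: h. Qed.

Lemma closed_0 : V (cst 0). Proof. by case: cV. Qed.

Lemma closed_comb z f g : V f -> V g -> V (fun x => z * f x + g x).
Proof. by case: cV => _ _ h _; exact: h. Qed.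

Lemma closed_add f g : V f -> V g -> V (fun x => f x + g x).
Proof.
move=> Vf Vg; apply: (eq1_set (closed_comb 1 Vf Vg)) => x.
by rewrite mul1r.
Qed.

Lemma closed_sub f g : V f -> V g -> V (fun x => f x - g x).
Proof.
move=> Vf Vg; apply: (eq1_set (closed_comb (-1) Vg Vf)) => x.
by rewrite mulN1r addrC.
Qed.

Lemma closed_scale z f : V f -> V (fun x => z * f x).
Proof.
move=> Vf; apply: (eq1_set (closed_comb z Vf closed_0)) => x.
by rewrite addr0.
Qed.

Lemma closed_sum (I : Type) (s : seq I) (F : I -> X2 -> R[i]) :
  (forall i, V (F i)) -> V (fun x => \sum_(i <- s) F i x).
Proof.
move=> VF; elim: s => [|i s IH].
  by apply: (eq1_set (closed_0)) => x; rewrite big_nil.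
apply: (eq1_set (closed_add (VF i) IH)) => x.
by rewrite big_cons.
Qed.

Lemma closed_lim (u : nat -> X2 -> R[i]) f : (forall n, V (u n)) -> L2 mu f ->
  norm2 (fun x => u n x - f x) @[n --> \oo] --> 0%E -> V f.
Proof. by case: cV => _ _ _ h; exact: h. Qed.

Lemma closed_ae f g : V f -> L2 mu g -> {ae mu, forall x, f x = g x} -> V g.
Proof.
move=> Vf Lg fg; apply: (@closed_lim (fun=> f)) => //.
have /L2P[mf _] := closed_L2 Vf; have /L2P[mg _] := Lg.
rewrite (_ : norm2 _ = 0%E); first exact: cvg_cst.
transitivity (\int[mu]_x (cst 0%E x : \bar R))%E; last exact: integral0.
apply: ae_eq_integral => //; first exact: (measurable_sqr_norm (cmeasurableB mf mg)).
by apply: filterS fg => x -> _; rewrite subrr sqr_normC expr0n.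
Qed.

Lemma closed_dominated (u : nat -> X2 -> R[i]) f (G : X2 -> R) :
  (forall n, V (u n)) -> L2 mu f ->
  (forall x, sqr_norm (u n x - f x) @[n --> \oo] --> 0) ->
  mu.-integrable setT (EFin \o G) ->
  (forall n x, sqr_norm (u n x - f x) <= G x) -> V f.
Proof.
move=> Vu Lf uf iG uG; apply: (closed_lim Vu) => //.
have /L2P[mf _] := Lf.
have mu_ n : cmeasurable (u n) by have /L2P[] := closed_L2 (Vu n).
have c0 : {ae mu, forall x, setT x ->
    (sqr_norm (u n x - f x))%:E @[n --> \oo] --> (cst 0%E x : \bar R)}.
  by apply: aeW => x _; apply: cvg_EFin => //; [exact: nearW|exact: uf].
have dom : {ae mu, forall x n, setT x -> (`|(sqr_norm (u n x - f x))%:E| <= (EFin \o G) x)%E}.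
  by apply: aeW => x n _; rewrite /= ger0_norm ?sqr_norm_ge0// lee_fin uG.
have [_ _] := dominated_convergence measurableT
  (fun n => measurable_sqr_norm (cmeasurableB (mu_ n) mf)) (measurable_cst _) c0 iG dom.
by rewrite integral0.
Qed.

Let integrable_norm2 f : L2 mu f -> mu.-integrable setT (EFin \o (fun x => sqr_norm (f x))).
Proof.
move=> /L2P[mf ff]; apply/integrableP; split; first exact: measurable_sqr_norm.
apply: le_lt_trans ff; rewrite /norm2 le_eqVlt; apply/orP; left; apply/eqP.
by apply: eq_integral => x _; rewrite /= ger0_norm// sqr_norm_ge0.
Qed.

Lemma closed_restrict_bigcup (F : (set X2)^nat) f : (forall n, measurable (F n)) ->
  nondecreasing_seq F -> L2 mu f -> (forall n, V (restrict (F n) f)) ->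
  V (restrict (\bigcup_n F n) f).
Proof.
move=> mF ndF Lf VF.
apply: (closed_dominated VF _ _ (integrable_norm2 Lf)).
- by apply: L2_restrict => //; exact: bigcupT_measurable.
- move=> x; have [[k _ Fk]|nF] := pselect ((\bigcup_n F n) x).
    apply: cvg_near_cst; near=> n; rewrite !restrictE !mem_set//.
    + by rewrite subrr sqr_normC expr0n.
    + by exists k.
    + have kn : (k <= n)%N by near: n; exact: nbhs_infty_ge.
      by move/subsetPset : (ndF _ _ kn); exact.
  apply: cvg_near_cst; apply: nearW => n; rewrite !restrictE !memNset//.
  + by rewrite subrr sqr_normC expr0n.
  + by move=> Fn; apply: nF; exists n.
- move=> n x; rewrite !restrictE.
  case: (boolP (x \in \bigcup_n F n)) => [_|nF].
    by case: ifP => _; rewrite ?subrr ?sqr_normC ?expr0n ?sqr_norm_ge0// sqr_normB subr0.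
  rewrite ifF ?subrr ?sqr_normC ?expr0n ?sqr_norm_ge0//.
  by apply/negP => /set_mem Fn; move/negP : nF; apply; apply/mem_set; exists n.
Unshelve. all: by end_near. Qed.

Lemma restrictT f : restrict setT f = f.
Proof. by apply/funext => x; rewrite restrictE mem_set. Qed.

(** The sets [F] for which the conclusion holds form a lambda-system: proper differences by
    linearity, increasing unions by dominated convergence. *)
Lemma closed_restrict_pi_lambda (G : set (set X2)) (s : X2 -> X2) f :
  @measurable _ X2 = <<s G >> -> setI_closed G -> measurable_fun setT s -> V f ->
  (forall C, G C -> V (restrict (s @^-1` C) f)) ->
  forall F, measurable F -> V (restrict (s @^-1` F) f).
Proof.
move=> GE GI ms Vf VG.
pose H : set (set X2) := [set F | measurable F /\ V (restrict (s @^-1` F) f)].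
suff sH : <<s G >> `<=` H by move=> F; rewrite GE => /sH[].
have mG : G `<=` measurable by rewrite GE; exact: sub_sigma_algebra.
apply: lambda_system_subset => //; last by move=> C GC; split; [exact: mG|exact: VG].
split=> //.
- by split=> //; rewrite preimage_setT restrictT.
- move=> A B BA [mA VA] [mB VB]; split; first exact: measurableD.
  apply: (eq1_set (closed_sub VA VB)) => x.
  rewrite !restrictE; have [Bx|nB] := pselect (B (s x)).
    rewrite (mem_set (_ : (s @^-1` A) x)); last exact: BA.
    by rewrite (mem_set (_ : (s @^-1` B) x))// subrr memNset// => -[].
  rewrite (memNset (_ : ~ (s @^-1` B) x))// subr0.
  have [Ax|nA] := pselect (A (s x)); first by rewrite !mem_set.
  by rewrite !memNset// => -[].
- move=> F ndF HF; split; first by apply: bigcupT_measurable => n; have [] := HF n.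
  rewrite preimage_bigcup; apply: closed_restrict_bigcup.
  + by move=> n; rewrite -[X in measurable X]setTI; apply: ms => //; have [] := HF n.
  + move=> n k nk; apply/subsetPset => x.
    by move/subsetPset : (ndF _ _ nk) => h Fx; exact: h.
  + exact: closed_L2.
  + by move=> n; have [] := HF n.
Qed.

Import HBNNSimple.

(** Simple functions [g n] increase to [a], and [0 <= g n <= a] bounds the squared error by the
    squared norm of [a * f]. *)
Let closed_mul_ge0 (a : X2 -> R) f : V f -> (forall E, measurable E -> V (restrict E f)) ->
  measurable_fun setT a -> (forall x, 0 <= a x) -> L2 mu (fun x => (a x)%:C * f x) ->
  V (fun x => (a x)%:C * f x).
Proof.
move=> Vf VE ma a0 Laf.
have mEa : measurable_fun setT (EFin \o a) by exact/measurable_EFinP.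
pose g := nnsfun_approx measurableT mEa.
have gcvg x : g n x @[n --> \oo] --> a x.
  have := @cvg_nnsfun_approx _ _ _ _ measurableT _ mEa _ x I.
  by move=> /(_ (fun y _ => (a0 y : (0 <= (a y)%:E)%E)))/fine_cvg.
have ga x n : 0 <= g n x <= a x.
  rewrite fun_ge0/=; rewrite -(cvg_lim _ (gcvg x))//.
  apply: nondecreasing_cvgn_le; last by apply/cvg_ex; exists (a x); exact: gcvg.
  by move=> i j ij; exact/lefP/nd_nnsfun_approx.
have normE n x : sqr_norm ((g n x)%:C * f x - (a x)%:C * f x) =
    (g n x - a x) ^+ 2 * sqr_norm (f x).
  by rewrite -mulrBl sqr_normM -rmorphB sqr_normC.
apply: (@closed_dominated (fun n x => (g n x)%:C * f x) _
  (fun x => sqr_norm ((a x)%:C * f x))) => //.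
- move=> n; apply: (eq1_set (W := V) (f := fun x =>
    \sum_(y <- finmap.enum_fset (fset_set (range (g n))))
      y%:C * restrict (g n @^-1` [set y]) f x)).
    by apply: closed_sum => y; apply: closed_scale; apply: VE.
  move=> x; rewrite (fimfunE (g n) x) fsbig_finite//= rmorph_sum/= mulr_suml.
  by apply: eq_bigr => y _; rewrite rmorphM/= mulrA.
- move=> x; under eq_fun do rewrite normE.
  have d0 : (g n x - a x) @[n --> \oo] --> 0.
    by rewrite -(subrr (a x)); apply: cvgB; [exact: gcvg|exact: cvg_cst].
  have h : (g n x - a x) * (g n x - a x) * sqr_norm (f x) @[n --> \oo] -->
      0 * 0 * sqr_norm (f x).
    by apply: cvgM; [exact: cvgM|exact: cvg_cst].
  rewrite !mul0r in h; apply: (cvg_trans _ h); apply: near_eq_cvg; apply: nearW => n /=.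
  by rewrite expr2.
- exact: integrable_norm2.
- move=> n x; rewrite normE sqr_normM sqr_normC ler_wpM2r ?sqr_norm_ge0//.
  have /andP[g0 gax] := ga x n; rewrite -subr_ge0.
  rewrite (_ : _ - _ = g n x * (2 * a x - g n x)); last by ring.
  by rewrite mulr_ge0//; lra.
Qed.

Let closed_mul_real (a : X2 -> R) f : V f -> (forall E, measurable E -> V (restrict E f)) ->
  measurable_fun setT a -> L2 mu (fun x => (a x)%:C * f x) ->
  V (fun x => (a x)%:C * f x).
Proof.
move=> Vf VE ma Laf.
have mf : cmeasurable f by have /L2P[] := closed_L2 Vf.
have h (b : X2 -> R) : measurable_fun setT b -> (forall x, 0 <= b x <= `|a x|) ->
    V (fun x => (b x)%:C * f x).
  move=> mb ba; apply: closed_mul_ge0 => //; first by move=> x; have /andP[] := ba x.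
  apply: (L2_le _ Laf); first by apply: cmeasurableM => //; exact: cmeasurableC.
  move=> x; rewrite !sqr_normM !sqr_normC ler_wpM2r ?sqr_norm_ge0//.
  have /andP[b0 bax] := ba x; rewrite -[leRHS]real_normK ?num_real//.
  by rewrite ler_pXn2r// nnegrE.
have mp : measurable_fun setT (fun x => Num.max (a x) 0).
  by apply: measurable_maxr => //; exact: measurable_cst.
have mn : measurable_fun setT (fun x => Num.max (- a x) 0).
  by apply: measurable_maxr; [exact: measurable_funN|exact: measurable_cst].
apply: (eq1_set (closed_sub (h _ mp _) (h _ mn _))).
- by move=> x; rewrite le_max lexx orbT/= ge_max ler_norm normr_ge0.
- by move=> x; rewrite le_max lexx orbT/= ge_max -normrN ler_norm normr_ge0.
- move=> x; rewrite -mulrBl -rmorphB; congr (_%:C * _).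
  by rewrite /Num.max; case: ifPn; case: ifPn; lra.
Qed.

Lemma closed_mul (a : X2 -> R[i]) f : V f -> (forall E, measurable E -> V (restrict E f)) ->
  cmeasurable a -> L2 mu (fun x => a x * f x) -> V (fun x => a x * f x).
Proof.
move=> Vf VE [mr mi] Laf.
have mf : cmeasurable f by have /L2P[] := closed_L2 Vf.
apply: (eq1_set (closed_comb 'i (@closed_mul_real _ _ Vf VE mi _) (@closed_mul_real _ _ Vf VE mr _))).
- apply: (L2_le _ Laf); first by apply: cmeasurableM => //; exact: cmeasurableC.
  move=> x; rewrite !sqr_normM ler_wpM2r ?sqr_norm_ge0// sqr_normC /sqr_norm.
  by rewrite lerDr sqr_ge0.
- apply: (L2_le _ Laf); first by apply: cmeasurableM => //; exact: cmeasurableC.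
  move=> x; rewrite !sqr_normM ler_wpM2r ?sqr_norm_ge0// sqr_normC /sqr_norm.
  by rewrite lerDl sqr_ge0.
- move=> x; rewrite mulrA -mulrDl; congr (_ * _).
  by apply/eqP; rewrite eq_complex ReD ImD ReM ImM/=; apply/andP; split; apply/eqP; ring.
Qed.

(** A density argument: a property whose solutions form a closed subspace holds on all of [L2] once
    it holds for the constant 1 and the indicator functions of a generating pi-system. *)
Lemma closed_total (G : set (set X2)) : @measurable _ X2 = <<s G >> -> setI_closed G ->
  V (cst 1) -> (forall C, G C -> V (restrict C (cst 1))) -> V = L2 mu.
Proof.
move=> GE GI V1 VG; apply/seteqP; split; first by case: cV.
move=> f Lf; apply: (eq1_set (W := V) (f := fun x => f x * cst 1 x)); last by move=> x; rewrite mulr1.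
apply: closed_mul => //.
- exact: (@closed_restrict_pi_lambda G id).
- by have /L2P[] := Lf.
- by apply: (eq1_set Lf) => x; rewrite mulr1.
Qed.

End closed_subspace_theory.
End complex_functions.

(** * Group elements and their action on columns *)

Section elements.
Variables (g : nat -> nat -> 'F_2) (N : nat).

Definition elt_mx : infmx := fun k n =>
  if [&& (0 < k)%N, (k < n)%N & (n < N)%N] then g k n else (k == n)%:R.

Lemma elt_mxP : B0_bool elt_mx.
Proof.
apply/asboolP/B0_predP; split=> [k n|].
  rewrite /elt_mx => -[->//|nk]; by rewrite [(k < n)%N]ltnNge nk/= andbF.
exists N => k n kn Nn; rewrite /elt_mx [(n < N)%N]ltnNge Nn !andbF.
by rewrite ltn_eqF.
Qed.

Definition elt : B0 := MkB0 elt_mxP.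

Lemma elt_bounded : bounded_by N elt.
Proof.
move=> k n kn Nn; rewrite /= /elt_mx [(n < N)%N]ltnNge Nn !andbF.
by rewrite ltn_eqF.
Qed.

Lemma entry_elt n x : (n < N)%N -> entry n (rmul x elt) =
  ((entry n x).1 + \sum_(j < n) (entry j x).1 * g j n,
   (entry n x).2 + \sum_(j < n) (entry j x).2 * g j n).
Proof.
move=> nN; rewrite entry_rmul !big_ord_recr/= {2 4}/elt_mx ltnn/= andbF eqxx !mulr1.
have E (F : nat -> 'F_2) : F 0%N = 0 ->
    \sum_(j < n) F j * elt_mx j n = \sum_(j < n) F j * g j n.
  move=> F0; apply: eq_bigr => j _; rewrite /elt_mx ltn_ord nN !andbT.
  by case: (posnP j) => [->|]//; rewrite F0 !mul0r.
rewrite (E (fun j => (entry j x).1)); last by rewrite /entry/= row_val_le.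
rewrite (E (fun j => (entry j x).2)); last by rewrite /entry/= row_val_le.
by apply/pair_equal_spec; split; rewrite addrC.
Qed.

End elements.

Lemma entry1 x : entry 1 x = (1, 0).
Proof. by rewrite /entry !row_val_le. Qed.

Lemma entry2_2 x : (entry 2 x).2 = 1.
Proof. by rewrite /entry/= row_val_le. Qed.

(* I + \sum_(lo <= n < hi) E_kn *)
Definition block k lo hi := elt (fun j n => ((j == k) && (lo <= n)%N)%:R) hi.

Lemma entry_block k lo hi n x : (0 < k < lo)%N -> entry n (rmul x (block k lo hi)) =
  if (lo <= n < hi)%N then entry n x + entry k x else entry n x.
Proof.
move=> /andP[k0 klo]; have [hn|nh] := leqP hi n.
  by rewrite andbF (entry_rmul_bounded x (@elt_bounded _ hi) hn).
rewrite entry_elt// andbT.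
have [lon|nlo] := leqP lo n; last first.
  by rewrite !big1 ?addr0; [case: (entry n x)|..] => // j _; rewrite andbF mulr0.
have kn := leq_trans klo lon.
have E (F : nat -> 'F_2) : \sum_(j < n) F j * (((j : nat) == k) && true)%:R = F k.
  rewrite (bigD1 (Ordinal kn))//= eqxx/= mulr1 big1 ?addr0// => j.
  by rewrite -val_eqE/= => /negPf ->; rewrite mulr0.
by rewrite (E (fun j => (entry j x).1)) (E (fun j => (entry j x).2)).
Qed.

(** The element with prescribed first two rows. As column 1 of an array is [(1, 0)] and column 2 is
    [(x_12, 1)], it adds [(r1 n + x_12 * r2 n, r2 n)] to column [n] for [2 < n < N]; the term in
    [x_12] is the origin of [straighten]. *)
Definition rows (r1 r2 : nat -> 'F_2) N := elt (fun j n =>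
  if j == 1%N then r1 n else if j == 2%N then r2 n else 0) N.

Lemma entry_rows2 r1 r2 N x : (2 < N)%N ->
  entry 2 (rmul x (rows r1 r2 N)) = ((entry 2 x).1 + r1 2, 1).
Proof.
move=> N2; rewrite entry_elt//.
have E (F : nat -> 'F_2) : \sum_(j < 2) F j *
    (if (j : nat) == 1%N then r1 2 else if (j : nat) == 2%N then r2 2 else 0) = F 1%N * r1 2.
  by rewrite !big_ord_recr big_ord0/= mulr0 !add0r.
rewrite (E (fun j => (entry j x).1)) (E (fun j => (entry j x).2)).
by rewrite entry1 entry2_2 mul1r mul0r addr0.
Qed.

Lemma entry_rows r1 r2 N n x : (2 < n < N)%N -> entry n (rmul x (rows r1 r2 N)) =
  ((entry n x).1 + r1 n + (entry 2 x).1 * r2 n, (entry n x).2 + r2 n).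
Proof.
move=> /andP[n2 nN]; rewrite entry_elt//.
have E (F : nat -> 'F_2) : \sum_(j < n) F j *
    (if (j : nat) == 1%N then r1 n else if (j : nat) == 2%N then r2 n else 0) =
    F 1%N * r1 n + F 2%N * r2 n.
  have n1 := ltn_trans (ltnSn 1) n2.
  rewrite (bigD1 (Ordinal n1))//= (bigD1 (Ordinal n2))//= big1 ?addr0//.
  by move=> j; rewrite -!val_eqE/= => /andP[/negPf -> /negPf ->]; rewrite mulr0.
rewrite (E (fun j => (entry j x).1)) (E (fun j => (entry j x).2)).
by rewrite entry1 entry2_2 !mul1r mul0r add0r addrA.
Qed.

(** * Translations as unitary operators *)

Section translations.
Local Open Scope complex_scope.
Variables (R : realType) (mu : nat -> nat -> probability 'F_2 R).
Hypothesis alpha_gt0 : forall (k n : nat) (r : 'F_2),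
  (1 <= k <= 2)%N -> (k < n)%N -> 0 < alpha mu k n r.
Local Notation m := (mu_alpha mu).
Local Notation density := (density mu).
Local Notation translate := (translate mu).
Implicit Types (f g : X2 -> R[i]).

Lemma translateM s t f : translate s (translate t f) = translate (s * t)%g f.
Proof.
apply/funext => x; rewrite /Submission.translate mulrA -rmorphM/= -sqrtrM ?density_ge0//.
by rewrite densityM// rmulA [density s x * _]mulrC.
Qed.

Lemma translate1 f : translate 1%g f = f.
Proof. by apply/funext => x; rewrite /Submission.translate density1// sqrtr1 mul1r rmul1. Qed.

Lemma cmeasurable_translate t f : cmeasurable f -> cmeasurable (translate t f).
Proof.
move=> [fr fi]; apply: cmeasurableM.
  apply: cmeasurableC; apply: (measurable_level entry_generate (N := bound t)) => x y xy.
  by congr Num.sqrt; exact: level_density.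
by split; [apply: (measurableT_comp fr)|apply: (measurableT_comp fi)]; exact: measurable_rmul.
Qed.

Lemma sqr_norm_translate t f x :
  sqr_norm (translate t f x) = sqr_norm (f (rmul x t)) * density t x.
Proof. by rewrite sqr_normM sqr_normC sqr_sqrtr ?density_ge0// mulrC. Qed.

Lemma norm2_translate t f : cmeasurable f -> norm2 m (translate t f) = norm2 m f.
Proof.
move=> mf; rewrite /norm2; under eq_integral do rewrite sqr_norm_translate EFinM.
apply: (ge0_integral_rmul alpha_gt0 t (h := fun x => (sqr_norm (f x))%:E)).
  exact: measurable_sqr_norm.
by move=> x; rewrite lee_fin sqr_norm_ge0.
Qed.

Lemma L2_translate t f : L2 m f -> L2 m (translate t f).
Proof.
move=> /L2P[mf ff]; apply/L2P; split; first exact: cmeasurable_translate.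
by rewrite norm2_translate.
Qed.

Lemma translate_restrict t A f :
  translate t (restrict A (translate t^-1%g f)) = restrict ((fun x => rmul x t) @^-1` A) f.
Proof.
apply/funext => x; rewrite -[in RHS](translate1 f) -(mulgV t) -translateM.
rewrite /restrict /Submission.translate !indicE mulrCA; congr (_%:R%:C * _).
Qed.

Section invariant.
Variable V : set (X2 -> R[i]).
Hypotheses (cV : closed_subspace m V) (TV : forall t f, V f -> V (T_rep m t f)).

Lemma closed_translate t f : V f -> V (translate t f).
Proof.
move=> Vf; apply: (closed_ae cV (TV t Vf)); first exact/L2_translate/(closed_L2 cV).
exact: T_rep_ae.
Qed.

Lemma closed_restrict_translate t A :
  (forall f, V f -> V (restrict A f)) ->
  forall f, V f -> V (restrict ((fun x => rmul x t) @^-1` A) f).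
Proof.
move=> VA f Vf; rewrite -translate_restrict.
by apply: closed_translate; apply: VA; exact: closed_translate.
Qed.

End invariant.

End translations.

(** * Averages of translates *)

Section vanishing_operators.
Local Open Scope complex_scope.
Variables (R : realType) (m : probability X2 R).

(** The operators are uniformly bounded, so convergence to 0 passes from functions [u n] close to
    [f] to [f] itself. With [closed_total], strong convergence can then be tested on indicator
    functions. *)
Lemma closed_vanishing (B : nat -> (X2 -> R[i]) -> X2 -> R[i]) (C : R) : 0 < C ->
  (forall J f, cmeasurable f -> cmeasurable (B J f)) ->
  (forall J z f g x, B J (fun x => z * f x + g x) x = z * B J f x + B J g x) ->
  (forall J f, cmeasurable f -> (norm2 m (B J f) <= C%:E * norm2 m f)%E) ->
  closed_subspace m [set f | L2 m f /\ norm2 m (B J f) @[J --> \oo] --> 0%E].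
Proof.
move=> C0 mB linB bB; set G := (X in closed_subspace _ X).
have G_le (f : X2 -> R[i]) (u : nat -> \bar R) : L2 m f -> u n @[n --> \oo] --> 0%E ->
    (forall J, (norm2 m (B J f) <= u J)%E) -> G f.
  move=> Lf u0 fu; split=> //; apply: squeeze_cvge u0; last exact: cvg_cst.
  by apply: nearW => J; rewrite norm2_ge0 fu.
have cvgeZ (c : R) (u : nat -> \bar R) : u n @[n --> \oo] --> 0%E -> (c%:E * u n)%E @[n --> \oo] --> 0%E.
  by move=> u0; rewrite -(mule0 c%:E); apply: cvgeZl.
have cvgeDz (u v : nat -> \bar R) : u n @[n --> \oo] --> 0%E -> v n @[n --> \oo] --> 0%E ->
    (u n + v n)%E @[n --> \oo] --> 0%E.
  by move=> u0 v0; rewrite -(adde0 0%E); apply: cvgeD.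
have GL f : G f -> cmeasurable f by move=> [/L2P[]].
split.
- by move=> f [].
- refine (G_le (cst 0) (fun=> (C%:E * norm2 m (cst 0%R))%E) (L2_0 m) _ _);
    last by move=> J; apply: bB; exact: cmeasurable_cst.
  rewrite /norm2/= sqr_normC expr0n/= integral0 mule0; exact: cvg_cst.
- move=> z f g [Lf f0] [Lg g0].
  have /L2P[mf _] := Lf; have /L2P[mg _] := Lg.
  apply: (@G_le _ (fun J => 2%:E * ((sqr_norm z)%:E * norm2 m (B J f)) + 2%:E * norm2 m (B J g))%E).
  + exact: L2_comb.
  + apply: cvgeDz; [exact: (cvgeZ _ _ (cvgeZ _ _ f0))|exact: (cvgeZ _ _ g0)].
  + move=> J; rewrite -norm2_scale; last exact: mB.
    rewrite (_ : B J _ = (fun x => z * B J f x + B J g x)); last by apply/funext => x; exact: linB.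
    by apply: norm2D_le; [apply: cmeasurableM; [exact: cmeasurable_cst|]|]; exact: mB.
- move=> u f Gu Lf uf; split=> //.
  have /L2P[mf _] := Lf.
  have B0 J : (0 <= norm2 m (B J f))%E by exact: norm2_ge0.
  suff h (e : R) : 0 < e -> \forall J \near \oo, (norm2 m (B J f) <= e%:E)%E.
    apply/fine_cvgP; split.
      apply: filterS (h 1 ltr01) => J BJ; rewrite ge0_fin_numE//.
      exact: le_lt_trans BJ (ltry _).
    apply/cvgr0Pnorm_le => e e0; apply: filterS (h e e0) => J BJ /=.
    rewrite ger0_norm ?fine_ge0// -lee_fin fineK// ge0_fin_numE//.
    exact: le_lt_trans BJ (ltry _).
  move=> e0.
  (* The part [f - u n] contributes [2 * C * e'] and the part [u n] contributes [2 * e']. *)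
  pose e' := e / (2 * C + 2).
  have C2 : 0 < 2 * C + 2 by lra.
  have e'0 : 0 < e' by rewrite divr_gt0.
  have small (v : nat -> \bar R) (r : R) : (forall n, (0 <= v n)%E) -> 0 < r ->
      v n @[n --> \oo] --> 0%E -> \forall n \near \oo, (v n <= r%:E)%E.
    move=> v0 r0 /fine_cvgP[vfin /cvgr_le/(_ _ r0) vr].
    by near=> n; rewrite -(fineK (_ : v n \is a fin_num)) ?lee_fin; near: n.
  have [n _ /(_ n (leqnn n)) un] := small _ _ (fun n => norm2_ge0 _ _) e'0 uf.
  have [Lu u0] := Gu n; have /L2P[mu_ _] := Lu.
  have := small _ _ (fun n => norm2_ge0 _ _) e'0 u0; apply: filterS => J uJ.
  have mfu := cmeasurableB mf mu_.
  have -> : B J f = fun x => B J (fun y => f y - u n y) x + B J (u n) x.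
    apply/funext => x; have := linB J 1 (fun y => f y - u n y) (u n) x; rewrite mul1r => <-.
    congr (B J _ x).
    by apply/funext => y; rewrite mul1r subrK.
  apply: le_trans (norm2D_le m (mB _ _ mfu) (mB _ _ mu_)) _.
  apply: (@le_trans _ _ (2%:E * (C%:E * e'%:E) + 2%:E * e'%:E)%E).
    have key : norm2 m (fun x => f x - u n x) = norm2 m (fun x => u n x - f x).
      by apply: eq_integral => x _; rewrite sqr_normB.
    apply: leeD; apply: lee_pmul => //; try exact: norm2_ge0.
    apply: le_trans (bB _ _ mfu) _; apply: lee_pmul => //; first by rewrite lee_fin ltW.
      exact: norm2_ge0.
    by rewrite key.
  rewrite -!EFinM -EFinD lee_fin mulrA -mulrDl /e' mulrC mulfVK//.
  by rewrite gt_eqF.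
Unshelve. all: by end_near. Qed.

End vanishing_operators.

Section block_translations.
Local Open Scope complex_scope.
Variables (R : realType) (mu : nat -> nat -> probability 'F_2 R).
Hypothesis alpha_gt0 : forall (k n : nat) (r : 'F_2),
  (1 <= k <= 2)%N -> (k < n)%N -> 0 < alpha mu k n r.
Local Notation m := (mu_alpha mu).
Local Notation density := (density mu).
Local Notation translate := (translate mu).
Local Notation weight := (weight mu).
Local Notation c := (c_coef mu).

(** The affinity of the law of column [n] and its translate by [u], by [affinity_translate]. *)
Definition column_affinity n (u : 'F_2 * 'F_2) : R :=
  shift_affinity mu 1 n u.1 * shift_affinity mu 2 n u.2.

Let shift_affinity_ge0 k n b : 0 <= shift_affinity mu k n b.
Proof. by apply: sumr_ge0 => a _; exact: sqrtr_ge0. Qed.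

Lemma column_affinity_ge0 n u : 0 <= column_affinity n u.
Proof. by rewrite mulr_ge0. Qed.

Lemma column_affinity_le1 n u : (2 < n)%N -> column_affinity n u <= 1.
Proof.
by move=> n2; apply: mulr_ile1 => //; apply: shift_affinity_le1 => //; exact: ltnW.
Qed.

Let weight_pos n v : (2 < n)%N -> 0 < weight n v.
Proof.
move=> n2; rewrite /Submission.weight /Submission.row_weight n2 (ltnW n2).
by rewrite mulr_gt0// alpha_gt0// ltnW.
Qed.

Let ratio n u v : R := Num.sqrt (weight n (v + u) / weight n v).

Let sum_ratio n u : (2 < n)%N -> \sum_v weight n v * ratio n u v = column_affinity n u.
Proof.
move=> n2; rewrite /column_affinity -affinity_translate; apply: eq_bigr => v _.
have w0 := weight_pos v n2.
rewrite /ratio -{1}[weight n v](ger0_norm (ltW w0)) -sqrtr_sqr -sqrtrM ?sqr_ge0//.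
by congr Num.sqrt; field; rewrite gt_eqF.
Qed.

Let sqrtr_prod N (F : nat -> R) : (forall n, 0 <= F n) ->
  Num.sqrt (\prod_(n < N) F n) = \prod_(n < N) Num.sqrt (F n).
Proof.
move=> F0; elim: N => [|N IH]; first by rewrite !big_ord0 sqrtr1.
by rewrite !big_ord_recr/= sqrtrM ?IH// prodr_ge0.
Qed.

Lemma sqrt_density_block k p1 p2 M x : (0 < k < p1)%N -> (p2 <= M)%N ->
  Num.sqrt (density (block k p1 p2) x) = \prod_(n < M)
    if (p1 <= n < p2)%N then ratio n (entry k x) (entry n x) else 1.
Proof.
move=> kp pM; have bM : bounded_by M (block k p1 p2) by apply: (bounded_by_le pM); exact: elt_bounded.
rewrite (densityE alpha_gt0 x bM).
rewrite /mass -prodf_div.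
rewrite (@sqrtr_prod M (fun n => weight n (entry n (rmul x (block k p1 p2))) / weight n (entry n x))).
  apply: eq_bigr => n _; rewrite entry_block//; case: ifP => // _.
  by rewrite divff ?sqrtr1// gt_eqF// weight_gt0.
by move=> n; rewrite divr_ge0// weight_ge0.
Qed.

(** With column [k] equal to [u], the integrand is a product of functions of single columns, and its
    integral factorizes. Every factor is at most 1; the affinities of the first block are the ones
    that are kept. *)
Lemma block_correlation k u p1 p2 q1 q2 : (2 < k)%N -> (k < p1)%N -> (k < q1)%N ->
  (p2 <= q1)%N || (q2 <= p1)%N ->
  (\int[m]_x (\1_[set y | entry k y = u] x * Num.sqrt (density (block k p1 p2) x) *
     Num.sqrt (density (block k q1 q2) x))%:E <=
   (\prod_(p1 <= n < p2) column_affinity n u)%:E)%E.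
Proof.
move=> k2 kp kq pq.
have k0 : (0 < k)%N by rewrite (leq_trans _ k2).
pose M := maxn k.+1 (maxn p2 q2).
have kM : (k < M)%N by rewrite leq_maxl.
have pM : (p2 <= M)%N by rewrite !leq_max leqnn orbT.
have qM : (q2 <= M)%N by rewrite !leq_max leqnn !orbT.
(* Column [k] carries the indicator function; the blocks being disjoint, any other column carries at
   most one ratio. *)
pose psi n v : R := if n == k then (v == u)%:R else
  if (p1 <= n < p2)%N || (q1 <= n < q2)%N then ratio n u v else 1.
have psi0 n v : 0 <= psi n v.
  by rewrite /psi; case: ifP => // _; case: ifP => // _; exact: sqrtr_ge0.
apply: (@le_trans _ _ (\int[m]_x (\prod_(n < M) psi n (entry n x))%:E)%E).
  rewrite le_eqVlt; apply/orP; left; apply/eqP; apply: eq_integral => x _.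
  congr EFin; rewrite indicE.
  have [xu|xu] := pselect (entry k x = u); last first.
    rewrite memNset// !mul0r (bigD1 (Ordinal kM))//= /psi eqxx.
    by case: eqP => //; rewrite mul0r.
  rewrite mem_set// mul1r (sqrt_density_block x _ pM) ?k0// (sqrt_density_block x _ qM) ?k0//.
  rewrite -big_split/=; apply: eq_bigr => n _; rewrite xu /psi.
  case: eqP => [->|_].
    by rewrite xu eqxx [(p1 <= k)%N]leqNgt kp [(q1 <= k)%N]leqNgt kq mulr1.
  case: (boolP (p1 <= n < p2)%N) => [/andP[pn np]|_]/=; last first.
    by rewrite mul1r.
  case: ifP => [/andP[qn nq]|_]; last by rewrite mulr1.
  exfalso; case/orP: pq => h.
    by move: (leq_trans np (leq_trans h qn)); rewrite ltnn.
  by move: (leq_trans nq (leq_trans h pn)); rewrite ltnn.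
rewrite (integral_coordinates entry_generate (entry_product_measure mu))// lee_fin.
have -> : \prod_(p1 <= n < p2) column_affinity n u =
    \prod_(n < M) if (p1 <= n < p2)%N then column_affinity n u else 1.
  rewrite -(big_mkord xpredT (fun n => if (p1 <= n < p2)%N then column_affinity n u else 1)).
  rewrite -big_mkcond/= (big_nat_widen _ _ M)// (big_nat_widenl _ 0)//.
  by apply: eq_bigl => n; rewrite /= andbC.
apply: ler_prod => n _; apply/andP; split.
  by apply: sumr_ge0 => v _; rewrite mulr_ge0// weight_ge0.
rewrite /psi; have [nk|nk] := eqVneq (n : nat) k.
  rewrite nk [(p1 <= k)%N]leqNgt kp/=.
  apply: (@le_trans _ _ (\sum_v weight k v)); last by rewrite weight_sum1.
  apply: ler_sum => v _; rewrite -[leRHS]mulr1 ler_wpM2l ?weight_ge0//.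
  by case: (v == u); rewrite ?ler01 ?lexx.
case: (boolP (p1 <= n < p2)%N) => [/andP[pn np]|_]/=.
  by rewrite sum_ratio// (ltn_trans k2)// (leq_trans kp).
case: (boolP (q1 <= n < q2)%N) => [/andP[qn nq]|_].
  have n2 : (2 < n)%N by rewrite (ltn_trans k2)// (leq_trans kq).
  by rewrite sum_ratio// column_affinity_le1.
rewrite (eq_bigr (fun v => weight n v)) ?weight_sum1// => v _.
by rewrite mulr1.
Qed.

End block_translations.

Section cell_multiplication.
Local Open Scope complex_scope.
Variables (R : realType) (mu : nat -> nat -> probability 'F_2 R).
Hypothesis alpha_gt0 : forall (k n : nat) (r : 'F_2),
  (1 <= k <= 2)%N -> (k < n)%N -> 0 < alpha mu k n r.
Local Notation m := (mu_alpha mu).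
Local Notation density := (density mu).
Local Notation translate := (translate mu).
Local Notation weight := (weight mu).
Local Notation c := (c_coef mu).

Hypothesis small_products : forall (N : nat) (e : R), (2 < N)%N -> 0 < e ->
  exists M, [/\ (N < M)%N, \prod_(N <= n < M) c 1 n <= e & \prod_(N <= n < M) c 2 n <= e].

(** A nonzero [u] either has upper entry 1, and the factors [c 1 n] make the product small, or is
    [(0, 1)], and the factors [c 2 n] do. This is why both products have to be small on the same
    block. *)
Lemma block_sequence k : (2 < k)%N -> exists Ns : nat -> nat,
  [/\ (k < Ns 0)%N, forall j, (Ns j < Ns j.+1)%N &
   forall j u, u != 0 ->
     \prod_(Ns j <= n < Ns j.+1) column_affinity mu n u <= j.+1%:R^-1].
Proof.
move=> k2.
have /choice[nx nxP] (Nj : nat * nat) : exists M, (2 < Nj.1)%N ->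
    [/\ (Nj.1 < M)%N, \prod_(Nj.1 <= n < M) c 1 n <= Nj.2.+1%:R^-1 &
     \prod_(Nj.1 <= n < M) c 2 n <= Nj.2.+1%:R^-1].
  have [N2|N2] := leqP Nj.1 2; first by exists 0%N.
  have e0 : 0 < Nj.2.+1%:R^-1 :> R by rewrite invr_gt0 ltr0n.
  by have [M MP] := small_products N2 e0; exists M.
(* Starting at [k.+1] keeps column [k] to the left of all blocks. *)
pose Ns j := iteri j (fun j N => nx (N, j)) k.+1.
have Nsk j : (k < Ns j)%N.
  elim: j => [|j IH]; first exact: ltnSn.
  have [h _ _] := nxP (Ns j, j) (ltn_trans k2 IH).
  exact: ltn_trans IH h.
have NsP j := nxP (Ns j, j) (ltn_trans k2 (Nsk j)).
exists Ns; split; first exact: Nsk.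
  by move=> j; have [] := NsP j.
move=> j u u0; have [_ h1 h2] := NsP j.
have sh0 i n b : 0 <= shift_affinity mu i n b.
  by apply: sumr_ge0 => a _; exact: sqrtr_ge0.
have hn n : (Ns j <= n)%N -> (2 < n)%N by move=> h; rewrite (ltn_trans k2)// (leq_trans (Nsk j)).
have prod_le (F G : nat -> R) a b : (forall n, (a <= n)%N -> 0 <= F n <= G n) ->
    \prod_(a <= n < b) F n <= \prod_(a <= n < b) G n.
  by move=> FG; rewrite big_nat [leRHS]big_nat; apply: ler_prod => n /andP[an _]; exact: FG.
have [u1|u1] := F2_cases u.1; last first.
  apply: le_trans h1; apply: prod_le => n /hn n2; rewrite column_affinity_ge0/=.
  rewrite /column_affinity u1 shift_affinity1 ?(ltnW n2)//.
  rewrite -[leRHS]mulr1 ler_wpM2l ?shift_affinity_le1//.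
  by rewrite -shift_affinity1 ?(ltnW n2).
have u2 : u.2 = 1.
  by have [u2|//] := F2_cases u.2; move: u0; rewrite (_ : u = 0) ?eqxx// [u]surjective_pairing u1 u2.
apply: le_trans h2; apply: prod_le => n /hn n2; rewrite column_affinity_ge0/=.
rewrite /column_affinity u2 shift_affinity1//.
rewrite -[leRHS]mul1r ler_wpM2r ?shift_affinity_le1 ?(ltnW n2)//.
by rewrite -shift_affinity1.
Qed.

Variable k : nat.
Hypothesis k2 : (2 < k)%N.

Let Z := [set x | entry k x = 0].

Let mZ : measurable Z. Proof. exact: measurable_entry. Qed.

Section averages.
Variable Ns : nat -> nat.
Hypotheses (Nsk : (k < Ns 0)%N) (NsS : forall j, (Ns j < Ns j.+1)%N).
Hypothesis NsP : forall j u, u != 0 ->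
  \prod_(Ns j <= n < Ns j.+1) column_affinity mu n u <= j.+1%:R^-1.

Let Ns_ge j : (j < Ns j)%N && (k < Ns j)%N.
Proof.
elim: j => [|j /andP[h1 h2]]; first by rewrite Nsk (leq_ltn_trans _ Nsk).
by rewrite (leq_ltn_trans h1)// (ltn_trans h2).
Qed.

Let Ns_le i j : (i <= j)%N -> (Ns i <= Ns j)%N.
Proof.
elim: j => [|j IH]; first by rewrite leqn0 => /eqP ->.
rewrite leq_eqVlt => /predU1P[->//|]; rewrite ltnS => /IH h.
by rewrite (leq_trans h)// ltnW.
Qed.

Let b j := block k (Ns j) (Ns j.+1).

(* On a function of finitely many coordinates, and for [j] large, translating by
   [b j] multiplies by the weight [w j] below, which is 1 on [Z].  Off [Z] the
   weights are nearly orthogonal, so that the averages tend to multiplication by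
   the indicator function of [Z]. *)
Definition average J (f : X2 -> R[i]) : X2 -> R[i] := fun x =>
  (J.+1%:R^-1 : R)%:C * \sum_(i < J.+1) translate (b (J + i)) f x.

Let csum (I : Type) (s : seq I) (F : I -> X2 -> R[i]) : (forall i, cmeasurable (F i)) ->
  cmeasurable (fun x => \sum_(i <- s) F i x).
Proof.
move=> mF; elim: s => [|i s IH].
  rewrite (_ : (fun x => _) = cst 0); first exact: cmeasurable_cst.
  by apply/funext => x; rewrite big_nil.
rewrite (_ : (fun x => _) = (fun x => F i x + \sum_(j <- s) F j x)).
  exact: cmeasurableD.
by apply/funext => x; rewrite big_cons.
Qed.

Let cmeasurable_average J f : cmeasurable f -> cmeasurable (average J f).
Proof.
move=> mf; apply: cmeasurableM; first exact: cmeasurable_cst.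
by apply: csum => i; exact: cmeasurable_translate.
Qed.

Let norm2_average J f : cmeasurable f -> (norm2 m (average J f) <= norm2 m f)%E.
Proof.
move=> mf.
rewrite norm2_scale; last by apply: csum => i; exact: cmeasurable_translate.
rewrite sqr_normC.
have J0 : 0 < J.+1%:R :> R by rewrite ltr0n.
apply: (@le_trans _ _ (((J.+1%:R^-1 : R) ^+ 2)%:E * (J.+1%:R%:E *
    \sum_(i < J.+1) norm2 m (translate (b (J + i)) f)))%E).
  apply: lee_pmul => //; first exact: norm2_ge0.
  rewrite /norm2 -ge0_integral_sum//; last 2 first.
  - by move=> i; apply: measurable_sqr_norm; exact: cmeasurable_translate.
  - by move=> i x _; rewrite lee_fin sqr_norm_ge0.
  have mS : measurable_fun setT (fun x => \sum_(i < J.+1) (sqr_norm (translate (b (J + i)) f x))%:E)%E.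
    by apply: emeasurable_sum => i; apply: measurable_sqr_norm; exact: cmeasurable_translate.
  rewrite -ge0_integralZl_EFin//; last first.
    by move=> x _; apply: sume_ge0 => i _; rewrite lee_fin sqr_norm_ge0.
  apply: ge0_le_integral => //.
  - by move=> x _; rewrite lee_fin sqr_norm_ge0.
  - by apply: measurable_sqr_norm; apply: csum => i; exact: cmeasurable_translate.
  - exact: measurable_funeM.
  - move=> x _; rewrite sumEFin -EFinM lee_fin.
    by apply: le_trans (sqr_norm_sum_le _ _) _; rewrite /index_enum -enumT size_enum_ord.
under eq_bigr do rewrite norm2_translate//.
have sum_cst (y : \bar R) n : (0 <= y)%E -> (\sum_(i < n) y = n%:R%:E * y)%E.
  move=> y0; elim: n => [|n IH]; first by rewrite big_ord0 mul0e.
  by rewrite big_ord_recr/= IH -natr1 EFinD ge0_muleDl ?mul1e ?lee_fin.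
rewrite sum_cst ?norm2_ge0// !muleA -!EFinM.
rewrite expr2 mulfVK ?gt_eqF// mulVf ?gt_eqF// mul1e//.
Qed.

Let B J f x := average J f x + (-1) * restrict Z f x.

Let cmeasurable_B J f : cmeasurable f -> cmeasurable (B J f).
Proof.
move=> mf; apply: cmeasurableD; first exact: cmeasurable_average.
apply: cmeasurableM; first exact: cmeasurable_cst.
exact: cmeasurable_restrict.
Qed.

Let linear_B J z f g x : B J (fun x => z * f x + g x) x = z * B J f x + B J g x.
Proof.
rewrite /B /average /restrict /Submission.translate.
rewrite (eq_bigr (fun i : 'I_J.+1 => z * translate (b (J + i)) f x + translate (b (J + i)) g x)); last first.
  by move=> i _; rewrite /Submission.translate; ring.
by rewrite big_split/= -mulr_sumr; ring.
Qed.

Let norm2_B J f : cmeasurable f -> (norm2 m (B J f) <= 4%:E * norm2 m f)%E.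
Proof.
move=> mf; apply: le_trans (norm2D_le _ (cmeasurable_average J mf) _) _.
  by apply: cmeasurableM; [exact: cmeasurable_cst|exact: (cmeasurable_restrict mZ mf)].
rewrite (norm2_scale _ (-1) (cmeasurable_restrict mZ mf)).
rewrite (_ : sqr_norm (-1) = 1) ?mul1e; last first.
  by rewrite /sqr_norm/= oppr0 sqrrN expr1n expr0n addr0.
rewrite (_ : 4%:E = (2%:E + 2%:E)%E :> \bar R); last by rewrite -EFinD; congr EFin; ring.
rewrite ge0_muleDl ?lee_fin//; apply: leeD; apply: lee_pmul => //; try exact: norm2_ge0.
  exact: norm2_average.
apply: norm2_le => //; first exact: (cmeasurable_restrict mZ mf).
by move=> x; exact: sqr_norm_restrict.
Qed.

Let w j x : R := Num.sqrt (density (b j) x).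

Let w_ge0 j x : 0 <= w j x. Proof. exact: sqrtr_ge0. Qed.

Let mw j : measurable_fun setT (w j).
Proof.
apply: (measurable_level entry_generate (N := bound (b j))) => x y xy.
by congr Num.sqrt; exact: level_density.
Qed.

(** For [i = j] the product of the weights is a density, of integral 1. Otherwise the blocks are
    disjoint, and the block of index [J + i] gives the bound [1 / (J + i + 1)]. *)
Let correlation J (i j : 'I_J.+1) u : u != 0 ->
  (\int[m]_x (\1_[set y | entry k y = u] x * w (J + i) x * w (J + j) x)%:E <=
   ((i == j)%:R + J.+1%:R^-1)%:E)%E.
Proof.
move=> u0; have [<-|ij] := eqVneq i j.
  apply: (@le_trans _ _ (\int[m]_x (1%:E * (density (b (J + i)) x)%:E))%E).
    apply: ge0_le_integral => //.
    - by move=> x _; rewrite lee_fin !mulr_ge0.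
    - apply/measurable_EFinP; apply: measurable_funM; last exact: mw.
      apply: measurable_funM; last exact: mw.
      by apply: measurable_indic; exact: measurable_entry.
    - apply: measurable_funeM; apply/measurable_EFinP; exact: measurable_density.
    - move=> x _; rewrite mul1e lee_fin -mulrA /w -expr2 sqr_sqrtr ?density_ge0//.
      rewrite indicE; case: (_ \in _); rewrite ?mul1r// mul0r; exact: density_ge0.
  rewrite (ge0_integral_rmul alpha_gt0 (b (J + i)) (h := cst 1%E))//.
  rewrite integral_cst// mul1e [X in (X <= _)%E](_ : _ = 1%:E).
    by rewrite lee_fin lerDl invr_ge0.
  exact: probability_setT.
apply: le_trans (block_correlation alpha_gt0 u k2 _ _ _) _.
- by have /andP[] := Ns_ge (J + i).
- by have /andP[] := Ns_ge (J + j).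
- move: ij; rewrite -val_eqE/= neq_ltn => /orP[ij|ij]; apply/orP; [left|right];
    by apply: Ns_le; rewrite -addnS leq_add2l.
rewrite lee_fin add0r; apply: le_trans (NsP _ u0) _.
by rewrite lef_pV2 ?posrE ?ltr0n// ler_nat ltnS leq_addr.
Qed.

(** The average uses the blocks of indices [J] to [2 * J], all to the right of the first [M]
    columns: the translations fix the indicator function of the fiber and only multiply it by their
    weights. On [Z] all weights are 1 and the error vanishes; off [Z] the square of their sum is
    expanded. *)
Let B_fiber M a J x : (M <= J)%N ->
  sqr_norm (B J (restrict (fiber entry M a) (cst 1)) x) <=
  (J.+1%:R^-1) ^+ 2 * \sum_(u : 'F_2 * 'F_2 | u != 0%R) \sum_(i < J.+1) \sum_(j < J.+1)
     \1_[set y | entry k y = u] x * w (J + i) x * w (J + j) x.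
Proof.
move=> MJ; rewrite /B /average.
have J0 : 0 < J.+1%:R :> R by rewrite ltr0n.
have rhs0 : 0 <= \sum_(u : 'F_2 * 'F_2 | u != 0%R) \sum_(i < J.+1) \sum_(j < J.+1)
     \1_[set y | entry k y = u] x * w (J + i) x * w (J + j) x.
  by do 3![apply: sumr_ge0 => ? _]; rewrite !mulr_ge0.
have trE (i : 'I_J.+1) : translate (b (J + i)) (restrict (fiber entry M a) (cst 1)) x =
    (w (J + i) x)%:C * (\1_(fiber entry M a) x)%:C.
  rewrite /Submission.translate /restrict mulr1 -/(w _ _); congr (_ * _%:C).
  rewrite !indicE; congr ((nat_of_bool _)%:R); apply/idP/idP => /set_mem/fiberP h;
    apply/mem_set/fiberP => n nM; rewrite -h//.
    rewrite entry_block ?ifF//; last by have /andP[_ ->] := Ns_ge (J + i); rewrite (ltn_trans _ k2).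
    apply/negbTE; rewrite negb_and -ltnNge (leq_trans nM)// (leq_trans MJ)//.
    by have /andP[h1 _] := Ns_ge (J + i); rewrite (leq_trans _ (ltnW h1))// leq_addr.
  rewrite entry_block ?ifF//; last by have /andP[_ ->] := Ns_ge (J + i); rewrite (ltn_trans _ k2).
  apply/negbTE; rewrite negb_and -ltnNge (leq_trans nM)// (leq_trans MJ)//.
  by have /andP[h1 _] := Ns_ge (J + i); rewrite (leq_trans _ (ltnW h1))// leq_addr.
rewrite (eq_bigr _ (fun i _ => trE i)) -mulr_suml.
have [xu|xu] := eqVneq (entry k x) 0.
  have w1 (i : 'I_J.+1) : w (J + i) x = 1.
    have kN : (0 < k < Ns (J + i))%N.
      by have /andP[_ ->] := Ns_ge (J + i); rewrite (ltn_trans _ k2).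
    rewrite /w (sqrt_density_block alpha_gt0 x kN (leqnn _)) big1// => n _.
    case: ifP => // _; rewrite xu addr0 divff ?sqrtr1// gt_eqF//.
    exact: weight_gt0.
  rewrite (eq_bigr (fun=> 1)); last by move=> i _; rewrite w1.
  rewrite sumr_const card_ord /restrict !mulr1 mulrA.
  rewrite (_ : (\1_Z x : R) = 1) ?mulr1; last by rewrite indicE mem_set.
  rewrite (_ : (J.+1%:R^-1)%:C * J.+1%:R = 1 :> R[i]).
    rewrite (_ : _ + _ = 0); first by rewrite sqr_normC expr0n mulr_ge0// sqr_ge0.
    by rewrite rmorph1; ring.
  by rewrite -(rmorph_nat (real_complex R)) -rmorphM/= mulVf ?gt_eqF.
rewrite (_ : restrict Z _ x = 0); last first.
  by rewrite restrictE memNset// => /= h; rewrite h eqxx in xu.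
rewrite mulr0 addr0 -rmorph_sum/= -!rmorphM/= sqr_normC exprMn.
rewrite ler_wpM2l ?sqr_ge0// (bigD1 (entry k x))//= -[leLHS]addr0.
apply: lerD; last by do 3![apply: sumr_ge0 => ? _]; rewrite !mulr_ge0.
rewrite [leRHS](_ : _ = \sum_(i < J.+1) w (J + i) x * \sum_(j < J.+1) w (J + j) x); last first.
  apply: eq_bigr => i _; rewrite mulr_sumr; apply: eq_bigr => j _.
  by rewrite indicE mem_set// mul1r.
rewrite -mulr_suml -expr2 exprMn -[leRHS]mulr1 ler_wpM2l ?sqr_ge0//.
Qed.

Let K : R := (\sum_(u : 'F_2 * 'F_2 | u != 0%R) 1)%R.

(** For each of the [K] nonzero values of [u], the correlations add up to at most [2 * (J + 1)]:
    [J + 1] from the diagonal and [J + 1] from the [(J + 1) ^ 2] terms [1 / (J + 1)]. *)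
Let norm2_B_fiber M a J : (M <= J)%N ->
  (norm2 m (B J (restrict (fiber entry M a) (cst 1%R))) <= (2 * K * J.+1%:R^-1)%:E)%E.
Proof.
move=> MJ.
have J0 : 0 < J.+1%:R :> R by rewrite ltr0n.
pose s := [seq u <- index_enum ('F_2 * 'F_2)%type | u != 0].
pose F u (i j : 'I_J.+1) x : R := \1_[set y | entry k y = u] x * w (J + i) x * w (J + j) x.
have F0 u i j x : 0 <= F u i j x by rewrite !mulr_ge0.
have mF u i j : measurable_fun setT (fun x => (F u i j x)%:E).
  apply/measurable_EFinP; apply: measurable_funM; last exact: mw.
  apply: measurable_funM; last exact: mw.
  by apply: measurable_indic; exact: measurable_entry.
pose y : \bar R := (((J.+1%:R^-1 : R) ^+ 2)%:E * \int[m]_x (\sum_(u <- s)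
    \sum_(i < J.+1) \sum_(j < J.+1) (F u i j x)%:E))%E.

apply: (@le_trans _ _ y); rewrite /y.
  have mS : measurable_fun setT (fun x => \sum_(u <- s)
      \sum_(i < J.+1) \sum_(j < J.+1) (F u i j x)%:E)%E.
    by do 3![apply: emeasurable_sum => ?]; exact: mF.
  have S0 x : (0 <= \sum_(u <- s) \sum_(i < J.+1) \sum_(j < J.+1) (F u i j x)%:E)%E.
    by do 3![apply: sume_ge0 => ? _]; rewrite lee_fin.
  rewrite -ge0_integralZl_EFin ?sqr_ge0//.
  apply: ge0_le_integral => //.
  - by move=> x _; rewrite lee_fin sqr_norm_ge0.
  - apply: measurable_sqr_norm; apply: cmeasurable_B; apply: cmeasurable_restrict.
      exact: (fiber_measurable entry_generate).
    exact: cmeasurable_cst.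
  - exact: measurable_funeM.
  - move=> x _; under eq_bigr => u _ do under eq_bigr => i _ do rewrite sumEFin.
    under eq_bigr => u _ do rewrite sumEFin.
    by rewrite sumEFin -EFinM lee_fin /s big_filter; exact: B_fiber.
have mF1 u i : measurable_fun setT (fun x => \sum_(j < J.+1) (F u i j x)%:E)%E.
  by apply: emeasurable_sum => j; exact: mF.
have mF2 u : measurable_fun setT (fun x => \sum_(i < J.+1) \sum_(j < J.+1) (F u i j x)%:E)%E.
  by apply: emeasurable_sum => i; exact: mF1.
have F0E u i j x : (0 <= (F u i j x)%:E)%E by rewrite lee_fin.
have F1 u i x : (0 <= \sum_(j < J.+1) (F u i j x)%:E)%E.
  by apply: sume_ge0 => j _; rewrite lee_fin.
have F2 u x : (0 <= \sum_(i < J.+1) \sum_(j < J.+1) (F u i j x)%:E)%E.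
  by apply: sume_ge0 => i _; exact: F1.
rewrite (ge0_integral_sum _ measurableT mF2 (fun u x _ => F2 u x)).
apply: (@le_trans _ _ (((J.+1%:R^-1 : R) ^+ 2)%:E * \sum_(u <- s) (2 * J.+1%:R)%:E)%E).
  apply: lee_pmul => //.
    by apply: sume_ge0 => u _; apply: integral_ge0 => x _; exact: F2.
  rewrite /s !big_filter; apply: lee_sum => u u0.
  rewrite (ge0_integral_sum _ measurableT (mF1 u) (fun i x _ => F1 u i x)).
  apply: (@le_trans _ _ (\sum_(i < J.+1) 2%:E)%E); last first.
    by rewrite sumEFin lee_fin sumr_const card_ord mulr_natr.
  apply: lee_sum => i _.
  rewrite (ge0_integral_sum _ measurableT (mF u i) (fun j x _ => F0E u i j x)).
  apply: (@le_trans _ _ (\sum_(j < J.+1) ((i == j)%:R + J.+1%:R^-1)%:E)%E).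
    by apply: lee_sum => j _; exact: correlation.
  rewrite sumEFin lee_fin big_split/= sumr_const card_ord -[X in _ + X]mulr_natr mulVf ?gt_eqF//.
  rewrite (bigD1 i)//= eqxx big1 ?addr0// => j /negPf.
  by rewrite eq_sym => ->.
rewrite sumEFin -EFinM lee_fin /s big_filter -[X in \sum_(_ | _) X]mulr1 -mulr_sumr -/K.
by rewrite le_eqVlt; apply/orP; left; apply/eqP; field; rewrite gt_eqF.
Qed.

(** By linearity and the uniform bound 4, the functions whose error tends to 0 form a closed
    subspace, and it contains the indicator functions of all fibers. *)
Lemma average_cvg f : L2 m f ->
  norm2 m (fun x => average J f x - restrict Z f x) @[J --> \oo] --> 0%E.
Proof.
have four : 0 < 4 :> R by [].
have cG := closed_vanishing four cmeasurable_B linear_B norm2_B.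
have fibG M a : norm2 m (B J (restrict (fiber entry M a) (cst 1))) @[J --> \oo] --> 0%E.
  apply: (@squeeze_cvge _ _ _ _ (fun=> 0%E) _ (fun J : nat => (2 * K * J.+1%:R^-1)%:E)).
  - near=> J; rewrite /= norm2_ge0 norm2_B_fiber//.
    by near: J; exact: nbhs_infty_ge.
  - exact: cvg_cst.
  - apply: cvg_EFin; first exact: nearW.
    rewrite -(mulr0 (2 * K)); apply: cvgM; first exact: cvg_cst.
    exact: cvg_harmonic.
have G1 (C : set X2) : measurable C -> L2 m (restrict C (cst 1)).
  by move=> mC; apply: L2_restrict => //; exact: L2_1.
have mfib M a := @fiber_measurable _ _ _ entry entry_generate M a.
have GE := closed_total cG (fibers_generate entry_generate 0) (@fibersI _ _ _ entry 0).
move=> Lf; have : [set f | L2 m f /\ norm2 m (B J f) @[J --> \oo] --> 0%E] f.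
  rewrite GE//.
    have -> : cst 1 = restrict (fiber entry 0 point) (cst 1) :> (X2 -> R[i]).
      by rewrite -[LHS]restrictT; congr restrict; apply/seteqP; split=> // x _; apply/fiberP.
    by split; [exact: G1|exact: fibG].
  move=> C [->|[M [a [_ ->]]]]; last by split; [exact: G1|exact: fibG].
  have -> : restrict set0 (cst 1) = cst 0 :> (X2 -> R[i]).
    by apply/funext => x; rewrite restrictE memNset.
  exact: (closed_0 cG).
move=> [_]; rewrite /B; under eq_fun do under [X in norm2 _ X]eq_fun do rewrite mulN1r.
by [].
Unshelve. all: by end_near. Qed.

End averages.

Variable V : set (X2 -> R[i]).
Hypotheses (cV : closed_subspace m V) (TV : forall t f, V f -> V (T_rep m t f)).

Lemma closed_restrict_cell f : V f -> V (restrict Z f).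
Proof.
move=> Vf; have Lf := closed_L2 cV Vf.
have [Ns [Nsk NsS NsP]] := block_sequence k2.
apply: (closed_lim cV (u := fun J => average Ns J f)).
- move=> J; apply: (closed_scale cV); apply: (closed_sum cV) => i.
  exact: (closed_translate alpha_gt0 cV TV).
- exact: L2_restrict.
- exact: average_cvg.
Qed.

End cell_multiplication.

(** * Multiplication operators that preserve an invariant subspace *)

Definition straighten (x : X2) : X2 := if (entry 2 x).1 == 0 then x else L12 x.

Lemma entry_straighten n x : entry n (straighten x) =
  ((entry n x).1 + (entry 2 x).1 * (entry n x).2, (entry n x).2).
Proof.
rewrite /straighten; case: eqP => [->|/eqP x0].
  by rewrite mul0r addr0; case: (entry n x).
have -> : (entry 2 x).1 = 1.
  by have [h|//] := F2_cases (entry 2 x).1; rewrite h eqxx in x0.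
by rewrite entry_L12 mul1r.
Qed.

Lemma measurable_straighten : measurable_fun setT straighten.
Proof.
apply: measurable_entry_map => n; exists (maxn n.+1 3) => x y xy.
by rewrite !entry_straighten !xy// leq_max ?ltnSn// orbT.
Qed.

Section multiplication_closed.
Local Open Scope complex_scope.
Variables (R : realType) (mu : nat -> nat -> probability 'F_2 R).
Hypothesis alpha_gt0 : forall (k n : nat) (r : 'F_2),
  (1 <= k <= 2)%N -> (k < n)%N -> 0 < alpha mu k n r.
Local Notation m := (mu_alpha mu).
Local Notation density := (density mu).
Local Notation translate := (translate mu).
Local Notation c := (c_coef mu).
Hypothesis small_products : forall (N : nat) (e : R), (2 < N)%N -> 0 < e ->
  exists M, [/\ (N < M)%N, \prod_(N <= n < M) c 1 n <= e & \prod_(N <= n < M) c 2 n <= e].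
Hypothesis singular : mutually_singular (pushforward m L12) m.
Variable V : set (X2 -> R[i]).
Hypotheses (cV : closed_subspace m V) (TV : forall t f, V f -> V (T_rep m t f)).

Lemma restrictI A B (f : X2 -> R[i]) : restrict (A `&` B) f = restrict A (restrict B f).
Proof.
apply/funext => x; rewrite !restrictE in_setI.
by case: (x \in A) => //=; case: (x \in B).
Qed.

(** If [t] has constant entries [v.1] and [v.2] in its first two rows, column [n] of [x t] vanishes
    if and only if [x_2n = v.2] and [x_1n + x_12 * x_2n = v.1], that is, if column [n] of
    [straighten x] is [v]. For [n <= 2] that column does not depend on [x]. *)
Let closed_restrict_entry n v f : V f -> V (restrict [set x | entry n (straighten x) = v] f).
Proof.
move=> Vf; have [n2|n2] := leqP n 2.
  have cE x y : entry n (straighten x) = entry n (straighten y).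
    rewrite !entry_straighten; move: n2; rewrite leq_eqVlt => /predU1P[->|n2].
      by rewrite !entry2_2 !mulr1 !F2_addrr.
    rewrite /entry/= !(row_val_le _ (ltnW n2)) !(@row_val_le 1 _ n) ?[(n == 2)%N]ltn_eqF ?mulr0//.
  have [h|h] := pselect (exists x, entry n (straighten x) = v).
    rewrite (_ : [set x | _] = setT) ?restrictT//; apply/seteqP; split=> // x _.
    by case: h => y <-; exact: cE.
  rewrite (_ : restrict _ _ = cst 0); first exact: (closed_0 cV).
  by apply/funext => x; rewrite restrictE memNset// => /= xv; apply: h; exists x.
have := closed_restrict_translate alpha_gt0 cV TV (rows (fun=> v.1) (fun=> v.2) n.+1)
  (fun g => closed_restrict_cell alpha_gt0 small_products n2 cV TV (f := g)) Vf.
rewrite (_ : _ @^-1` _ = [set x | entry n (straighten x) = v])//.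
have eqF (a b : 'F_2) : a + b = 0 -> a = b.
  by move=> h; rewrite -[a]addr0 -(F2_addrr b) addrA h add0r.
apply/seteqP; split=> x /=; rewrite entry_rows ?n2 ?ltnSn// entry_straighten.
  move=> h; have h1 := congr1 fst h; have h2 := congr1 snd h.
  have e2 := eqF _ _ h2; rewrite [RHS]surjective_pairing -e2; congr pair.
  by apply: eqF; rewrite e2 addrAC; exact: h1.
move=> <- /=; apply/pair_equal_spec; split; last exact: F2_addrr.
by rewrite addrA F2_addrr add0r F2_addrr.
Qed.

Let closed_restrict_straight F f : measurable F -> V f -> V (restrict (straighten @^-1` F) f).
Proof.
move=> mF Vf; apply: (closed_restrict_pi_lambda cV (fibers_generate entry_generate 0)
  (@fibersI _ _ _ entry 0) measurable_straighten Vf _ mF).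
move=> C [->|[M [a [_ ->]]]].
  rewrite preimage_set0 (_ : restrict _ _ = cst 0); first exact: (closed_0 cV).
  by apply/funext => x; rewrite restrictE memNset.
(* The induction is over all [f] in [V], because splitting off the last column replaces [f] by its
   restriction. *)
elim: M f Vf {F mF C} => [|M IH] f Vf.
  rewrite (_ : _ @^-1` _ = setT) ?restrictT//; apply/seteqP; split=> // x _.
  exact/fiberP.
rewrite (_ : _ @^-1` _ = straighten @^-1` fiber entry M a `&`
    [set x | entry M (straighten x) = entry M a]).
  by rewrite restrictI; apply: IH; exact: closed_restrict_entry.
apply/seteqP; split=> x /=.
  by move=> /fiberP xa; split; [apply/fiberP => n nM; apply: xa; exact: ltnW|exact: xa].
move=> [/fiberP xa xM]; apply/fiberP => n; rewrite ltnS leq_eqVlt => /predU1P[->//|].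
exact: xa.
Qed.

(* [L12] maps a set [A'] of full measure to a null set, so that [A' `&` E] and
   its image make up an [L12]-invariant set, which differs from [E] by a null
   set. *)
Lemma closed_restrict_all E f : measurable E -> V f -> V (restrict E f).
Proof.
move=> mE Vf; case: singular => A [mA LA0 A0].
have mL B : measurable B -> measurable (L12 @^-1` B).
  by move=> mB; rewrite -[X in measurable X]setTI; exact: measurable_L12.
pose A' := A `\` L12 @^-1` A.
have mA' : measurable A' by apply: measurableD => //; exact: mL.
pose E' := (A' `&` E) `|` L12 @^-1` (A' `&` E).
have mE' : measurable E' by apply: measurableU; [|apply: mL]; exact: measurableI.
have sE' : straighten @^-1` E' = E'.
  have LE' x : E' (L12 x) = E' x.
    apply/propext; rewrite /E' /setU /preimage /mkset L12K.
    by split=> -[]; [right|left|right|left].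
  by apply/seteqP; split=> x; rewrite /preimage /mkset /straighten; case: ifP => _ //; rewrite LE'.
have := closed_restrict_straight mE' Vf; rewrite sE' => VE'.
apply: (closed_ae cV VE'); first exact/L2_restrict/(closed_L2 cV).
exists (~` A'); split; first exact: measurableC.
  rewrite /A' setCD; apply/eqP; rewrite -measure_le0.
  apply: le_trans (measureU2 m (measurableC mA) (mL _ mA)) _.
  by rewrite -[leRHS]adde0; apply: leeD; [rewrite -A0|rewrite -LA0].
move=> x /= h A'x; apply: h; rewrite !restrictE.
suff -> : (x \in E') = (x \in E) by [].
have [Ax nLA] := A'x.
apply/idP/idP => /set_mem Ex; apply/mem_set; last by left.
by case: Ex => [[]//|[[LAx _] _]].
Qed.

End multiplication_closed.

(** [measure_prefix] for the measure whose density is the indicator function of [D]. *)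
Lemma measure_prefixI d (T : measurableType d) (R : realType) (J : finType)
    (z : nat -> T -> J) (m : {measure set T -> \bar R}) :
  @measurable _ T = <<s cylinder z >> ->
  forall D, measurable D -> forall N (S : pred {ffun 'I_N -> J}),
  m ([set x | S (prefix z N x)] `&` D) =
  (\sum_(i | S i) m ([set x | prefix z N x = i] `&` D))%E.
Proof.
move=> mE D mD N S.
have D0 x : 0 <= \1_D x :> R by rewrite indicE.
have mI : measurable_fun setT (\1_D : T -> R) by exact: measurable_indic.
have [nu nuE] := density_measureP m D0 mI.
have nuI X : measurable X -> nu X = m (X `&` D).
  by move=> mX; rewrite nuE /density_measure integral_indic// setIC.
have mS (S' : pred {ffun 'I_N -> J}) : measurable [set x | S' (prefix z N x)].
  apply: (measurable_cylinder mE); exists N => x y xy.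
  rewrite /mkset; congr (is_true (S' _)).
  by apply/ffunP => n; rewrite !ffunE xy.
rewrite -nuI// (measure_prefix mE); apply: eq_bigr => i _.
by rewrite nuI//; exact: (measurable_fiber mE).
Qed.

(** * Ergodicity and irreducibility *)

Section density_points.
Context d (T : measurableType d) (R : realType) (J : finType).
Variables (z : nat -> T -> J) (m : {measure set T -> \bar R}).
Hypothesis measurableE : @measurable _ T = <<s cylinder z >>.
Hypothesis mT : (m setT < +oo)%E.

(** A substitute for Lebesgue's density theorem. If [A] missed more than the proportion [e] of every
    fiber of depth at least [N0], a cylinder [B] within [e * m A / 2] of [A] would satisfy
    [e * m B < e * m A / 2], hence [m B < m A / 2], against [m A <= m B + e * m A / 2]. *)
Lemma density_fiber N0 A (e : R) : measurable A -> (0 < m A)%E -> 0 < e -> e <= 1 ->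
  exists M a, (N0 <= M)%N /\ (m (fiber z M a `\` A) <= e%:E * m (fiber z M a))%E.
Proof.
move=> mA A0 e0 e1; apply: contrapT => abs.
have Afin : m A \is a fin_num.
  by rewrite ge0_fin_numE//; apply: le_lt_trans mT; apply: le_measure; rewrite ?inE.
pose p := fine (m A).
have pE : m A = p%:E by rewrite fineK.
have p0 : 0 < p by rewrite -lte_fin -pE.
have ep0 : 0 < e * p / 2 by rewrite divr_gt0// mulr_gt0.
have [B [N BN] Bp] := cylinder_approx measurableE mT mA ep0.
have {}BN := level_le (leq_maxl N N0) BN; set M := maxn N N0 in BN.
have mB : measurable B by apply: (measurable_cylinder measurableE); exists M.
have mY : measurable (B `+` A) by apply: measurableU; exact: measurableD.
pose S : pred {ffun 'I_M -> J} := fun i => `[< exists2 x, B x & prefix z M x = i >].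
have SB : B = [set x | S (prefix z M x)].
  apply/seteqP; split=> x /=; first by move=> Bx; apply/asboolP; exists x.
  by move=> /asboolP[y By] yx; rewrite (level_prefix BN (esym yx)).
have le1 : (e%:E * m B <= m (B `\` A))%E.
  rewrite {1}SB (measure_prefix measurableE m S) ge0_sume_distrr//.
  have mAC := measurableC mA.
  rewrite setDE SB (measure_prefixI m measurableE mAC).
  apply: lee_sum => i /asboolP[x _ xi].
  rewrite -xi leNgt; apply/negP => h; apply: abs; exists M, x.
  by rewrite leq_maxr; split=> //; rewrite setDE; exact: ltW.
have le2 : (m (B `\` A) < (e * p / 2)%:E)%E.
  apply: le_lt_trans Bp; apply: le_measure; rewrite ?inE//; first exact: measurableD.
  by move=> x Bx; left.
have le3 : (m A <= m B + (e * p / 2)%:E)%E.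
  apply: (@le_trans _ _ (m B + m (B `+` A))%E); last by rewrite leeD2l// ltW.
  apply: le_trans (measureU2 m mB mY); apply: le_measure; rewrite ?inE//.
    exact: measurableU.
  by move=> x Ax; have [?|?] := pselect (B x); [left|right; right].
have Bfin : m B \is a fin_num.
  by rewrite ge0_fin_numE//; apply: le_lt_trans mT; apply: le_measure; rewrite ?inE.
have {le1 le2}le4 := le_lt_trans le1 le2.
rewrite pE -(fineK Bfin) -EFinD lee_fin in le3.
rewrite -(fineK Bfin) -EFinM lte_fin in le4.
move: le3 le4; set q := fine (m B) => le3 le4.
have : e * (p - e * p / 2) <= e * q by rewrite ler_pM2l//; lra.
have : e * p <= p by rewrite ger_pMl.
move=> h1 h2; have : e * (e * p) <= e * p by rewrite ler_pM2l.
by nra.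
Qed.

End density_points.

Section ergodicity.
Variables (R : realType) (mu : nat -> nat -> probability 'F_2 R).
Hypothesis alpha_gt0 : forall (k n : nat) (r : 'F_2),
  (1 <= k <= 2)%N -> (k < n)%N -> 0 < alpha mu k n r.
Local Notation m := (mu_alpha mu).
Local Notation density := (density mu).

(** The rows [r1] and [r2] solve the equations of [entry_rows] and [entry_rows2]. The bound is at
    least 3 so that the entry (1, 2) of the element can be prescribed. *)
Lemma fiber_transitive M a b : exists2 t, bounded_by (maxn M 3) t &
  fiber entry M a (rmul b t).
Proof.
pose r2 n := (entry n b).2 + (entry n a).2.
pose r1 n := if n == 2%N then (entry 2 b).1 + (entry 2 a).1 else
  (entry n b).1 + (entry n a).1 + (entry 2 b).1 * r2 n.
exists (rows r1 r2 (maxn M 3)); first exact: elt_bounded.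
apply/fiberP => n nM.
have [n1|n1] := leqP n 1; first by rewrite /entry !row_val_le// (leq_trans n1).
have [n2|n2] := leqP n 2.
  have -> : n = 2%N by apply/eqP; rewrite eqn_leq n2.
  rewrite entry_rows2 ?leq_maxr// /r1 eqxx addrA F2_addrr add0r.
  by rewrite [RHS]surjective_pairing entry2_2.
rewrite entry_rows; last by rewrite n2 leq_max nM.
rewrite /r1 gtn_eqF// /r2 !addrA F2_addrr add0r.
rewrite [RHS]surjective_pairing; apply/pair_equal_spec; split; last by rewrite F2_addrr add0r.
by rewrite -addrA F2_addrr addr0.
Qed.

(** On the fiber of [b], which [t] carries onto that of [a], the density is the constant
    [mass mu M a / mass mu M b]. *)
Lemma measure_fiber_translate M a b t X : bounded_by M t -> fiber entry M a (rmul b t) ->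
  measurable X -> X `<=` fiber entry M a ->
  m ((fun x => rmul x t) @^-1` X) = ((mass mu M b / mass mu M a)%:E * m X)%E.
Proof.
move=> tM bta mX Xa.
have mY : measurable ((fun x => rmul x t) @^-1` X).
  by rewrite -[Y in measurable Y]setTI; exact: measurable_rmul.
have := ge0_integral_rmul alpha_gt0 t (h := fun x => (\1_X x)%:E).
rewrite integral_indic// setIT => <-; last 2 first.
- exact/measurable_EFinP/measurable_indic.
- by move=> x; rewrite lee_fin.
rewrite -[X in m X]setIT -integral_indic// -ge0_integralZl_EFin//; last 3 first.
- move=> x _; rewrite mule_ge0 ?lee_fin ?density_ge0//.
- apply: emeasurable_funM; last by apply/measurable_EFinP; exact: measurable_density.
  apply/measurable_EFinP; apply: measurable_indic; exact: mY.
- by rewrite divr_ge0// ltW// mass_gt0.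
apply: eq_integral => x _.
rewrite -!EFinM; congr EFin.
have -> : \1_((fun x => rmul x t) @^-1` X) x = \1_X (rmul x t) :> R by [].
rewrite indicE; case: (boolP (_ \in X)) => [/set_mem Xx|]; last by rewrite mul0r mulr0.
rewrite mul1r (densityE alpha_gt0 x tM).
have -> : mass mu M (rmul x t) = mass mu M a.
  by apply: level_mass => n nM; have /fiberP := Xa _ Xx; exact.
have -> : mass mu M x = mass mu M b.
  rewrite -(rmulK t x) -[b](rmulK t b); apply: (level_comp_rmul _ (@level_mass _ mu M)) => n nM.
  by have /fiberP -> // := Xa _ Xx; have /fiberP -> := bta.
by rewrite /=; field; rewrite !gt_eqF ?mass_gt0.
Qed.

(** Ergodicity in quantitative form. [A] fills some fiber up to the proportion [e]. Each of the
    finitely many fibers of the same depth is carried onto that one by a group element, with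
    constant density, so the corresponding translate of [A] fills it up to the same proportion. *)
Lemma translates_cover A (e : R) : measurable A -> (0 < m A)%E -> 0 < e -> e <= 1 ->
  exists ts : seq B0, (m (~` \big[setU/set0]_(t <- ts) ((fun x => rmul x t) @^-1` A)) <= e%:E)%E.
Proof.
move=> mA A0 e0 e1.
have mT : (m setT < +oo)%E.
  by apply: le_lt_trans (ltry 1); exact: probability_le1.
have [M [a [M3 Ma]]] := density_fiber entry_generate mT 3 mA A0 e0 e1.
(* One element serves all points with the same prefix; a prefix without points gets the identity. *)
have /choice[t tP] (i : {ffun 'I_M -> 'F_2 * 'F_2}) : exists t, bounded_by M t /\
    forall b, prefix entry M b = i -> fiber entry M a (rmul b t).
  have [[b bi]|nb] := pselect (exists b, prefix entry M b = i).
    have [t tM tb] := fiber_transitive M a b.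
    exists t; split; first by move: tM; rewrite (maxn_idPl M3).
    move=> b' b'i; rewrite /fiber /mkset -tb.
    have fM : level entry M (fun y => prefix entry M (rmul y t)).
      apply: level_comp_rmul => x y xy; apply/ffunP => n; rewrite !ffunE; exact: xy.
    by apply: (level_prefix fM); rewrite b'i bi.
  by exists 1%g; split=> [k n kn _|b bi]; [rewrite /= /infmx1 ltn_eqF|case: nb; exists b].
exists [seq t i | i <- index_enum {ffun 'I_M -> 'F_2 * 'F_2}].
set E := \big[setU/set0]_(_ <- _) _.
have mrA s : measurable ((fun x => rmul x s) @^-1` A).
  by rewrite -[Y in measurable Y]setTI; exact: measurable_rmul.
have mE : measurable E.
  by apply: bigsetU_measurable => s _; exact: mrA.
have EE x : E x <-> exists i, A (rmul x (t i)).
  rewrite /E big_map; split.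
    elim: (index_enum _) => [|i l IH]; first by rewrite big_nil.
    by rewrite big_cons => -[Ax|/IH//]; exists i.
  move=> [i Ax]; have : i \in index_enum {ffun 'I_M -> 'F_2 * 'F_2} by exact: mem_index_enum.
  elim: (index_enum _) => [//|j l IH]; rewrite in_cons big_cons => /predU1P[<-|/IH]; [by left|by right].
have mEC := measurableC mE.
have -> : m (~` E) = (\sum_i m ([set x | prefix entry M x = i] `&` ~` E))%E.
  rewrite -(@measure_prefixI _ _ _ _ _ m entry_generate _ mEC M predT).
  by congr (m _); apply/seteqP; split=> x // [].
apply: (@le_trans _ _ (\sum_(i : {ffun 'I_M -> 'F_2 * 'F_2}) e%:E * m [set x | prefix entry M x = i])%E).
  apply: lee_sum => i _.
  have [[b bi]|nb] := pselect (exists b, prefix entry M b = i); last first.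
    rewrite (_ : [set x | _] = set0); last first.
      by apply/seteqP; split=> // x xi; apply: nb; exists x.
    by rewrite set0I measure0 mule0.
  have [tM tb] := tP i; have tab := tb b bi.
  pose X := fiber entry M a `\` A.
  have mfib b' : measurable (fiber entry M b') by exact: (fiber_measurable entry_generate).
  have mX : measurable X by exact: measurableD.
  apply: (@le_trans _ _ (m ((fun x => rmul x (t i)) @^-1` X))).
    apply: le_measure; rewrite ?inE.
    - apply: measurableI => //; rewrite -bi; exact: mfib.
    - by rewrite -[Y in measurable Y]setTI; exact: measurable_rmul.
    - move=> x [xi nE]; split; first exact: tb.
      by move=> Ax; apply: nE; apply/EE; exists i.
  rewrite (measure_fiber_translate tM tab mX); last by move=> x [].
  rewrite -bi -/(fiber entry M b) mass_fiber.
  apply: (@le_trans _ _ ((mass mu M b / mass mu M a)%:E * (e%:E * m (fiber entry M a)))%E).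
    by apply: lee_pmul => //; rewrite lee_fin divr_ge0// ltW// mass_gt0.
  rewrite [m (fiber entry M a)]mass_fiber -!EFinM lee_fin le_eqVlt; apply/orP; left; apply/eqP.
  by field; rewrite gt_eqF// mass_gt0.
rewrite -ge0_sume_distrr//.
rewrite -(measure_prefix entry_generate m predT).
rewrite -[leRHS]mule1; apply: lee_pmul => //; first by rewrite lee_fin ltW.
apply: probability_le1; rewrite (_ : [set x | _] = setT)//; exact/seteqP.
Qed.

End ergodicity.

Section irreducibility.
Local Open Scope complex_scope.
Variables (R : realType) (mu : nat -> nat -> probability 'F_2 R).
Hypothesis alpha_gt0 : forall (k n : nat) (r : 'F_2),
  (1 <= k <= 2)%N -> (k < n)%N -> 0 < alpha mu k n r.
Local Notation m := (mu_alpha mu).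
Local Notation c := (c_coef mu).
Local Notation Re := complex.Re.
Local Notation Im := complex.Im.

Section full_sets.
Variable V : set (X2 -> R[i]).
Hypotheses (cV : closed_subspace m V) (TV : forall t f, V f -> V (T_rep m t f)).

Definition full (E : set X2) := measurable E /\ forall g, L2 m g -> V (restrict E g).

Lemma full_set0 : full set0.
Proof.
split=> // g _; rewrite (_ : restrict _ _ = cst 0); first exact: (closed_0 cV).
by apply/funext => x; rewrite restrictE memNset.
Qed.

Lemma fullU E F : full E -> full F -> full (E `|` F).
Proof.
move=> [mE VE] [mF VF]; split=> [|g Lg]; first exact: measurableU.
have VF' := VF _ (L2_restrict (measurableC mE) Lg).
have -> : restrict (E `|` F) g = (fun x => restrict E g x + restrict F (restrict (~` E) g) x).
  apply/funext => x; rewrite !restrictE in_setU in_setC.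
  by case: (x \in E); case: (x \in F); rewrite ?addr0 ?add0r.
exact: (closed_add cV (VE _ Lg) VF').
Qed.

Lemma full_bigU (I : Type) (s : seq I) (F : I -> set X2) :
  (forall i, full (F i)) -> full (\big[setU/set0]_(i <- s) F i).
Proof.
move=> fF; elim: s => [|i s IH]; first by rewrite big_nil; exact: full_set0.
by rewrite big_cons; exact: fullU.
Qed.

Lemma full_bigcup (F : (set X2)^nat) : (forall n, full (F n)) -> full (\bigcup_n F n).
Proof.
move=> fF; have mF n : measurable (F n) by have [] := fF n.
split=> [|g Lg]; first exact: bigcupT_measurable.
pose G n := \big[setU/set0]_(k < n.+1) F k.
have -> : \bigcup_n F n = \bigcup_n G n.
  apply/seteqP; split=> x [n _].
    by move=> Fx; exists n => //; rewrite /G big_ord_recr; right.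
  by rewrite /G -bigcup_mkord => -[k _ Fx]; exists k.
have fG n : full (G n) by apply: full_bigU.
apply: (closed_restrict_bigcup cV) => //.
- by move=> n; have [] := fG n.
- by move=> i j ij; apply/subsetPset; exact: subset_bigsetU.
- by move=> n; have [_] := fG n; exact.
Qed.

Lemma full_translate t E : full E -> full ((fun x => rmul x t) @^-1` E).
Proof.
move=> [mE VE]; split=> [|g Lg].
  by rewrite -[Y in measurable Y]setTI; exact: measurable_rmul.
rewrite -(translate_restrict alpha_gt0); apply: (closed_translate alpha_gt0 cV TV).
by apply: VE; exact: L2_translate.
Qed.

Lemma full_almost E : full E -> m (~` E) = 0%E -> V = L2 m.
Proof.
move=> [mE VE] E0; apply/seteqP; split; first by case: cV.
move=> g Lg; apply: (closed_ae cV (VE g Lg)) => //.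
exists (~` E); split=> //; first exact: measurableC.
by move=> x /= h Ex; apply: h; rewrite restrictE mem_set.
Qed.

Definition csupport (f : X2 -> R[i]) := [set x | f x != 0].

Lemma csupportE f : csupport f = (fun x => sqr_norm (f x)) @^-1` (~` [set 0]).
Proof.
by apply/seteqP; split=> x; rewrite /csupport /preimage /mkset -sqr_norm_eq0 => /eqP.
Qed.

Lemma measurable_csupport f : cmeasurable f -> measurable (csupport f).
Proof.
move=> mf; rewrite csupportE -[Y in measurable Y]setTI.
by apply: (cmeasurable_sqr_norm mf) => //; exact: measurableC.
Qed.

(** The product of [f] with [g] times the conjugate of [f] divided by the squared modulus of [f] is
    [g] on the support of [f]. *)
Lemma full_csupport f : V f -> (forall E, measurable E -> V (restrict E f)) ->
  full (csupport f).
Proof.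
move=> Vf VE; have /L2P[mf _] := closed_L2 cV Vf.
split=> [|g Lg]; first exact: measurable_csupport.
have /L2P[mg _] := Lg.
pose cf x : R[i] := (Re (f x))%:C - 'i * (Im (f x))%:C.
have mcf : cmeasurable cf.
  have [mr mi] := mf; apply: cmeasurableB; first exact: cmeasurableC.
  by apply: cmeasurableM; [exact: cmeasurable_cst|exact: cmeasurableC].
(* The power -1, a measurable function, is the inverse off 0; where [f] vanishes, so does
   [a x * f x]. *)
pose a x : R[i] := g x * cf x * ((sqr_norm (f x)) `^ (-1))%:C.
have ma : cmeasurable a.
  apply: cmeasurableM; first exact: cmeasurableM.
  apply: cmeasurableC.
  exact: (measurableT_comp (@measurable_powR R (-1)) (cmeasurable_sqr_norm mf)).
have aE : (fun x => a x * f x) = restrict (csupport f) g.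
  apply/funext => x; rewrite restrictE /a powR_inv1 ?sqr_norm_ge0//.
  have cff : cf x * f x = (sqr_norm (f x))%:C.
    apply/eqP; rewrite eq_complex /cf /sqr_norm; apply/andP; split; apply/eqP.
      by rewrite ReM ReB ImB ReM ImM/=; ring.
    by rewrite ImM ReB ImB ReM ImM/=; ring.
  case: ifPn => [/set_mem fx|]; last first.
    by rewrite notin_setE => /negP; rewrite negbK => /eqP ->; rewrite mulr0.
  rewrite -mulrA [_%:C * _]mulrC mulrA -[g x * _ * _]mulrA cff -mulrA -rmorphM/=.
  by rewrite divff ?mulr1// sqr_norm_eq0.
have := closed_mul cV Vf VE ma; rewrite aE; apply.
by apply: L2_restrict => //; exact: measurable_csupport.
Qed.

End full_sets.

Hypothesis small_products : forall (N : nat) (e : R), (2 < N)%N -> 0 < e ->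
  exists M, [/\ (N < M)%N, \prod_(N <= n < M) c 1 n <= e & \prod_(N <= n < M) c 2 n <= e].

(** The support of a nonzero [f] in [V] is full. Full sets are stable under translations and
    countable unions, and by ergodicity translates of the support cover almost the whole space. *)
Lemma singular_irreducible : mutually_singular (pushforward m L12) m ->
  irreducible m (T_rep m).
Proof.
move=> sing V cV TV.
have [h|/existsNP[f /not_implyP[Vf f0]]] :=
  pselect (forall f, V f -> {ae m, forall x, f x = 0}); [by left|right].
have VE E : measurable E -> V (restrict E f).
  by move=> mE; exact: (closed_restrict_all alpha_gt0 small_products sing cV TV mE Vf).
have fA := full_csupport cV Vf VE; have [mA _] := fA.
have A0 : (0 < m (csupport f))%E.
  rewrite lt_neqAle measure_ge0 andbT; apply/eqP => A0; apply: f0.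
  exists (csupport f); split=> // x /= fx.
  by apply/negP => /eqP.
have /choice[ts tsP] (j : nat) : exists ts : seq B0,
    (m (~` \big[setU/set0]_(t <- ts) ((fun x => rmul x t) @^-1` csupport f)) <= (j.+1%:R^-1 : R)%:E)%E.
  apply: translates_cover => //.
  by rewrite invf_le1 ?ler1n.
pose E j := \big[setU/set0]_(t <- ts j) ((fun x => rmul x t) @^-1` csupport f).
have fE j : full V (E j).
  by apply: (full_bigU cV) => t; exact: (full_translate cV TV).
have fU := full_bigcup cV fE; have [mU _] := fU.
apply: (full_almost cV fU); apply/eqP; rewrite -measure_le0.
apply/lee_addgt0Pr => e e0; rewrite add0e.
have [j je] : exists j : nat, j.+1%:R^-1 <= e.
  by have [j _ /(_ j (leqnn j))/ltW] := near_infty_natSinv_lt (PosNum e0); exists j.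
apply: (@le_trans _ _ (m (~` E j))); last by apply: le_trans (tsP j) _; rewrite lee_fin.
have [mEj _] := fE j.
apply: le_measure; rewrite ?inE; [exact: measurableC|exact: measurableC|].
by apply: subsetC => x Ex; exists j.
Qed.

End irreducibility.

(** * Reducibility *)

Section orthogonality.
Local Open Scope complex_scope.
Variables (R : realType) (mu : nat -> nat -> probability 'F_2 R).
Hypothesis alpha_gt0 : forall (k n : nat) (r : 'F_2),
  (1 <= k <= 2)%N -> (k < n)%N -> 0 < alpha mu k n r.
Local Notation m := (mu_alpha mu).
Local Notation density := (density mu).
Local Notation translate := (translate mu).
Local Notation Re := complex.Re.
Local Notation Im := complex.Im.
Implicit Types (a b w : X2 -> R).

Definition rtranslate t a : X2 -> R := fun x => Num.sqrt (density t x) * a (rmul x t).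

Definition square_integrable a := measurable_fun setT a /\
  (\int[m]_x (a x ^+ 2)%:E < +oo)%E.

Lemma rtranslateM s t a : rtranslate s (rtranslate t a) = rtranslate (s * t)%g a.
Proof.
apply/funext => x; rewrite /rtranslate mulrA -sqrtrM ?density_ge0//.
by rewrite densityM// rmulA [density s x * _]mulrC.
Qed.

Lemma rtranslate1 a : rtranslate 1%g a = a.
Proof. by apply/funext => x; rewrite /rtranslate density1// sqrtr1 mul1r rmul1. Qed.

Lemma Re_translate t f x : Re (translate t f x) = rtranslate t (fun x => Re (f x)) x.
Proof. by rewrite /Submission.translate ReM/= mul0r subr0. Qed.

Lemma Im_translate t f x : Im (translate t f x) = rtranslate t (fun x => Im (f x)) x.
Proof. by rewrite /Submission.translate ImM/= mul0r addr0. Qed.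

Lemma square_integrableC a : square_integrable a <-> L2 m (fun x => (a x)%:C).
Proof.
split=> [[ma fa]|/L2P[[ma _] fa]].
  apply/L2P; split; first exact: cmeasurableC.
  by move: fa; rewrite /norm2; under [in X in _ -> X]eq_integral do rewrite sqr_normC.
by split=> //; move: fa; rewrite /norm2; under eq_integral do rewrite sqr_normC.
Qed.

Lemma square_integrable_Re f : L2 m f -> square_integrable (fun x => Re (f x)).
Proof.
move=> Lf; have /L2P[[mr mi] _] := Lf; apply/square_integrableC.
apply: (L2_le _ Lf); first exact: cmeasurableC.
by move=> x; rewrite sqr_normC /sqr_norm lerDl sqr_ge0.
Qed.

Lemma square_integrable_Im f : L2 m f -> square_integrable (fun x => Im (f x)).
Proof.
move=> Lf; have /L2P[[mr mi] _] := Lf; apply/square_integrableC.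
apply: (L2_le _ Lf); first exact: cmeasurableC.
by move=> x; rewrite sqr_normC /sqr_norm lerDr sqr_ge0.
Qed.

Lemma square_integrable_rtranslate t a :
  square_integrable a -> square_integrable (rtranslate t a).
Proof.
move=> /square_integrableC La; apply/square_integrableC.
have := L2_translate alpha_gt0 t La; congr (L2 m); apply/funext => x.
by rewrite /Submission.translate /rtranslate rmorphM.
Qed.

Let young (k x y : R) : 0 < k -> `|x * y| <= k * x ^+ 2 + k^-1 * y ^+ 2.
Proof.
move=> k0; have ki : 0 < k^-1 by rewrite invr_gt0.
have h : 0 <= k^-1 * (k * `|x| - `|y|) ^+ 2 by rewrite mulr_ge0 ?sqr_ge0// ltW.
have e : k^-1 * (k * `|x| - `|y|) ^+ 2 = k * x ^+ 2 + k^-1 * y ^+ 2 - 2 * (`|x| * `|y|).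
  by rewrite -[x ^+ 2]real_normK ?num_real// -[y ^+ 2]real_normK ?num_real//; field; rewrite gt_eqF.
have xy : 0 <= `|x| * `|y| by rewrite mulr_ge0.
by rewrite normrM; lra.
Qed.

Let measurable_mul a b : measurable_fun setT a -> measurable_fun setT b ->
  measurable_fun setT (fun x => (a x * b x)%:E).
Proof. by move=> ma mb; apply/measurable_EFinP; exact: measurable_funM. Qed.

Let measurable_sqr a : measurable_fun setT a -> measurable_fun setT (fun x => (a x ^+ 2)%:E).
Proof. by move=> ma; apply/measurable_EFinP; exact: measurable_funX. Qed.

(** Young's inequality with a free weight [k]; [inner_lim] uses it in place of the Cauchy-Schwarz
    inequality. *)
Lemma integral_mul_le (k : R) a b : 0 < k -> measurable_fun setT a -> measurable_fun setT b ->
  (\int[m]_x `|(a x * b x)%:E| <=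
   k%:E * \int[m]_x (a x ^+ 2)%:E + (k^-1)%:E * \int[m]_x (b x ^+ 2)%:E)%E.
Proof.
move=> k0 ma mb; have ki : 0 < k^-1 by rewrite invr_gt0.
have msq (u : X2 -> R) (p : R) : measurable_fun setT u -> measurable_fun setT (fun x => p%:E * (u x ^+ 2)%:E)%E.
  by move=> mu_; apply: measurable_funeM; exact: measurable_sqr.
have sq0 (u : X2 -> R) (p : R) (x : X2) : 0 < p -> (0 <= p%:E * (u x ^+ 2)%:E)%E.
  by move=> p0; rewrite -EFinM lee_fin mulr_ge0 ?sqr_ge0// ltW.
have Z (u : X2 -> R) (p : R) : 0 < p -> measurable_fun setT u ->
    (p%:E * \int[m]_x (u x ^+ 2)%:E = \int[m]_x (p%:E * (u x ^+ 2)%:E))%E.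
  move=> p0 mu_; rewrite ge0_integralZl_EFin//; first by move=> x _; rewrite lee_fin sqr_ge0.
    exact: measurable_sqr.
  exact: ltW.
rewrite !Z// -(ge0_integralD m measurableT (fun x _ => sq0 a k x k0) (msq a k ma)
  (fun x _ => sq0 b k^-1 x ki) (msq b k^-1 mb)).
apply: (ge0_le_integral m measurableT) => //.
- by apply: measurableT_comp => //; exact: measurable_mul.
- by apply: emeasurable_funD; exact: msq.
- by move=> x _; rewrite -!EFinM -EFinD lee_fin; exact: young.
Qed.

Lemma integrable_mul a b : square_integrable a -> square_integrable b ->
  m.-integrable setT (fun x => (a x * b x)%:E).
Proof.
move=> [ma fa] [mb fb]; apply/integrableP; split; first exact: measurable_mul.
apply: le_lt_trans (integral_mul_le (ltr01 : 0 < 1 :> R) ma mb) _.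
by rewrite invr1 !mul1e lte_add_pinfty.
Qed.

Definition inner a b := (\int[m]_x (a x * b x)%:E)%E.

Lemma inner_rtranslate t a b : square_integrable a -> square_integrable b ->
  inner (rtranslate t a) (rtranslate t b) = inner a b.
Proof.
move=> sa sb; rewrite /inner -(integral_rmul alpha_gt0 t (integrable_mul sa sb)).
apply: eq_integral => x _; rewrite -EFinM; congr EFin.
rewrite /rtranslate mulrACA -expr2 sqr_sqrtr ?density_ge0//; ring.
Qed.

Lemma inner_lin (p : R) a b w : square_integrable a -> square_integrable b ->
  square_integrable w -> inner (fun x => p * a x + b x) w = (p%:E * inner a w + inner b w)%E.
Proof.
move=> sa sb sw; have ia := integrable_mul sa sw; have ib := integrable_mul sb sw.
have ipa : m.-integrable setT (fun x => p%:E * (a x * w x)%:E)%E by exact: integrableZl.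
rewrite /inner -(integralZl measurableT ia) -(integralD measurableT ipa ib).
by apply: eq_integral => x _; rewrite -EFinM -EFinD mulrDl mulrA.
Qed.

Lemma square_integrable_lin (p : R) a b : square_integrable a -> square_integrable b ->
  square_integrable (fun x => p * a x + b x).
Proof.
move=> /square_integrableC La /square_integrableC Lb; apply/square_integrableC.
have := L2_comb p%:C La Lb; congr (L2 m).
by apply/funext => x; rewrite rmorphD rmorphM.
Qed.

Lemma inner_lim (u : nat -> X2 -> R) a w : square_integrable a -> (forall n, square_integrable (u n)) ->
  square_integrable w -> (forall n, inner (u n) w = 0%E) ->
  (forall e : R, 0 < e -> exists n, (\int[m]_x ((u n x - a x) ^+ 2)%:E <= e%:E)%E) ->
  inner a w = 0%E.
Proof.
move=> sa su sw u0 ua.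
have sub n : inner a w = inner (fun x => a x - u n x) w.
  have ia := integrable_mul sa sw; have iu := integrable_mul (su n) sw.
  rewrite /inner; under [RHS]eq_integral do rewrite mulrBl EFinB.
  by rewrite integralB// [X in (_ - X)%E]u0 sube0.
apply/eqP; rewrite -abse_eq0.
have [mw fw] := sw; have [ma _] := sa.
pose W := fine (\int[m]_x (w x ^+ 2)%:E)%E.
have WE : (\int[m]_x (w x ^+ 2)%:E)%E = W%:E.
  by rewrite fineK// ge0_fin_numE//; apply: integral_ge0 => x _; rewrite lee_fin sqr_ge0.
have W0 : 0 <= W by rewrite fine_ge0//; apply: integral_ge0 => x _; rewrite lee_fin sqr_ge0.
rewrite eq_le abse_ge0 andbT; apply/lee_addgt0Pr => e e0; rewrite add0e.
(* This weight makes the term in [w] at most [e / 2], and the distance [e / 2 / k] does the same for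
   the other term. The summand 1 covers the case [W = 0]. *)
pose k := 2 * (W + 1) / e.
have k0 : 0 < k by rewrite divr_gt0// mulr_gt0// ltr_wpDl.
have e'0 : 0 < e / 2 / k by rewrite divr_gt0// divr_gt0.
have [n un] := ua _ e'0; have [mun _] := su n.
have mau : measurable_fun setT (fun x => a x - u n x) by exact: measurable_funB.
rewrite (sub n); apply: le_trans (le_abse_integral _ measurableT (measurable_mul mau mw)) _.
apply: le_trans (integral_mul_le k0 mau mw) _; rewrite WE.
apply: (@le_trans _ _ (k%:E * (e / 2 / k)%:E + (k^-1)%:E * W%:E)%E).
  apply: leeD => //; apply: lee_wpmul2l; [by rewrite lee_fin ltW|apply: le_trans un].
  by rewrite le_eqVlt; apply/orP; left; apply/eqP/eq_integral => x _; rewrite -sqrrN opprB.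
rewrite -!EFinM -EFinD lee_fin mulrC divfK ?gt_eqF//.
have : k^-1 * W <= e / 2.
  rewrite /k invf_div mulrAC ler_pdivrMr ?mulr_gt0 ?ltr_wpDl//.
  by nra.
by lra.
Qed.

Variables (f0 w0 : X2 -> R).
Hypotheses (sf : square_integrable f0) (sw : square_integrable w0).
Hypotheses (f0_neq0 : norm2 m (fun x => (f0 x)%:C) <> 0%E)
           (w0_neq0 : norm2 m (fun x => (w0 x)%:C) <> 0%E).
Hypothesis orth : forall t, inner f0 (rtranslate t w0) = 0%E.

(* The orthogonal complement of the orbit of [w0]. *)
Let V : set (X2 -> R[i]) := [set f | L2 m f /\ forall t,
  inner (fun x => Re (f x)) (rtranslate t w0) = 0%E /\
  inner (fun x => Im (f x)) (rtranslate t w0) = 0%E].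

Let swt t : square_integrable (rtranslate t w0).
Proof. exact: square_integrable_rtranslate. Qed.

Let inner0 w : inner (cst 0) w = 0%E.
Proof. by rewrite /inner; under eq_integral do rewrite mul0r; exact: integral0. Qed.

Let closed_V : closed_subspace m V.
Proof.
split.
- by move=> f [].
- by split=> [|t]; [exact: L2_0|split; exact: inner0].
- move=> z f g [Lf Vf] [Lg Vg]; split=> [|t]; first exact: L2_comb.
  have [f1 f2] := Vf t; have [g1 g2] := Vg t.
  have rf := square_integrable_Re Lf; have jf := square_integrable_Im Lf.
  have rg := square_integrable_Re Lg; have jg := square_integrable_Im Lg.
  split.
    have E x : Re (z * f x + g x) = Re z * Re (f x) + (- Im z * Im (f x) + Re (g x)).
      by rewrite ReD ReM mulNr addrA.
    rewrite (_ : (fun x => _) = (fun x => Re z * Re (f x) + (- Im z * Im (f x) + Re (g x))));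
      last exact/funext.
    by rewrite !inner_lin ?f1 ?f2 ?g1 ?mule0 ?adde0//; exact: square_integrable_lin.
  have E x : Im (z * f x + g x) = Re z * Im (f x) + (Im z * Re (f x) + Im (g x)).
    by rewrite ImD ImM addrA.
  rewrite (_ : (fun x => _) = (fun x => Re z * Im (f x) + (Im z * Re (f x) + Im (g x))));
    last exact/funext.
  by rewrite !inner_lin ?f1 ?f2 ?g2 ?mule0 ?adde0//; exact: square_integrable_lin.
- move=> u f Vu Lf uf; split=> // t.
  have Lu n : L2 m (u n) by have [] := Vu n.
  have small (e : R) : 0 < e -> exists n, (norm2 m (fun x => (u n x - f x)%R) <= e%:E)%E.
    move=> e0; move/fine_cvgP : uf => [ufin /cvgr_le/(_ _ e0) ue].
    near \oo => n; exists n.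
    have fn : norm2 m (fun x => (u n x - f x)%R) \is a fin_num by near: n; exact: ufin.
    rewrite -(fineK fn) lee_fin; near: n; exact: ue.
  have [/L2P[mf _] mu_] := (Lf, fun n => proj1 ((L2P _ _).1 (Lu n))).
  split.
    apply: (@inner_lim (fun n x => Re (u n x))) => //; first exact: square_integrable_Re.
    + by move=> n; exact: square_integrable_Re.
    + by move=> n; have [_ /(_ t)[]] := Vu n.
    + move=> e /small[n un]; exists n; apply: le_trans un.
      apply: ge0_le_integral => //.
      * by move=> x _; rewrite lee_fin sqr_ge0.
      * apply: measurable_sqr; apply: measurable_funB; first by have [] := mu_ n.
        by have [] := mf.
      * exact: (measurable_sqr_norm (cmeasurableB (mu_ n) mf)).
      * by move=> x _; rewrite lee_fin /sqr_norm ReB lerDl sqr_ge0.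
  apply: (@inner_lim (fun n x => Im (u n x))) => //; first exact: square_integrable_Im.
  + by move=> n; exact: square_integrable_Im.
  + by move=> n; have [_ /(_ t)[]] := Vu n.
  + move=> e /small[n un]; exists n; apply: le_trans un.
    apply: ge0_le_integral => //.
    * by move=> x _; rewrite lee_fin sqr_ge0.
    * apply: measurable_sqr; apply: measurable_funB; first by have [] := mu_ n.
      by have [] := mf.
    * exact: (measurable_sqr_norm (cmeasurableB (mu_ n) mf)).
    * by move=> x _; rewrite lee_fin /sqr_norm ImB lerDr sqr_ge0.
Unshelve. all: by end_near. Qed.

Let translate_V s f : V f -> V (translate s f).
Proof.
move=> [Lf Vf]; split=> [|t]; first exact: L2_translate.
rewrite -(mul1g t) -(mulgV s) -mulgA -rtranslateM.
have [h1 h2] := Vf (s^-1 * t)%g.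
have rf := square_integrable_Re Lf; have jf := square_integrable_Im Lf.
split.
  rewrite -h1 -(inner_rtranslate s rf (swt _)); congr inner.
  by apply/funext => x; rewrite Re_translate.
rewrite -h2 -(inner_rtranslate s jf (swt _)); congr inner.
by apply/funext => x; rewrite Im_translate.
Qed.

Let cmeasurable_T_rep t f : cmeasurable f -> cmeasurable (T_rep m t f).
Proof.
move=> [fr fi]; apply: cmeasurableM.
  apply: cmeasurableC; apply: measurableT_comp.
    by apply: continuous_measurable_fun; exact: sqrt_continuous.
  apply: measurableT_comp => //.
  apply: measurable_int (@Radon_Nikodym_integrable _ _ _
    (charge_of_finite_measure (distribution m (R_act t))) m _).
  exact: (density_dominates (measurable_density mu t) (image_density alpha_gt0 t)).
by split; [apply: (measurableT_comp fr)|apply: (measurableT_comp fi)]; exact: measurable_R_act.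
Qed.

(** The orthogonal complement contains [f0], hence is not zero; it does not contain [w0], which is
    not orthogonal to itself, hence is not [L2]. *)
Lemma not_irreducible : ~ irreducible m (T_rep m).
Proof.
move=> irr; have [|V0|VL] := irr V closed_V.
- move=> t f Vf; have [Lf _] := Vf; have /L2P[mf _] := Lf.
  have [Lt _] := translate_V t Vf; have /L2P[mt ft] := Lt.
  apply: (closed_ae closed_V (translate_V t Vf)).
    apply/L2P; split; first exact: cmeasurable_T_rep.
    rewrite /norm2 (_ : (\int[m]_x _)%E = norm2 m (translate t f))//.
    apply: ae_eq_integral => //.
    + by apply: measurable_sqr_norm; exact: cmeasurable_T_rep.
    + exact: measurable_sqr_norm.
    + by apply: filterS (T_rep_ae alpha_gt0 t f) => x -> _.
  by apply: filterS (T_rep_ae alpha_gt0 t f) => x ->.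
- apply: f0_neq0; have Vf0 : V (fun x => (f0 x)%:C).
    split=> [|t]; first exact/square_integrableC.
    by split; [exact: orth|exact: inner0].
  transitivity (\int[m]_x (cst 0%E x : \bar R))%E; last exact: integral0.
  apply: ae_eq_integral => //.
    by apply: measurable_sqr_norm; apply: cmeasurableC; have [] := sf.
  by apply: filterS (V0 _ Vf0) => x -> _; rewrite sqr_normC expr0n.
- apply: w0_neq0; have : V (fun x => (w0 x)%:C) by rewrite VL; exact/square_integrableC.
  move=> [_ /(_ 1%g)[h _]]; rewrite -h rtranslate1.
  by apply: eq_integral => x _; rewrite sqr_normC expr2.
Qed.

End orthogonality.

(** The Lebesgue decomposition of [k] with respect to [m]: [B] has the least [k]-measure among the
    sets that are conull for [m]. Removing an [m]-null set from [B] leaves a set of this kind, so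
    the removed part is [k]-null. *)
Lemma minimal_conull_set d (T : measurableType d) (R : realType)
    (m k : {finite_measure set T -> \bar R}) :
  exists B, [/\ measurable B, m (~` B) = 0%E &
    forall A, measurable A -> m A = 0%E -> k (A `&` B) = 0%E].
Proof.
pose S := [set k B | B in [set B | measurable B /\ m (~` B) = 0%E]].
have S0 y : S y -> (0 <= y)%E by move=> [B _ <-].
have fk A : measurable A -> k A \is a fin_num by exact: fin_num_measure.
have ST : S (k setT) by exists setT => //=; rewrite setCT measure0.
have fi : ereal_inf S \is a fin_num.
  rewrite ge0_fin_numE; last exact: le_ereal_inf_tmp.
  by apply: le_lt_trans (ereal_inf_lbound ST) _; rewrite ltey_eq fk.
have /choice[B BP] n : exists B, [/\ measurable B, m (~` B) = 0%E &
    (k B < ereal_inf S + (n.+1%:R^-1)%:E)%E].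
  have n0 : 0 < n.+1%:R^-1 :> R by rewrite invr_gt0.
  by have [_ [B [mB B0] <-] kB] := lb_ereal_inf_adherent n0 fi; exists B.
have mB n : measurable (B n) by have [] := BP n.
have mBB : measurable (\bigcap_n B n) by exact: bigcapT_measurable.
have B0 : m (~` \bigcap_n B n) = 0%E.
  rewrite setC_bigcap; apply/eqP; rewrite eq_le measure_ge0 andbT.
  have mC n : measurable (~` B n) by exact: measurableC.
  have mU : measurable (\bigcup_n ~` B n) by exact: bigcupT_measurable.
  have := measure_sigma_subadditive m mC mU (@subset_refl _ _).
  by rewrite eseries0// => n _ _; have [_ + _] := BP n.
have kB : k (\bigcap_n B n) = ereal_inf S.
  apply/eqP; rewrite eq_le; apply/andP; split; last first.
    by apply: ereal_inf_lbound; exists (\bigcap_n B n).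
  apply/lee_addgt0Pr => e e0.
  have [n ne] : exists n, n.+1%:R^-1 < e.
    by have [n _ /(_ n (leqnn n))] := near_infty_natSinv_lt (PosNum e0); exists n.
  have [_ _ kn] := BP n.
  apply: (@le_trans _ _ (k (B n))).
    by apply: le_measure; rewrite ?inE//; exact: bigcap_inf.
  by apply: (le_trans (ltW kn)); rewrite leeD2l// lee_fin ltW.
exists (\bigcap_n B n); split=> // A mA A0; set C := \bigcap_n B n in mBB B0 kB *.
have mD : measurable (C `\` A) by exact: measurableD.
have mI : measurable (C `&` A) by exact: measurableI.
have le : (k C <= k (C `\` A))%E.
  rewrite kB; apply: ereal_inf_lbound; exists (C `\` A) => //; split=> //.
  apply/eqP; rewrite eq_le measure_ge0 andbT setCD.
  apply: le_trans (measureU2 _ _ _) _ => //; first exact: measurableC.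
  by rewrite -[leRHS]adde0; apply: leeD; [rewrite -B0|rewrite -A0].
move: le; rewrite (measureDI _ mBB mA) -[leRHS]adde0 leeD2lE ?fk// => h.
by apply/eqP; rewrite setIC eq_le measure_ge0 andbT.
Qed.

Lemma ge0_integral_density_on d (T : measurableType d) (R : realType)
    (mu : {sigma_finite_measure set T -> \bar R}) (nu : {finite_measure set T -> \bar R})
    (D : T -> R) (A : set T) (h : T -> R) :
  measurable_fun setT D -> has_density mu nu D -> measurable A ->
  measurable_fun setT h -> (forall x, 0 <= h x) ->
  (\int[nu]_(x in A) (h x)%:E = \int[mu]_(x in A) (h x * D x)%:E)%E.
Proof.
move=> mD nuD mA mh h0; rewrite integral_mkcond [RHS]integral_mkcond.
rewrite (ge0_integral_density mD nuD).
- by apply: eq_integral => x _; rewrite !patchE; case: ifP; rewrite ?mul0e ?EFinM.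
- by apply/(measurable_restrictT _ mA)/measurable_funTS/measurable_EFinP.
- by move=> x; rewrite patchE; case: ifP => // _; rewrite lee_fin.
Qed.

Section quasi_invariant.
Variables (R : realType) (m : probability X2 R) (D : B0 -> X2 -> R).
Hypothesis mD : forall t, measurable_fun setT (D t).
Hypothesis m_density : forall t, has_density m (distribution m (R_act t)) (D t).

Lemma null_rmul t A : measurable A -> m A = 0%E -> m ((fun x => rmul x t) @^-1` A) = 0%E.
Proof.
move=> mA A0; rewrite -[LHS]/(m (fun x => A (rmul x t))).
have := m_density t^-1%g mA; rewrite null_set_integral//.
  by move=> <-; congr (m _); apply/funext => x; rewrite /= /preimage /mkset R_actE invgK.
by apply/measurable_EFinP; exact: measurable_funTS.
Qed.

End quasi_invariant.

Section absolute_continuity.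
Variables (R : realType) (m k : probability X2 R) (D D' : B0 -> X2 -> R).
Hypotheses (mD : forall t, measurable_fun setT (D t))
           (mD' : forall t, measurable_fun setT (D' t)).
Hypotheses (D_ge0 : forall t x, 0 <= D t x) (D'_ge0 : forall t x, 0 <= D' t x).
Hypotheses (m_density : forall t, has_density m (distribution m (R_act t)) (D t))
           (k_density : forall t, has_density k (distribution k (R_act t)) (D' t)).
Hypothesis cover : forall A (e : R), measurable A -> (0 < k A)%E -> 0 < e -> e <= 1 ->
  exists ts : seq B0, (k (~` \big[setU/set0]_(t <- ts) ((fun x => rmul x t) @^-1` A)) <= e%:E)%E.
Hypothesis nonsingular : ~ mutually_singular k m.

(* By [cover], a set of positive measure which the group leaves invariant up
   to null sets is conull; this applies to the part of [k] which is absolutely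
   continuous with respect to [m]. *)
Lemma nonsingular_dominates : k `<< m.
Proof.
have [B [mB B0 Bk]] := minimal_conull_set m k.
have mr t A : measurable A -> measurable ((fun x => rmul x t) @^-1` A).
  by move=> mA; rewrite -[Y in measurable Y]setTI; exact: measurable_rmul.
have kB : (0 < k B)%E.
  rewrite lt0e measure_ge0 andbT; apply/eqP => kB0; apply: nonsingular.
  by exists B.
(* The points of [B] that [t^-1] moves out of [B] form an [m]-null set inside [B], hence a [k]-null
   set; quasi-invariance of [k] then moves it back by [t]. *)
have inv t : k ((fun x => rmul x t) @^-1` B `\` B) = 0%E.
  have mC : measurable (B `&` ((fun x => rmul x t^-1%g) @^-1` ~` B)).
    by apply: measurableI => //; apply: mr; exact: measurableC.
  rewrite (_ : _ `\` _ = (fun x => rmul x t) @^-1` (B `&` ((fun x => rmul x t^-1%g) @^-1` ~` B))).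
    apply: (null_rmul mD' k_density) => //; rewrite setIC; apply: Bk.
      by apply: mr; exact: measurableC.
    by apply: (null_rmul mD m_density) => //; exact: measurableC.
  by apply/seteqP; split=> x [/= xB nB]; split=> //; move: nB; rewrite ?rmulK.
have kBC : k (~` B) = 0%E.
  apply/eqP; rewrite eq_le measure_ge0 andbT; apply/lee_addgt0Pr => e e0; rewrite add0e.
  have [||ts kts] := cover mB kB (_ : 0 < Num.min e 1); rewrite ?lt_min ?e0 ?ltr01//.
    by rewrite ge_min lexx orbT.
  have {}kts : (k (~` \big[setU/set0]_(t <- ts) ((fun x => rmul x t) @^-1` B)) <= e%:E)%E.
    by apply: (le_trans kts); rewrite lee_fin ge_min lexx.
  set U := \big[setU/set0]_(t <- ts) _ in kts.
  have mU : measurable U by apply: bigsetU_measurable => t _; exact: mr.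
  have kUB : k (U `\` B) = 0%E.
    rewrite /U; elim: ts {U kts mU} => [|t ts IH]; first by rewrite big_nil set0D measure0.
    rewrite big_cons setDUl; apply/eqP; rewrite eq_le measure_ge0 andbT.
    have mV : measurable (\big[setU/set0]_(j <- ts) ((fun x => rmul x j) @^-1` B)).
      by apply: bigsetU_measurable => j _; exact: mr.
    apply: le_trans (measureU2 _ _ _) _; [by apply: measurableD => //; exact: mr|exact: measurableD|].
    by rewrite -[leRHS]adde0; apply: leeD; [rewrite -(inv t)|rewrite -IH].
  have sub : ~` B `<=` ~` U `|` (U `\` B).
    by move=> x nB; have [Ux|] := pselect (U x); [right|left].
  apply: (@le_trans _ _ (k (~` U `|` (U `\` B)))).
    apply: le_measure; rewrite ?inE//; first exact: measurableC.
    by apply: measurableU; [exact: measurableC|exact: measurableD].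
  apply: le_trans (measureU2 _ _ _) _; [exact: measurableC|exact: measurableD|].
  by rewrite -[leRHS]adde0; apply: leeD => //; rewrite -kUB.
apply/null_content_dominatesP => A mA A0.
apply/eqP; rewrite eq_le measure_ge0 andbT.
rewrite (measureDI _ mA mB) -[leRHS]adde0; apply: leeD; last by rewrite -(Bk A).
rewrite -kBC; apply: le_measure; rewrite ?inE//.
- exact: measurableD.
- exact: measurableC.
Qed.

Lemma nonsingular_density : exists h : X2 -> R,
  [/\ measurable_fun setT h, forall x, 0 <= h x & has_density m k h].
Proof.
have km := nonsingular_dominates.
have ff := Radon_Nikodym_SigmaFinite.f_fin_num km.
exists (fun x => fine (Radon_Nikodym_SigmaFinite.f k m x)); split.
- apply: measurableT_comp => //.
  exact: measurable_int (Radon_Nikodym_SigmaFinite.f_integrable km).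
- by move=> x; rewrite fine_ge0// Radon_Nikodym_SigmaFinite.f_ge0.
- move=> A mA; rewrite (Radon_Nikodym_SigmaFinite.f_integral km)//.
  by apply: eq_integral => x _; rewrite fineK.
Qed.

Variable h : X2 -> R.
Hypotheses (mh : measurable_fun setT h) (h_ge0 : forall x, 0 <= h x) (kh : has_density m k h).

(** Both sides are densities with respect to [m] of the image of [k] under [R_act t]: on the left
    [k] is expressed by [m] before the translation, on the right after it. *)
Lemma density_cocycle t : {ae m, forall x, h (rmul x t) * D t x = D' t x * h x}.
Proof.
have mht : measurable_fun setT (fun x => h (rmul x t)).
  exact: (measurableT_comp mh (measurable_rmul t)).
have eqA A : measurable A ->
    (\int[m]_(x in A) (h (rmul x t) * D t x)%:E = \int[m]_(x in A) (D' t x * h x)%:E)%E.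
  move=> mA.
  have mA' : measurable ((fun x => rmul x t^-1%g) @^-1` A).
    by rewrite -[Y in measurable Y]setTI; exact: measurable_rmul.
  rewrite -(ge0_integral_density_on (mD t) (m_density t) mA mht (fun x => h_ge0 _)).
  rewrite -(ge0_integral_density_on mh kh mA (mD' t) (D'_ge0 t)) -k_density//.
  rewrite [RHS](kh mA') (ge0_integral_pushforward (@measurable_R_act t))//.
  - by apply: eq_integral => x _ /=; rewrite R_actE rmulVK.
  - exact/measurable_funTS/measurable_EFinP.
  - by move=> x _; rewrite lee_fin.
have mL : measurable_fun setT (fun x => (h (rmul x t) * D t x)%:E).
  by apply/measurable_EFinP; exact: measurable_funM.
have mR : measurable_fun setT (fun x => (D' t x * h x)%:E).
  by apply/measurable_EFinP; exact: measurable_funM.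
have : ae_eq m setT (fun x => (h (rmul x t) * D t x)%:E) (fun x => (D' t x * h x)%:E).
  apply: integral_ae_eq => //; last by move=> A _ mA; exact: eqA.
  apply/integrableP; split=> //; under eq_integral do rewrite gee0_abs ?lee_fin ?mulr_ge0//.
  rewrite eqA//; apply: (@le_lt_trans _ _ 1%E); last by rewrite ltry.
  apply: (@le_trans _ _ (distribution k (R_act t) setT)); last exact: probability_le1.
  by rewrite k_density// (ge0_integral_density_on mh kh measurableT (mD' t) (D'_ge0 t)).
by apply: filterS => x /(_ I)[].
Qed.

End absolute_continuity.

Section shear_reducible.
Variables (R : realType) (mu : nat -> nat -> probability 'F_2 R).
Hypothesis alpha_gt0 : forall (k n : nat) (r : 'F_2),
  (1 <= k <= 2)%N -> (k < n)%N -> 0 < alpha mu k n r.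
Local Notation m := (mu_alpha mu).
Local Notation density := (density mu).
Local Notation k := (distribution m L12).

Let ae_rmul t (P : X2 -> Prop) : {ae m, forall x, P x} -> {ae m, forall x, P (rmul x t)}.
Proof.
move=> [A [mA A0 PA]]; exists ((fun x => rmul x t) @^-1` A); split.
- by rewrite -[Y in measurable Y]setTI; exact: measurable_rmul.
- exact: (null_rmul (measurable_density mu) (image_density alpha_gt0)).
- by move=> x nP; exact: PA.
Qed.

Let measurable_densityL t : measurable_fun setT (fun x => density t (L12 x)).
Proof. exact: (measurableT_comp (measurable_density mu t) measurable_L12). Qed.

Let mL A : measurable A -> measurable (L12 @^-1` A).
Proof. by move=> mA; rewrite -[Y in measurable Y]setTI; exact: measurable_L12. Qed.

(** [L12] is an involution that commutes with right multiplications, so it carries the densities for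
    [m] to densities for [k]. *)
Let density_L12 t : has_density k (distribution k (R_act t)) (fun x => density t (L12 x)).
Proof.
move=> A mA; rewrite (ge0_integral_pushforward measurable_L12)//; last 2 first.
- by apply/measurable_EFinP; exact: measurable_funTS.
- by move=> x _; rewrite lee_fin density_ge0.
rewrite -[LHS]/(m (fun x => A (R_act t (L12 x)))).
transitivity (distribution m (R_act t) (L12 @^-1` A)).
  congr (m _); apply/funext => x; rewrite /preimage /mkset !R_actE.
  by rewrite rmul_L12.
rewrite image_density//; last exact: mL.
by apply: eq_integral => x _ /=; rewrite L12K.
Qed.

Let cover_L12 A (e : R) : measurable A -> (0 < k A)%E -> 0 < e -> e <= 1 ->
  exists ts : seq B0, (k (~` \big[setU/set0]_(t <- ts) ((fun x => rmul x t) @^-1` A)) <= e%:E)%E.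
Proof.
move=> mA A0 e0 e1; have [ts tsP] := translates_cover alpha_gt0 (mL mA) A0 e0 e1.
exists ts; apply: le_trans tsP; rewrite le_eqVlt; apply/orP; left; apply/eqP.
rewrite -[LHS]/(m _); congr (m _).
elim: ts => [|t ts IH]; first by rewrite !big_nil.
rewrite !big_cons !setCU -IH; apply/seteqP; split=> x [/= h1 h2]; split=> //.
  by move: h1; rewrite -rmul_L12.
by move: h1; rewrite rmul_L12.
Qed.

Lemma shear_not_irreducible :
  ~ mutually_singular (pushforward m L12) m -> ~ irreducible m (T_rep m).
Proof.
move=> nonsingular.
have [h [mh h_ge0 kh]] := nonsingular_density (measurable_density mu) measurable_densityL
  (image_density alpha_gt0) density_L12 cover_L12 nonsingular.
have cocycle := density_cocycle (measurable_density mu) measurable_densityL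
  (density_ge0 alpha_gt0)
  (fun t x => density_ge0 alpha_gt0 t (L12 x)) (image_density alpha_gt0) density_L12 mh h_ge0 kh.
have mhL : measurable_fun setT (fun x => h (L12 x)).
  exact: (measurableT_comp mh measurable_L12).
(* As [L12] is an involution, [h \o L12] is the density of [m] with respect to [k]; multiplied by
   [h] it is the density of [m] with respect to itself. *)
have hL : {ae m, forall x, h (L12 x) * h x = 1}.
  have eqA A : measurable A -> (\int[m]_(x in A) (h (L12 x) * h x)%:E = m A)%E.
    move=> mA; rewrite -(ge0_integral_density_on mh kh mA mhL (fun x => h_ge0 _)).
    rewrite (ge0_integral_pushforward measurable_L12)//.
    - transitivity (k (L12 @^-1` A)).
        rewrite kh; last exact: mL.
        by apply: eq_integral => x _ /=; rewrite L12K.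
      rewrite -[LHS]/(m (fun x => A (L12 (L12 x)))); congr (m _); apply/funext => x.
      by rewrite L12K.
    - exact/measurable_funTS/measurable_EFinP.
    - by move=> x _; rewrite lee_fin.
  have mhh : measurable_fun setT (fun x => (h (L12 x) * h x)%:E).
    by apply/measurable_EFinP; exact: measurable_funM.
  have : ae_eq m setT (fun x => (h (L12 x) * h x)%:E) (cst 1%E).
    apply: integral_ae_eq => //.
      apply/integrableP; split=> //; under eq_integral do rewrite gee0_abs ?lee_fin ?mulr_ge0//.
      rewrite eqA//; apply: le_lt_trans (ltry 1); exact: probability_le1.
    by move=> A _ mA; rewrite eqA// integral_cst// mul1e.
  by apply: filterS => x /(_ I)[].
(* As [h (L12 x)] is the inverse of [h x], the weight [Num.min 1 h] makes
   [F x dm] change sign under [L12], for every [t]. *)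
pose G x := Num.sqrt (Num.min 1 (h x)).
pose s x : R := if (entry 2 x).1 == 0 then 1 else -1.
have min0 x : 0 <= Num.min 1 (h x) by rewrite le_min ler01/=.
have G2 x : G x ^+ 2 = Num.min 1 (h x) by rewrite sqr_sqrtr.
have mmin : measurable_fun setT (fun x => Num.min 1 (h x)).
  by apply: measurable_minr => //; exact: measurable_cst.
have mG : measurable_fun setT G.
  by apply: measurableT_comp => //; apply: continuous_measurable_fun; exact: sqrt_continuous.
have ms : measurable_fun setT s.
  apply: (measurable_level entry_generate (N := 3)) => x y xy.
  by rewrite /s xy.
have s2 x : s x ^+ 2 = 1 by rewrite /s; case: ifP => _; rewrite ?sqrrN expr1n.
have int_min : (\int[m]_x (Num.min 1 (h x))%:E < +oo)%E.
  apply: (@le_lt_trans _ _ (\int[m]_x cst 1%E x)%E).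
    apply: (ge0_le_integral m measurableT) => //.
    - by move=> x _; rewrite lee_fin.
    - exact/measurable_EFinP.
    - by move=> x _; rewrite lee_fin ge_min lexx.
  by rewrite integral_cst// mul1e; apply: le_lt_trans (ltry 1); exact: probability_le1.
have sG : square_integrable mu G.
  by split=> //; under eq_integral do rewrite G2.
have ssG : square_integrable mu (fun x => s x * G x).
  split; first exact: measurable_funM.
  by under eq_integral do rewrite exprMn s2 mul1r G2.
have sL x : s (L12 x) = - s x.
  have E : (entry 2 (L12 x)).1 = (entry 2 x).1 + 1.
    by rewrite entry_L12; congr (_ + _); exact: entry2_2.
  rewrite /s E.
  by have [->|->] := F2_cases (entry 2 x).1; rewrite /= ?opprK.
(* If [Num.min 1 (h x)] were 0 almost everywhere, so would be [h], and [k] would have total mass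
   0. *)
have norm_neq0 : (\int[m]_x (Num.min 1 (h x))%:E)%E <> 0%E.
  have -> : (\int[m]_x (Num.min 1 (h x))%:E = \int[m]_x `|(Num.min 1 (h x))%:E|)%E.
    by apply: eq_integral => x _; rewrite gee0_abs// lee_fin.
  have mE : measurable_fun setT (fun x => (Num.min 1 (h x))%:E) by exact/measurable_EFinP.
  move=> /(ae_eq_integral_abs m measurableT mE) h0.
  have : k setT = 0%E.
    rewrite kh//; transitivity (\int[m]_x (cst 0%E x : \bar R))%E; last exact: integral0.
    apply: ae_eq_integral => //; first exact/measurable_EFinP.
    apply: filterS h0 => x /(_ I)[] e _; congr EFin; move: e.
    by rewrite /Num.min; case: ifP => // _ /eqP; rewrite oner_eq0.
  by rewrite probability_setT => /eqP; rewrite onee_eq0.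
apply: (@not_irreducible _ _ alpha_gt0 G (fun x => s x * G x)) => //.
- rewrite /norm2; under eq_integral do rewrite sqr_normC G2; exact: norm_neq0.
- rewrite /norm2; under eq_integral do rewrite sqr_normC exprMn s2 mul1r G2; exact: norm_neq0.
- move=> t; set w := rtranslate mu t _.
  have sw : square_integrable mu w by exact: square_integrable_rtranslate.
  have iF := integrable_mul sG sw.
  set F := fun x => (G x * w x)%:E in iF.
  have mF := measurable_int _ iF.
  have mFL : measurable_fun setT (F \o L12) by exact: (measurableT_comp mF measurable_L12).
  have iFL : m.-integrable (L12 @^-1` setT) ((F \o L12) \o L12).
    by rewrite (_ : (F \o L12) \o L12 = F)//; apply/funext => x /=; rewrite L12K.
  have ikFL : k.-integrable setT (F \o L12).
    exact: (integrable_pushforward measurable_L12 mFL iFL).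
  have eF : (\int[m]_x F x = (-1)%:E * \int[m]_x F x)%E.
    transitivity (\int[k]_x (F \o L12) x)%E.
      rewrite (integral_pushforward measurable_L12 mFL iFL)// preimage_setT.
      by apply: eq_integral => x _ /=; rewrite L12K.
    rewrite (integral_density mh kh ikFL) -(integralZl measurableT iF).
    apply: ae_eq_integral => //.
    + by apply: emeasurable_funM => //; exact/measurable_EFinP.
    + exact: measurable_funeM.
    have hLt := ae_rmul t hL.
    (* Applied with [a = h y] and [a' = h (L12 y)], for [y = x] and for [y = x t], this gives the
       behaviour of [G] under [L12]. *)
    have half (a a' : R) : 0 <= a -> a' * a = 1 ->
        Num.sqrt (Num.min 1 a') * Num.sqrt a = Num.sqrt (Num.min 1 a).
      move=> a0 aa'; rewrite [LHS]mulrC -sqrtrM// minr_pMr// mulr1 [a * _]mulrC aa'.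
      by rewrite minC.
    apply: filterS3 hL (cocycle t) hLt => x a1 a2 a3 _.
    rewrite /F/= -!EFinM; congr EFin.
    rewrite /w /rtranslate rmul_L12 sL /G -(half _ _ (h_ge0 x) a1) -(half _ _ (h_ge0 _) a3).
    have a4 : Num.sqrt (h (rmul x t)) * Num.sqrt (density t x) =
        Num.sqrt (density t (L12 x)) * Num.sqrt (h x).
      by rewrite -!sqrtrM ?a2// density_ge0.
    have a5 := sqr_sqrtr (h_ge0 x).
    ring: a4 a5.
  have fF : (\int[m]_x F x)%E \is a fin_num by exact: integrable_fin_num.
  move: eF; rewrite -[inner _ _ _]/(\int[m]_x F x)%E.
  by case: (\int[m]_x F x)%E fF => // r _; rewrite -EFinM => -[e]; congr EFin; lra.
Qed.
End shear_reducible.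

Section uniform_row_reducible.
Variables (R : realType) (mu : nat -> nat -> probability 'F_2 R).
Hypothesis alpha_gt0 : forall (k n : nat) (r : 'F_2),
  (1 <= k <= 2)%N -> (k < n)%N -> 0 < alpha mu k n r.
Local Notation m := (mu_alpha mu).

Definition uniform_row2 (k : nat) : nat -> probability 'F_2 R :=
  fun n => if k == 2%N then mu_inv : probability _ _ else mu k n.

Local Notation mu' := uniform_row2.
Local Notation k := (mu_alpha mu').

Let alpha'2 n r : alpha mu' 2 n r = 2^-1.
Proof. by have := @mu_invE R r => /(congr1 fine). Qed.

Let alpha'_gt0 (j n : nat) (r : 'F_2) :
  (1 <= j <= 2)%N -> (j < n)%N -> 0 < alpha mu' j n r.
Proof.
case: j => [//|[|[|//]]] _ jn; first exact: alpha_gt0.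
by rewrite alpha'2 invr_gt0.
Qed.

(** The first rows have the same law, with affinity 1 in each column, so the two Kakutani criteria
    involve the same products. *)
Lemma singular_uniform_row2 : mutually_singular k m ->
  mutually_singular (mu_row mu 2) (@mu_inv_row2 R).
Proof.
move=> /(kakutani entry_generate (entry_product_measure mu') (weight_ge0 mu')
  (entry_product_measure mu) (weight_ge0 mu)) h.
apply/(kakutani (row_cylinder_generate 2) (row_product_weight mu 2) (row_weight_ge0 mu 2)
  (row_product_weight mu' 2) (row_weight_ge0 mu' 2)).
suff E n : affinity (weight mu') (weight mu) n = affinity (row_weight mu 2) (row_weight mu' 2) n.
  by move: h; under eq_fun do under eq_bigr do rewrite E.
rewrite /affinity -[RHS]mul1r -(row_weight_sum1 mu 1 n) -sum_pairM.
apply: eq_bigr => v _; rewrite /weight -[row_weight mu' 1]/(row_weight mu 1).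
rewrite mulrACA -expr2 sqrtrM ?sqr_ge0// sqrtr_sqr ger0_norm ?row_weight_ge0//.
by rewrite [X in Num.sqrt X]mulrC.
Qed.

Let mass_row1 N x y : x.1 = y.1 -> mass mu' N x = mass mu' N y.
Proof.
move=> xy; apply: eq_bigr => n _; rewrite /weight /entry/= xy; congr (_ * _).
rewrite /row_weight; case: ltnP => n2; first by rewrite !alpha'2.
by rewrite !row_val_le.
Qed.

(** Right of the diagonal every entry of the second row has weight 1/2, whatever its value. *)
Let density_row1 t x y : x.1 = y.1 -> density mu' t x = density mu' t y.
Proof.
move=> xy; rewrite /density (mass_row1 _ xy); congr (_ / _).
by apply: mass_row1; rewrite /rmul/= xy.
Qed.

(** Adds 1 to [x_23], the first free entry of the second row; the uniform second row makes this
    preserve [k]. *)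
Let flip (x : X2) : X2 := (x.1, fun i => x.2 i + (val i == 3%N)%:R).

Let entry_flip n x : entry n (flip x) = ((entry n x).1, (entry n x).2 + (n == 3%N)%:R).
Proof.
rewrite /entry /flip/=; congr pair; rewrite /row_val.
case: insubP => [u _ <-//|]; rewrite -leqNgt => n2.
by case: (n =P 3%N) n2 => [->//|_ _]; rewrite /= addr0.
Qed.

Let flipK : involutive flip.
Proof.
by move=> x; apply: entry_inj => n; rewrite !entry_flip/= -addrA F2_addrr addr0.
Qed.

Let measurable_flip : measurable_fun setT flip.
Proof.
by apply: measurable_entry_map => n; exists n.+1 => x y xy; rewrite !entry_flip xy.
Qed.

Let measure_flip A : measurable A -> k (flip @^-1` A) = k A.
Proof.
pose fl : {mfun X2 >-> X2} := HB.pack flip (isMeasurableFun.Build _ _ _ _ flip measurable_flip).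
move=> mA; rewrite -[LHS]/(distribution k fl A).
apply: (fibers_measure_unique entry_generate (N0 := 0)) => //.
  by apply: le_lt_trans (ltry 1); exact: probability_le1.
move=> N a _; transitivity (k (fiber entry N (flip a))).
  rewrite -[LHS]/(k (flip @^-1` fiber entry N a)); congr (k _).
  apply/seteqP; split=> x /fiberP xa; apply/fiberP => n nN; have := xa n nN.
    by move=> e; rewrite -(flipK x) entry_flip e -entry_flip.
  by move=> e; rewrite -[a]flipK entry_flip e -entry_flip.
by rewrite mass_fiber [RHS](mass_fiber mu' N a); congr EFin; exact: mass_row1.
Qed.

Let g x : R := if (entry 3 x).2 == 0 then 1 else -1.

Let g2 x : g x ^+ 2 = 1. Proof. by rewrite /g; case: ifP => _; rewrite ?sqrrN expr1n. Qed.

Let mg : measurable_fun setT g.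
Proof. by apply: (measurable_level entry_generate (N := 4)) => x y xy; rewrite /g xy. Qed.

Let F t x : R := g x * Num.sqrt (density mu' t x).

Let mF t : measurable_fun setT (F t).
Proof.
apply: measurable_funM => //; apply: measurableT_comp.
  by apply: continuous_measurable_fun; exact: sqrt_continuous.
exact: measurable_density.
Qed.

Let integrable_F t : k.-integrable setT (EFin \o F t).
Proof.
apply: measurable_bounded_integrable => //.
  by apply: le_lt_trans (ltry 1); exact: probability_le1.
have [C DC] := density_bounded mu' t.
exists (Num.sqrt C); split; first exact: num_real.
move=> y Cy x _; apply: le_trans (ltW Cy).
rewrite normrM [`|Num.sqrt _|]ger0_norm ?sqrtr_ge0// /g.
by case: ifP => _; rewrite ?normrN normr1 mul1r ler_wsqrtr.
Qed.

(** [flip] preserves [k] and the density, which depends on the first row only, but changes the sign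
    of [g]. *)
Let integral_F t : (\int[k]_x (F t x)%:E = 0)%E.
Proof.
have FN x : F t (flip x) = - F t x.
  rewrite /F (@density_row1 t (flip x) x)// /g entry_flip/= -mulNr; congr (_ * _).
  by have [->|->] := F2_cases (row_val x.2 3); rewrite /= ?opprK.
have mFE : measurable_fun setT (EFin \o F t) by exact/measurable_EFinP.
have iFN : k.-integrable (flip @^-1` setT) ((EFin \o F t) \o flip).
  rewrite (_ : (EFin \o F t) \o flip = (fun x => - (EFin \o F t) x)%E); last first.
    by apply/funext => x /=; rewrite FN EFinN.
  by rewrite preimage_setT; apply: integrableN; exact: integrable_F.
have e : (\int[k]_x (F t x)%:E = (-1)%:E * \int[k]_x (F t x)%:E)%E.
  pose fl : {mfun X2 >-> X2} := HB.pack flip (isMeasurableFun.Build _ _ _ _ flip measurable_flip).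
  transitivity (\int[distribution k fl]_x (EFin \o F t) x)%E.
    by apply: eq_measure_integral => A mA _; exact: (esym (measure_flip mA)).
  rewrite (integral_pushforward measurable_flip mFE iFN)// preimage_setT.
  rewrite -(integralZl measurableT (integrable_F t)); apply: eq_integral => x _.
  by rewrite /= FN -EFinM mulN1r.
have fF : (\int[k]_x (F t x)%:E)%E \is a fin_num by exact: (integrable_fin_num measurableT (integrable_F t)).
by move: e; case: (\int[k]_x _)%E fF => // r _; rewrite -EFinM => -[e]; congr EFin; lra.
Qed.

(** By the cocycle identity, the inner product of [g * sqrt h] with a translate of [sqrt h] is the
    integral of [F t * h] against [m], that is, of [F t] against [k], which is 0. *)
Lemma uniform_row2_not_irreducible :
  ~ mutually_singular (mu_row mu 2) (@mu_inv_row2 R) -> ~ irreducible m (T_rep m).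
Proof.
move=> nonsingular.
have cover A (e : R) := @translates_cover _ _ alpha'_gt0 A e.
have [h [mh h_ge0 kh]] := nonsingular_density (measurable_density mu) (measurable_density mu')
  (image_density alpha_gt0) (image_density alpha'_gt0) cover
  (fun s => nonsingular (singular_uniform_row2 s)).
have cocycle := density_cocycle (measurable_density mu) (measurable_density mu')
  (density_ge0 alpha_gt0) (density_ge0 alpha'_gt0)
  (image_density alpha_gt0) (image_density alpha'_gt0) mh h_ge0 kh.
pose G x := Num.sqrt (h x).
have G2 x : G x ^+ 2 = h x by rewrite sqr_sqrtr.
have mG : measurable_fun setT G.
  by apply: measurableT_comp => //; apply: continuous_measurable_fun; exact: sqrt_continuous.
have int_h : (\int[m]_x (h x)%:E = 1)%E by rewrite -(kh _ measurableT); exact: (probability_setT k).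
have sG : square_integrable mu G.
  by split=> //; under eq_integral do rewrite G2; rewrite int_h ltry.
have sgG : square_integrable mu (fun x => g x * G x).
  split; first exact: measurable_funM.
  by under eq_integral do rewrite exprMn g2 mul1r G2; rewrite int_h ltry.
have neq0 : (\int[m]_x (h x)%:E)%E <> 0%E by rewrite int_h => /eqP; rewrite onee_eq0.
apply: (@not_irreducible _ _ alpha_gt0 (fun x => g x * G x) G) => //.
- rewrite /norm2; under eq_integral do rewrite sqr_normC exprMn g2 mul1r G2; exact: neq0.
- rewrite /norm2; under eq_integral do rewrite sqr_normC G2; exact: neq0.
- move=> t; rewrite -(integral_F t) (integral_density mh kh (integrable_F t)).
  have [mw _] := square_integrable_rtranslate alpha_gt0 t sG.
  apply: ae_eq_integral => //.
  + apply/measurable_EFinP; apply: measurable_funM => //; exact: measurable_funM.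
  + by apply: emeasurable_funM => //; exact/measurable_EFinP.
  apply: filterS (cocycle t) => x e _; rewrite /= -EFinM; congr EFin.
  have a4 : Num.sqrt (h (rmul x t)) * Num.sqrt (density mu t x) =
      Num.sqrt (density mu' t x) * Num.sqrt (h x).
    by rewrite -!sqrtrM ?e// density_ge0.
  have a5 := sqr_sqrtr (h_ge0 x).
  rewrite /rtranslate /G /F; ring: a4 a5.
Qed.

End uniform_row_reducible.

(** As [alpha mu 2 n 1 <= 1], divergence of [S_L12] forces that of the sum of the
    [1 - c_coef mu 1 n]. Both tail products then tend to 0, and one large [M] serves for both. *)
Lemma small_products (R : realType) (mu : nat -> nat -> probability 'F_2 R)
    (alpha_gt0 : forall (k n : nat) (r : 'F_2),
      (1 <= k <= 2)%N -> (k < n)%N -> 0 < alpha mu k n r) N (e : R) :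
  S_L12 mu = +oo%E -> S_L22 mu = +oo%E -> (2 < N)%N -> 0 < e ->
  exists M, [/\ (N < M)%N, \prod_(N <= n < M) c_coef mu 1 n <= e &
    \prod_(N <= n < M) c_coef mu 2 n <= e].
Proof.
move=> S1 S2 N2 e0.
have tail k : (1 <= k <= 2)%N -> (\sum_(3 <= n <oo) (1 - c_coef mu k n)%:E = +oo)%E ->
    \forall M \near \oo, \prod_(N <= n < M) c_coef mu k n <= e.
  (* The value 1 up to column 2 makes all factors positive: [c_coef_gt0] applies only right of the
     diagonal. *)
  move=> k12 Sk; pose c n := if (2 < n)%N then c_coef mu k n else 1.
  have k2 : (k <= 2)%N by case/andP: k12.
  have c0 n : 0 < c n.
    by rewrite /c; case: ltnP => // n2; apply: (c_coef_gt0 alpha_gt0) => //; exact: leq_ltn_trans n2.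
  have c1 n : c n <= 1 by rewrite /c; case: ifP => // _; exact: c_coef_le1.
  have cE n : (2 < n)%N -> c n = c_coef mu k n by rewrite /c => ->.
  have /(prod_cvg0P c0 c1) c_cvg : (\sum_(3 <= n <oo) (1 - c n)%:E = +oo)%E.
    rewrite -Sk; apply: congr_lim; apply/funext => M.
    by apply: eq_big_nat => n /andP[n3 _]; rewrite cE.
  have := prod_tail_small c0 N c_cvg e0; apply: filterS => M.
  rewrite (_ : \prod_(N <= n < M) c n = \prod_(N <= n < M) c_coef mu k n)//.
  by apply: eq_big_nat => n /andP[Nn _]; rewrite cE// (leq_trans N2).
have S1' : (\sum_(3 <= n <oo) (1 - c_coef mu 1 n)%:E = +oo)%E.
  move: S1; apply: (series_oo_le (C := 1)) => // n n3.
  have := alpha_sum1 mu 2 n; have := c_coef_le1 mu 1 n.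
  have a0 r : 0 <= alpha mu 2 n r by exact: fine_ge0.
  have := a0 0; have := a0 1; move=> *.
  by rewrite mul1r; apply/andP; split; nra.
near \oo => M; exists M; split.
- by near: M; exists N.+1.
- by near: M; exact: tail.
- by near: M; exact: tail.
Unshelve. all: by end_near. Qed.

Theorem theorem6p1 (R : realType) (mu : nat -> nat -> probability 'F_2 R)
    (alpha_gt0 : forall (k n : nat) (r : 'F_2),
      (1 <= k <= 2)%N -> (k < n)%N -> 0 < alpha mu k n r) :
  [/\ irreducible (mu_alpha mu) (T_rep (mu_alpha mu)) <->
        mutually_singular (pushforward (mu_alpha mu) L12) (mu_alpha mu) /\
        mutually_singular (mu_row mu 2) mu_inv_row2,
      mutually_singular (pushforward (mu_alpha mu) L12) (mu_alpha mu) <->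
        S_L12 mu = +oo%E &
      mutually_singular (mu_row mu 2) mu_inv_row2 <-> S_L22 mu = +oo%E].
Proof.
split; [|exact: singular_shear|exact: singular_inv].
split=> [irr|[s1 s2]].
  split; apply: contrapT => ns.
    exact: (shear_not_irreducible alpha_gt0 ns).
  exact: (uniform_row2_not_irreducible alpha_gt0 ns).
apply: (singular_irreducible alpha_gt0) => // N e N2 e0.
by apply: (small_products alpha_gt0) => //; [apply/(singular_shear alpha_gt0)|apply/(singular_inv alpha_gt0)].
Qed.
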